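(* Let $(\mathcal X,\mathcal Y_1,\mathcal Y_2,P_{Y_1,Y_2|X})$ be a memoryless physically degraded broadcast channel with finite alphabets, used without feedback, with an unreliable conference link of rate $C_{1,2}\ge 0$ from Decoder 1 to Decoder 2. Let $\mathcal R(C_{1,2})$ be the convex hull of all nonnegative rate triples $(R_1,R_2,R_2')$ satisfying $$R_1\le I(X;Y_1|U,V),$$ $$R_2\le I(U;Y_2),$$ $$R_2'\le \min\{I(V;Y_2|U)+C_{1,2},\ I(V;Y_1|U)\},$$ for some joint distribution of the form $P_{U,V,X,Y_1,Y_2}=P_{U,V}P_{X|U,V}P_{Y_1,Y_2|X}$, where $U,V$ take values in finite sets $\mathcal U,\mathcal V$ with $|\mathcal U|\le|\mathcal X|+3$ and $|\mathcal V|\le(|\mathcal X|+2)(|\mathcal X|+3)$. Then the capacity region with unreliable conference link of rate $C_{1,2}$ is $$\mathcal C(C_{1,2})=\mathcal R(C_{1,2}).$$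
   Context: Logarithms, entropies and mutual informations are in nats. A broadcast channel (BC) is a transition probability $P_{Y_1,Y_2|X}$ from the finite set $\mathcal X$ to $\mathcal Y_1\times\mathcal Y_2$ (finite sets). It is physically degraded if for every input distribution $P_X$ the Markov chain $X - Y_1 - Y_2$ holds, i.e. $P_XP_{Y_1,Y_2|X}=P_XP_{Y_1|X}P_{Y_2|Y_1}$. It is memoryless without feedback: $P(y_1^n,y_2^n|x^n)=\prod_{i=1}^nP_{Y_1,Y_2|X}(y_{1,i},y_{2,i}|x_i)$. Code. For positive integers $\nu_1,\nu_2,\nu_2',\nu_{1,2}$ let $\mathcal N_1=\{1,\dots,\nu_1\}$, $\mathcal N_2=\{1,\dots,\nu_2\}$, $\mathcal N_2'=\{1,\dots,\nu_2'\}$, $\mathcal N_{1,2}=\{1,\dots,\nu_{1,2}\}$. An $(n,\nu_1,\nu_2,\nu_2',\nu_{1,2},\epsilon)$ code for the BC with an unreliable conference link consists of an encoder $f:\mathcal N_1\times\mathcal N_2\times\mathcal N_2'\to\mathcal X^n$, a conference map $h:\mathcal Y_1^n\to\mathcal N_{1,2}$, and decoding maps $g_1:\mathcal Y_1^n\to\mathcal N_1$, $g_2:\mathcal Y_2^n\to\mathcal N_2$, $g_2':\mathcal Y_2^n\times\mathcal N_{1,2}\to\mathcal N_2'$, such that $P_e\le\epsilon$ and $P_e'\le\epsilon$. Here, with $S_e(m_1,m_2)=\{(y_1^n,y_2^n): g_1(y_1^n)\ne m_1 \text{ or } g_2(y_2^n)\ne m_2\}$ and $S_e'(m_1,m_2,m_2')=S_e(m_1,m_2)\cup\{(y_1^n,y_2^n):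 g_2'(y_2^n,h(y_1^n))\ne m_2'\}$, $P_e$ (resp. $P_e'$) is the average over all $(m_1,m_2,m_2')\in\mathcal N_1\times\mathcal N_2\times\mathcal N_2'$, with uniform weights $1/(\nu_1\nu_2\nu_2')$, of the probability of $S_e(m_1,m_2)$ (resp. $S_e'(m_1,m_2,m_2')$) when $f(m_1,m_2,m_2')$ is the channel input. ($R_1,R_2$ are rates always decoded by users 1, 2; $R_2'$ is the extra rate to user 2 if the link is present.) Achievability. A quadruple $(R_1,R_2,R_2',C_{1,2})$ of nonnegative reals is achievable if for every $\epsilon>0$, $\gamma>0$ and all sufficiently large $n$ there is an $(n,\nu_1,\nu_2,\nu_2',\nu_{1,2},\epsilon)$ code with $\nu_1\ge e^{n(R_1-\gamma)}$, $\nu_2\ge e^{n(R_2-\gamma)}$, $\nu_2'\ge e^{n(R_2'-\gamma)}$, $\nu_{1,2}\le e^{n(C_{1,2}+\gamma)}$. The capacity region $\mathcal C$ is the closure of the set of achievable quadruples, and $\mathcal C(C_{1,2})=\{(R_1,R_2,R_2'):(R_1,R_2,R_2',C_{1,2})\in\mathcal C\}$. *)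

(* Defs.v *)
From mathcomp Require Export all_boot all_order all_algebra.
From mathcomp Require Export all_classical all_reals all_analysis.

Set Implicit Arguments.
Unset Strict Implicit.
Unset Printing Implicit Defensive.

Export Order.TTheory GRing.Theory Num.Theory.
Export numFieldNormedType.Exports.

Local Open Scope classical_set_scope.
Local Open Scope ring_scope.

Definition pmf (R : realType) (T : finType) (p : T -> R) : Prop :=
  (forall t, 0 <= p t) /\ \sum_t p t = 1.

Definition transition (R : realType) (S T : finType) (K : S -> T -> R) : Prop :=
  forall s, pmf (K s).

(* The random variables on the finite probability space [(T, p)] are the
   functions with domain [T]; [law p f] is the pmf of [f]. *)
Definition law (R : realType) (T A : finType) (p : T -> R) (f : T -> A)
    (a : A) : R :=
  \sum_(t | f t == a) p t.

(* [P(f = a | g = b)], with value [0] when [P(g = b) = 0]. *)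
Definition cond_law (R : realType) (T A B : finType) (p : T -> R)
    (f : T -> A) (g : T -> B) (a : A) (b : B) : R :=
  law p (fun t => (f t, g t)) (a, b) / law p g b.

(* [ln] is the natural logarithm (nats). In the two sums below, the terms whose
   joint probability is [0] vanish, and in the other terms every denominator is
   positive: this is the convention [0 ln (0 / q) = 0]. *)
Definition mutual_info (R : realType) (T A B : finType) (p : T -> R)
    (f : T -> A) (g : T -> B) : R :=
  \sum_a \sum_b
    law p (fun t => (f t, g t)) (a, b) *
    ln (law p (fun t => (f t, g t)) (a, b) / (law p f a * law p g b)).

Definition cond_mutual_info (R : realType) (T A B C : finType) (p : T -> R)
    (f : T -> A) (g : T -> B) (h : T -> C) : R :=
  \sum_a \sum_b \sum_c
    law p (fun t => (f t, g t, h t)) (a, b, c) *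
    ln (cond_law p (fun t => (f t, g t)) h (a, b) c /
        (cond_law p f h a c * cond_law p g h b c)).

Section BroadcastChannel.

Variables (R : realType) (X Y1 Y2 : finType).

(* [W x (y1, y2)] is [P_{Y1,Y2|X}(y1, y2 | x)]. *)
Implicit Types W : X -> Y1 * Y2 -> R.

(* For every [P_X], [P_X P_{Y1,Y2|X} = P_X P_{Y1|X} P_{Y2|Y1}], where
   [P_{Y2|Y1}] is computed from the joint law [P_X P_{Y1,Y2|X}]. *)
Definition physically_degraded W : Prop :=
  forall PX : X -> R, pmf PX ->
  let p := fun t : X * (Y1 * Y2) => PX t.1 * W t.1 t.2 in
  forall x y1 y2,
    p (x, (y1, y2)) =
    PX x * (\sum_y2' W x (y1, y2')) *
    cond_law p (fun t => t.2.2) (fun t => t.2.1) y2 y1.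

Definition block_channel W (n : nat) (x : n.-tuple X)
    (y : n.-tuple Y1 * n.-tuple Y2) : R :=
  \prod_(i < n) W (tnth x i) (tnth y.1 i, tnth y.2 i).

(* The message set [{1, ..., nu}] is represented by ['I_nu]. *)
Record code (n nu1 nu2 nu2' nu12 : nat) := Code {
  enc : 'I_nu1 * 'I_nu2 * 'I_nu2' -> n.-tuple X ;
  conf : n.-tuple Y1 -> 'I_nu12 ;
  dec1 : n.-tuple Y1 -> 'I_nu1 ;
  dec2 : n.-tuple Y2 -> 'I_nu2 ;
  dec2' : n.-tuple Y2 * 'I_nu12 -> 'I_nu2' }.

Section Errors.

Variables (n nu1 nu2 nu2' nu12 : nat) (c : code n nu1 nu2 nu2' nu12).

Definition error_set (m1 : 'I_nu1) (m2 : 'I_nu2) :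
    {set n.-tuple Y1 * n.-tuple Y2} :=
  [set y | (dec1 c y.1 != m1) || (dec2 c y.2 != m2)]%SET.

Definition error_set' (m1 : 'I_nu1) (m2 : 'I_nu2) (m2' : 'I_nu2') :
    {set n.-tuple Y1 * n.-tuple Y2} :=
  (error_set m1 m2 :|: [set y | dec2' c (y.2, conf c y.1) != m2'])%SET.

Definition avg_error W : R :=
  (nu1 * nu2 * nu2')%:R^-1 *
  \sum_m1 \sum_m2 \sum_m2'
    \sum_(y in error_set m1 m2) block_channel W (enc c (m1, m2, m2')) y.

Definition avg_error' W : R :=
  (nu1 * nu2 * nu2')%:R^-1 *
  \sum_m1 \sum_m2 \sum_m2'
    \sum_(y in error_set' m1 m2 m2') block_channel W (enc c (m1, m2, m2')) y.

End Errors.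

Definition code_exists W (n nu1 nu2 nu2' nu12 : nat) (eps : R) : Prop :=
  [/\ (0 < nu1)%N, (0 < nu2)%N, (0 < nu2')%N & (0 < nu12)%N] /\
  exists c : code n nu1 nu2 nu2' nu12,
    avg_error c W <= eps /\ avg_error' c W <= eps.

(* Quadruples are nested pairs [(R1, R2, R2', C12)]. *)
Definition achievable W : set (R * R * R * R) :=
  [set q | let '(R1, R2, R2', C12) := q in
    [/\ 0 <= R1, 0 <= R2, 0 <= R2' & 0 <= C12] /\
    forall eps gamma : R, 0 < eps -> 0 < gamma ->
    \forall n \near \oo, exists nu1 nu2 nu2' nu12 : nat,
      code_exists W n nu1 nu2 nu2' nu12 eps /\
      [/\ expR (n%:R * (R1 - gamma)) <= nu1%:R,
          expR (n%:R * (R2 - gamma)) <= nu2%:R,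
          expR (n%:R * (R2' - gamma)) <= nu2'%:R &
          nu12%:R <= expR (n%:R * (C12 + gamma))]].

Definition capacity_region W : set (R * R * R * R) := closure (achievable W).

Definition capacity_region_at W (C12 : R) : set (R * R * R) :=
  [set r | let '(R1, R2, R2') := r in
    capacity_region W (R1, R2, R2', C12)].

(* [P_{U,V} P_{X|U,V} P_{Y1,Y2|X}]; a sample is [((u, v), x, (y1, y2))]. *)
Definition joint W (U V : finType) (PUV : U * V -> R)
    (PX_UV : U * V -> X -> R) : U * V * X * (Y1 * Y2) -> R :=
  fun t => let '(uv, x, y) := t in PUV uv * PX_UV uv x * W x y.

Definition single_letter_region W (C12 : R) : set (R * R * R) :=
  [set r | let '(R1, R2, R2') := r in
    [/\ 0 <= R1, 0 <= R2 & 0 <= R2'] /\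
    exists (U V : finType) (PUV : U * V -> R) (PX_UV : U * V -> X -> R),
      [/\ (#|U| <= #|X| + 3)%N, (#|V| <= (#|X| + 2) * (#|X| + 3))%N,
          pmf PUV & transition PX_UV] /\
      let p := joint W PUV PX_UV in
      let rv_u := fun t : U * V * X * (Y1 * Y2) => t.1.1.1 in
      let rv_v := fun t : U * V * X * (Y1 * Y2) => t.1.1.2 in
      let rv_x := fun t : U * V * X * (Y1 * Y2) => t.1.2 in
      let rv_y1 := fun t : U * V * X * (Y1 * Y2) => t.2.1 in
      let rv_y2 := fun t : U * V * X * (Y1 * Y2) => t.2.2 in
      [/\ R1 <= cond_mutual_info p rv_x rv_y1 (fun t => (rv_u t, rv_v t)),
          R2 <= mutual_info p rv_u rv_y2 &
          R2' <= Num.min (cond_mutual_info p rv_v rv_y2 rv_u + C12)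
                         (cond_mutual_info p rv_v rv_y1 rv_u)]].

(* The convex hull, as the intersection of the convex sets containing the
   single-letter region. [R^o] is [R] as a module over itself. *)
Definition rate_region W (C12 : R) : set (R * R * R) :=
  smallest (@convex_set R (R^o * R^o * R^o)%type) (single_letter_region W C12).

End BroadcastChannel.

(* Main.v *)
(* The single-letter region is already convex (a time-sharing index can be
   absorbed into U) and closed, so neither the convex hull nor the closure of the
   achievable set changes anything; it remains to bound it from both sides.

   Cardinality and closedness: all the rates are sums of homogeneous functionals
   of the measures x |-> P(u, v, x), so letters u and v can be reweighted as in
   Caratheodory's theorem. Preserving the input law and three functionals while
   minimizing the sum of P(u, v) H(Y2 | u, v) leaves |X| + 3 letters u; then |X| + 2
   letters v are enough for each u. On the resulting simplex the rates are
   continuous, hence approximate rates can be replaced by exact ones.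

   Converse: with U_i = (M2, Y2^(i-1)) and V_i = (M2', Y1^(i-1)), Fano's inequality
   and telescoping sums of entropies give the bounds. Degradedness enters through
   the fact that given Y1^(i-1), Y2^(i-1) is independent of the messages and Y1_i.

   Achievability: superposition coding u(m2), v(m2, m2'), x(m1, m2, m2'), where the
   conference link carries the index of a bin of m2'. Decoding compares the
   information density to a threshold: the true codeword passes by Chebyshev's
   inequality, a wrong one passes with probability at most exp(-threshold), and
   I(U; Y2) <= I(U; Y1) lets Decoder 1 recover m2. *)
Require Import Defs.
From mathcomp Require Import ring lra.

Set Implicit Arguments.
Unset Strict Implicit.
Unset Printing Implicit Defensive.

Local Open Scope classical_set_scope.
Local Open Scope ring_scope.

(** * Entropies on a finite probability space *)

(** The converse produces auxiliary variables whose alphabets grow with the block length, so a limit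
    cannot be taken directly: alphabets are reduced first, which puts all candidate laws in one
    compact simplex. For this the rates are expressed through [hent], which is homogeneous of degree
    one: reweighting a letter acts linearly and letters of mass zero contribute nothing. H(Y1 | X)
    is linear in the input law, so preserving that law fixes it at no extra cost. The letters v
    attached to different u are unrelated and can share names, hence |X| + 2 letters v serve all u
    at once. In the code, Decoder 1 recovers all three messages: the bin that it sends is a function
    of m2', and R2' <= I(V; Y1 | U) pays for this. Decoder 2 resolves what remains inside the bin
    from Y2. Every estimate for wrong messages counts [nu.-1] competitors and not [nu]: when a rate
    is below the tolerance gamma, the message set is a singleton and must contribute no error, even
    if the corresponding information is zero. *)

Lemma sum_pair (R : nmodType) (A B : finType) (F : A * B -> R) :
  \sum_z F z = \sum_a \sum_b F (a, b).
Proof.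
by rewrite (pair_big xpredT xpredT (fun a b => F (a, b))); apply: eq_bigr => -[].
Qed.

Lemma pmf_inhabited (R : realType) (T : finType) (p : T -> R) :
  pmf p -> exists t : T, True.
Proof.
case=> _ p1; case: (pickP (@predT T)) => [t _|T0]; first by exists t.
by move: p1; rewrite big_pred0 // => /eqP; rewrite eq_sym oner_eq0.
Qed.

Section Laws.
Variables (R : realType) (T : finType) (p : T -> R).
Hypothesis p_pmf : pmf p.
Implicit Types A B C : finType.

Let p_ge0 t : 0 <= p t. Proof. by case: p_pmf. Qed.

Lemma law_sum A (f : T -> A) (g : A -> R) :
  \sum_a law p f a * g a = \sum_t p t * g (f t).
Proof.
rewrite [RHS](partition_big f xpredT) //=; apply: eq_bigr => a _.
by rewrite /law big_distrl /=; apply: eq_bigr => t /eqP ->.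
Qed.

Lemma sum_law A (f : T -> A) : \sum_a law p f a = 1.
Proof.
under eq_bigr => a _ do rewrite -[law _ _ _]mulr1.
rewrite (law_sum f (fun=> 1)).
by under eq_bigr => t _ do rewrite mulr1; case: p_pmf.
Qed.

Lemma law_ge0 A (f : T -> A) a : 0 <= law p f a.
Proof. by apply: sumr_ge0. Qed.

Lemma law_pmf A (f : T -> A) : pmf (law p f).
Proof. by split; [exact: law_ge0 | exact: sum_law]. Qed.

Lemma le_law A (f : T -> A) t : p t <= law p f (f t).
Proof.
rewrite /law (bigD1 t) //= lerDl; exact: sumr_ge0.
Qed.

Lemma law_gt0 A (f : T -> A) t : 0 < p t -> 0 < law p f (f t).
Proof. by move=> /lt_le_trans; apply; exact: le_law. Qed.

Lemma law_comp A B (f : T -> A) (phi : A -> B) b :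
  law p (phi \o f) b = \sum_(a | phi a == b) law p f a.
Proof.
rewrite [RHS](eq_bigr (fun a => \sum_(t | (phi (f t) == b) && (f t == a)) p t)).
  rewrite /law (partition_big f (fun a => phi a == b)) //=.
move=> a /eqP phia; apply: eq_bigl => t.
by case: eqP => [->|]; rewrite ?phia ?eqxx ?andbF.
Qed.

Lemma law_fst A B (f : T -> A) (g : T -> B) a :
  law p f a = \sum_b law p (fun t => (f t, g t)) (a, b).
Proof.
rewrite /law (partition_big g xpredT) //=; apply: eq_bigr => b _.
Qed.

Lemma law_snd A B (f : T -> A) (g : T -> B) b :
  law p g b = \sum_a law p (fun t => (f t, g t)) (a, b).
Proof.
rewrite /law (partition_big f xpredT) //=; apply: eq_bigr => a _.
by apply: eq_bigl => t; rewrite xpair_eqE andbC.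
Qed.

Lemma eq_law A B (f : T -> A) (g : T -> B) a b :
  (forall t, (f t == a) = (g t == b)) -> law p f a = law p g b.
Proof. by move=> fg; apply: eq_bigl => t; rewrite fg. Qed.

Lemma le_expect (F G : T -> R) : (forall t, 0 < p t -> F t <= G t) ->
  \sum_t p t * F t <= \sum_t p t * G t.
Proof.
move=> FG; apply: ler_sum => t _.
have [pt|] := ltP 0 (p t); first by rewrite ler_pM2l // FG.
by move=> pt; rewrite (_ : p t = 0) ?mul0r //; apply/eqP; rewrite eq_le pt p_ge0.
Qed.

Lemma eq_expect (F G : T -> R) : (forall t, 0 < p t -> F t = G t) ->
  \sum_t p t * F t = \sum_t p t * G t.
Proof. by move=> FG; apply/eqP; rewrite eq_le !le_expect // => t /FG ->. Qed.

(** Jensen's inequality for [ln], from the tangent bound [ln r <= r - 1]; [cond_ent_le] rests on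
    it. *)
Lemma gibbs (r : T -> R) :
  (forall t, 0 < p t -> 0 < r t) -> \sum_t p t * r t <= 1 ->
  \sum_t p t * ln (r t) <= 0.
Proof.
move=> r_gt0 sum_le1.
apply: (@le_trans _ _ (\sum_t p t * (r t - 1))); last first.
  under eq_bigr => t _ do rewrite mulrBr mulr1.
  by rewrite sumrB; case: p_pmf => _ ->; rewrite subr_le0.
apply: le_expect => t pt.
have := @le_ln1Dx R (r t - 1); rewrite (addrC 1) subrK; apply.
by rewrite ltrBDl addrN r_gt0.
Qed.

(** Written as an expectation over sample points and not as a sum over values: it visibly depends
    only on the partition induced by [f] ([eq_ent]), so tuples can be reordered at will, and
    identities between entropies reduce to pointwise identities of logarithms. *)
Definition ent A (f : T -> A) : R := - \sum_t p t * ln (law p f (f t)).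

Lemma eq_ent A B (f : T -> A) (g : T -> B) :
  (forall t t', (f t == f t') = (g t == g t')) -> ent f = ent g.
Proof.
move=> fg; congr (- _); apply: eq_bigr => t _.
by rewrite (eq_law (fun t' => fg t' t)).
Qed.

(** Cross-entropy bound: a guessed sub-stochastic kernel [q] for [f] given [h] can only overestimate
    H(f | h), by [gibbs] applied to the ratio of [q] to the true conditional law. Conditioning, the
    bound by the logarithm of the cardinality and Fano's inequality are three choices of [q]. *)
Lemma cond_ent_le A C (f : T -> A) (h : T -> C) (q : A -> C -> R) :
  (forall a c, 0 <= q a c) -> (forall c, \sum_a q a c <= 1) ->
  (forall t, 0 < p t -> 0 < q (f t) (h t)) ->
  ent (fun t => (f t, h t)) - ent h <= - \sum_t p t * ln (q (f t) (h t)).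
Proof.
move=> q_ge0 q_le1 q_gt0.
pose fh t := (f t, h t).
pose r t := q (f t) (h t) * law p h (h t) / law p fh (fh t).
have r_gt0 t : 0 < p t -> 0 < r t.
  by move=> pt; rewrite divr_gt0 ?mulr_gt0 ?q_gt0 ?law_gt0.
have sum_le1 : \sum_t p t * r t <= 1.
  rewrite -(law_sum fh (fun z => q z.1 z.2 * law p h z.2 / law p fh z)).
  apply: (@le_trans _ _ (\sum_z q z.1 z.2 * law p h z.2)).
    apply: ler_sum => z _; have [->|nz] := eqVneq (law p fh z) 0.
      by rewrite mul0r mulr_ge0 // law_ge0.
    by rewrite mulrC divfK.
  rewrite sum_pair exchange_big /= -[X in _ <= X](sum_law h).
  apply: ler_sum => c _; rewrite -big_distrl /=.
  by rewrite -[X in _ <= X]mul1r ler_wpM2r // law_ge0.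
have := gibbs r_gt0 sum_le1.
have -> : \sum_t p t * ln (r t) = \sum_t p t * ln (q (f t) (h t))
    + \sum_t p t * ln (law p h (h t)) - \sum_t p t * ln (law p fh (fh t)).
  rewrite -big_split -sumrB /=.
  under [RHS]eq_bigr => t _ do rewrite -mulrDr -mulrBr.
  apply: eq_expect => t pt.
  have h0 := law_gt0 h pt; have fh0 := law_gt0 fh pt; have q0 := q_gt0 _ pt.
  by rewrite /r ln_div ?lnM ?posrE ?mulr_gt0.
rewrite /ent -/fh; lra.
Qed.

(** The guess for [f] given [(g, h)] is the law of [f] given [h] alone, whose cross-entropy is
    exactly H(f | h). *)
Lemma cond_ent_reduce A B C (f : T -> A) (g : T -> B) (h : T -> C) :
  ent (fun t => (f t, (g t, h t))) - ent (fun t => (g t, h t))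
  <= ent (fun t => (f t, h t)) - ent h.
Proof.
pose fh t := (f t, h t).
pose q a (c : B * C) := law p fh (a, c.2) / law p h c.2.
have := @cond_ent_le _ _ f (fun t => (g t, h t)) q.
have -> : - (\sum_t p t * ln (q (f t) (g t, h t))) = ent fh - ent h.
  rewrite /ent -/fh opprK addrC -opprB; congr (- _); rewrite -sumrB.
  under [RHS]eq_bigr => t _ do rewrite -mulrBr.
  apply: eq_expect => t pt.
  by rewrite /q /= ln_div ?posrE ?law_gt0 // (law_gt0 fh pt).
apply.
- by move=> a c; rewrite divr_ge0 ?law_ge0.
- move=> c; rewrite -big_distrl /= -(law_snd f h).
  by have [->|/divff ->] := eqVneq (law p h c.2) 0; rewrite ?mul0r ?ler01.
- by move=> t pt; rewrite /q /= divr_gt0 ?law_gt0.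
Qed.

(** The Markov chain f - h - g in cross-multiplied form, free of divisions. At sample points of
    positive probability its logarithm is the wanted identity. *)
Lemma cond_ent_markov A B C (f : T -> A) (g : T -> B) (h : T -> C) :
  (forall t, law p (fun t => (f t, (g t, h t))) (f t, (g t, h t))
             * law p h (h t) =
     law p (fun t => (f t, h t)) (f t, h t)
     * law p (fun t => (g t, h t)) (g t, h t)) ->
  ent (fun t => (f t, (g t, h t))) - ent (fun t => (g t, h t))
  = ent (fun t => (f t, h t)) - ent h.
Proof.
move=> mk.
suff : \sum_t p t * (ln (law p (fun t => (f t, (g t, h t))) (f t, (g t, h t)))
    + ln (law p h (h t)) - ln (law p (fun t => (f t, h t)) (f t, h t))
    - ln (law p (fun t => (g t, h t)) (g t, h t))) = \sum_t p t * 0.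
  under eq_bigr => t _ do rewrite !mulrBr mulrDr.
  rewrite -big_distrl /= mulr0 !sumrB big_split /ent /=; lra.
apply: eq_expect => t pt.
have /(congr1 (@ln R)) := mk t.
have l1 := law_gt0 (fun t => (f t, (g t, h t))) pt.
have l2 := law_gt0 h pt.
have l3 := law_gt0 (fun t => (f t, h t)) pt.
have l4 := law_gt0 (fun t => (g t, h t)) pt.
rewrite !lnM ?posrE // => e; lra.
Qed.

Lemma le_ent A B (f : T -> A) (g : T -> B) :
  (forall t t', f t = f t' -> g t = g t') -> ent g <= ent f.
Proof.
move=> fg; rewrite /ent lerN2; apply: le_expect => t pt.
rewrite ler_ln ?posrE ?law_gt0 // /law.
rewrite [X in _ <= X](bigID (fun t' => f t' == f t)) /=.
rewrite (eq_bigl (fun t' => (g t' == g t) && (f t' == f t))) ?lerDl ?sumr_ge0 //.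
by move=> t'; case: (eqVneq (f t') (f t)) => [/fg ->|]; rewrite ?eqxx ?andbF.
Qed.

Lemma ent_unit : ent (fun=> tt) = 0.
Proof.
rewrite /ent big1 ?oppr0 // => t _.
suff -> : law p (fun=> tt) tt = 1 by rewrite ln1 mulr0.
by case: p_pmf => _ <-; apply: eq_bigl.
Qed.

Lemma ent_pair_unit A (f : T -> A) : ent (fun t => (f t, tt)) = ent f.
Proof. by apply: eq_ent => t t'; rewrite xpair_eqE andbT. Qed.

Lemma ent_subadd A B (f : T -> A) (g : T -> B) :
  ent (fun t => (f t, g t)) <= ent f + ent g.
Proof.
have := cond_ent_reduce f g (fun=> tt).
rewrite ent_unit subr0 !ent_pair_unit.
rewrite (@eq_ent _ _ _ (fun t => (f t, g t))); first lra.
by move=> t t'; rewrite !xpair_eqE andbT.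
Qed.

Lemma ent_le_ln_card A (f : T -> A) : ent f <= ln #|A|%:R.
Proof.
have [t0 _] := pmf_inhabited p_pmf.
have A0 : (0 < #|A|)%N by apply/card_gt0P; exists (f t0).
have A0' : 0 < #|A|%:R :> R by rewrite ltr0n.
have := @cond_ent_le _ _ f (fun=> tt) (fun _ _ => #|A|%:R^-1).
rewrite ent_unit subr0 ent_pair_unit lnV ?posrE // => /(_ _ _ _)/le_trans; apply.
- by move=> *; rewrite invr_ge0 ler0n.
- by move=> _; rewrite sumr_const -[_ *+ _]mulr_natl divff ?gt_eqF.
- by move=> *; rewrite invr_gt0.
- by rewrite -big_distrl /=; case: p_pmf => _ ->; rewrite mul1r opprK.
Qed.

Lemma fano A B (f : T -> A) (h : T -> B) (g : B -> A) :
  ent (fun t => (f t, h t)) - ent h <=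
  ln 2 + (\sum_(t | g (h t) != f t) p t) * ln #|A|%:R.
Proof.
have [t0 _] := pmf_inhabited p_pmf.
have A0 : (0 < #|A|)%N by apply/card_gt0P; exists (f t0).
have A0' : 0 < #|A|%:R :> R by rewrite ltr0n.
(* The guess gives mass 1/2 to the decoded value and [(2 * #|A|)^-1] to each other value: its
   logarithmic cost is [ln 2] on success and [ln 2 + ln #|A|] on failure, so no binary entropy
   function appears. *)
pose q a c : R := if g c != a then (2 * #|A|%:R)^-1 else 2^-1.
have q_gt0 a c : 0 < q a c.
  by rewrite /q; case: ifP => _; rewrite invr_gt0 ?mulr_gt0.
have := @cond_ent_le _ _ f h q; move=> /(_ _ _ _)/le_trans; apply.
- by move=> a c; exact: ltW.
- move=> c; rewrite (bigD1 (g c)) //= {1}/q eqxx /=.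
  apply: (@le_trans _ _ (2^-1 + \sum_(a : A) (2 * #|A|%:R)^-1)).
    rewrite lerD2l [X in _ <= X](bigD1 (g c)) //=.
    apply: ler_wpDl; first by rewrite invr_ge0 mulr_ge0 ?ler0n.
    by apply: ler_sum => a ac; rewrite /q eq_sym ac.
  rewrite sumr_const -(mulr_natl (2 * _)^-1) (_ : _ * _ = 2^-1 :> R); first lra.
  by field; rewrite gt_eqF.
- by move=> *; exact: q_gt0.
have -> : - (\sum_t p t * ln (q (f t) (h t))) =
    \sum_t p t * (ln 2 + (g (h t) != f t)%:R * ln #|A|%:R).
  rewrite -sumrN; apply: eq_bigr => t _; rewrite -mulrN; congr (_ * _).
  rewrite /q; case: ifP => _; rewrite lnV ?posrE ?mulr_gt0 // opprK.
    by rewrite lnM ?posrE // mul1r.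
  by rewrite mul0r addr0.
under eq_bigr => t _ do rewrite mulrDr mulrA.
rewrite big_split /= -!big_distrl /=; case: p_pmf => _ ->; rewrite mul1r.
rewrite lerD2l [X in _ <= X * _]big_mkcond /=; under [X in _ <= X * _]eq_bigr => t _.
  rewrite (_ : (if _ then _ else _) = p t * (g (h t) != f t)%:R); last first.
    by case: ifP; rewrite ?mulr1 ?mulr0.
  over.
by [].
Qed.

Lemma mutual_info_ent A B (f : T -> A) (g : T -> B) :
  mutual_info p f g = ent f + ent g - ent (fun t => (f t, g t)).
Proof.
rewrite /mutual_info.
rewrite -(sum_pair (fun z => law p (fun t => (f t, g t)) z *
  ln (law p (fun t => (f t, g t)) z / (law p f z.1 * law p g z.2)))).
rewrite (law_sum _ (fun z => ln (law p
  (fun t => (f t, g t)) z / (law p f z.1 * law p g z.2)))) /=.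
rewrite /ent opprK addrC -opprD -big_split -sumrB /=.
under [RHS]eq_bigr => t _ do rewrite -mulrDr -mulrBr.
apply: eq_expect => t pt.
have l1 := law_gt0 (fun t => (f t, g t)) pt.
by rewrite ln_div ?lnM ?posrE ?mulr_gt0 ?law_gt0.
Qed.

Lemma cond_mutual_info_ent A B C (f : T -> A) (g : T -> B) (h : T -> C) :
  cond_mutual_info p f g h = ent (fun t => (f t, h t)) + ent (fun t => (g t, h t))
    - ent (fun t => (f t, g t, h t)) - ent h.
Proof.
rewrite /cond_mutual_info.
pose L z := ln (cond_law p (fun t => (f t, g t)) h z.1 z.2 /
        (cond_law p f h z.1.1 z.2 * cond_law p g h z.1.2 z.2)).
transitivity (\sum_z law p (fun t => (f t, g t, h t)) z * L z).
  by rewrite !sum_pair.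
rewrite law_sum; set S := LHS.
suff -> : S = \sum_t p t * (ln (law p (fun t => (f t, g t, h t)) (f t, g t, h t))
    + ln (law p h (h t)) - ln (law p (fun t => (f t, h t)) (f t, h t))
    - ln (law p (fun t => (g t, h t)) (g t, h t))).
  under eq_bigr => t _ do rewrite !mulrBr mulrDr.
  rewrite !sumrB big_split /ent /=; lra.
apply: eq_expect => t pt.
have l1 := law_gt0 (fun t => (f t, g t, h t)) pt.
have l2 := law_gt0 h pt.
have l3 := law_gt0 (fun t => (f t, h t)) pt.
have l4 := law_gt0 (fun t => (g t, h t)) pt.
rewrite /L /= /cond_law ln_div ?posrE ?lnM ?posrE ?divr_gt0 ?mulr_gt0 ?invr_gt0 //.
rewrite !lnV ?posrE //; ring.
Qed.

End Laws.

(** * Rates as functionals of the input law *)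

Definition xlnx (R : realType) (t : R) : R := t * ln t.

Lemma xlnx0 (R : realType) : xlnx 0 = 0 :> R.
Proof. exact: mul0r. Qed.

Lemma xlnxM (R : realType) (a b : R) : 0 <= a -> 0 <= b ->
  xlnx (a * b) = a * xlnx b + xlnx a * b.
Proof.
rewrite /xlnx le0r => /predU1P[->|a0]; first by rewrite !mul0r addr0.
rewrite le0r => /predU1P[->|b0]; first by rewrite !(mulr0, mul0r) addr0.
by rewrite lnM ?posrE //; ring.
Qed.

Lemma ent_xlnx (R : realType) (T A : finType) (p : T -> R) (f : T -> A) :
  ent p f = - \sum_a xlnx (law p f a).
Proof. by rewrite /ent /xlnx law_sum. Qed.

(* Homogeneous conditional entropy: for a measure [mu] of mass [c] this is [c]
   times the entropy of the output of [K] on the input law [mu / c]. *)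
Definition hent (R : realType) (X Y : finType) (K : X -> Y -> R) (mu : X -> R) : R :=
  xlnx (\sum_x mu x) - \sum_y xlnx (\sum_x mu x * K x y).

Lemma eq_hent (R : realType) (X Y : finType) (K : X -> Y -> R) (mu nu : X -> R) :
  mu =1 nu -> hent K mu = hent K nu.
Proof. by move=> /funext ->. Qed.

Lemma hent0 (R : realType) (X Y : finType) (K : X -> Y -> R) (mu : X -> R) :
  (forall x, mu x = 0) -> hent K mu = 0.
Proof.
move=> mu0; rewrite /hent big1 // xlnx0 big1 ?subr0 // => y _.
by rewrite big1 ?xlnx0 // => x _; rewrite mu0 mul0r.
Qed.

(** The Markov chain f - x - y with transition [K] from [x] to [y], in product form so that no law
    is divided by. *)
Definition channel_law (R : realType) (T A X Y : finType) (p : T -> R)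
    (K : X -> Y -> R) (f : T -> A) (x : T -> X) (y : T -> Y) : Prop :=
  forall a x0 y0, law p (fun t => (f t, x t, y t)) (a, x0, y0) =
    law p (fun t => (f t, x t)) (a, x0) * K x0 y0.

Section Channel.
Variables (R : realType) (X Y : finType) (K : X -> Y -> R).
Hypothesis K_tr : transition K.

Lemma transition_ge0 x y : 0 <= K x y.
Proof. by case: (K_tr x). Qed.

Lemma transition_sum x : \sum_y K x y = 1.
Proof. by case: (K_tr x). Qed.

(** The two terms in [xlnx c] cancel because a stochastic [K] preserves total mass. *)
Lemma hent_scale c (mu : X -> R) : 0 <= c -> (forall x, 0 <= mu x) ->
  hent K (fun x => c * mu x) = c * hent K mu.
Proof.
move=> c0 mu0; rewrite /hent -big_distrr /= xlnxM ?sumr_ge0 //.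
have -> : \sum_y xlnx (\sum_x c * mu x * K x y) =
    c * (\sum_y xlnx (\sum_x mu x * K x y)) + xlnx c * \sum_x mu x.
  under eq_bigr => y _.
    under eq_bigr => x _ do rewrite -mulrA.
    rewrite -big_distrr /= xlnxM //; last first.
      by apply: sumr_ge0 => x _; rewrite mulr_ge0 // transition_ge0.
    over.
  rewrite big_split /= -!big_distrr /=; congr (_ + _ * _).
  rewrite exchange_big /=; apply: eq_bigr => x _.
  by rewrite -big_distrr /= transition_sum mulr1.
ring.
Qed.

Variables (T : finType) (p : T -> R).
Hypothesis p_pmf : pmf p.


Lemma channel_law_comp (A B : finType) (f : T -> A) (x : T -> X) (y : T -> Y)
    (phi : A -> B) : channel_law p K f x y -> channel_law p K (fun t => phi (f t)) x y.
Proof.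
move=> ch b x0 y0.
pose psi (z : A * X * Y) := (phi z.1.1, z.1.2, z.2).
rewrite (law_comp p (fun t => (f t, x t, y t)) psi).
pose psi' (z : A * X) := (phi z.1, z.2).
rewrite (law_comp p (fun t => (f t, x t)) psi') big_distrl /=.
rewrite big_mkcond sum_pair /=.
rewrite [RHS]big_mkcond /=; apply: eq_bigr => -[a x1] _.
rewrite (bigD1 y0) //= big1 ?addr0 => [|y1 /negbTE y01].
  rewrite /psi' /psi /= !xpair_eqE eqxx andbT; case: ifP => // /andP[_ /eqP xx].
  by rewrite ch xx.
by rewrite /psi /= !xpair_eqE y01 andbF.
Qed.

Lemma hent_law (A : finType) (f : T -> A) (x : T -> X) (y : T -> Y) :
  channel_law p K f x y ->
  ent p (fun t => (f t, y t)) - ent p f =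
  \sum_a hent K (fun x0 => law p (fun t => (f t, x t)) (a, x0)).
Proof.
move=> ch; rewrite !ent_xlnx opprK addrC /hent sumrB; congr (_ - _).
  by apply: eq_bigr => a _; rewrite (law_fst p f x).
rewrite sum_pair; apply: eq_bigr => a _; apply: eq_bigr => y0 _; congr xlnx.
rewrite (law_snd p x); apply: eq_bigr => x0 _; rewrite -ch.
apply: eq_law => // t; rewrite !xpair_eqE.
by rewrite andbA [(_ == x0) && _]andbC.
Qed.

(** Given the input, the output ignores [f]: conditioning on the pair leaves scaled point masses,
    and by homogeneity the sum collapses to H(Y | X). The result is linear in the law of [x], hence
    fixed as soon as the input law is. *)
Lemma hent_law_input (A : finType) (f : T -> A) (x : T -> X) (y : T -> Y) :
  channel_law p K f x y ->
  ent p (fun t => (f t, x t, y t)) - ent p (fun t => (f t, x t)) =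
  \sum_x0 law p x x0 * hent K (fun x1 => (x1 == x0)%:R).
Proof.
move=> ch.
rewrite (@hent_law _ (fun t => (f t, x t)) x y).
  transitivity (\sum_z law p (fun t => (f t, x t)) z * hent K (fun x1 => (x1 == z.2)%:R)).
    apply: eq_bigr => -[a x0] _ /=.
    rewrite -hent_scale ?law_ge0 //; apply: eq_hent => x1.
    have [->|x10] := eqVneq x1 x0.
      rewrite mulr1; apply: eq_law => t; rewrite !xpair_eqE.
      by case: (x t == x0); rewrite ?andbF ?andbT.
    rewrite mulr0 /law big_pred0 // => t; rewrite !xpair_eqE.
    by have [->|] := eqVneq (x t) x0; rewrite ?andbF // [x0 == x1]eq_sym (negbTE x10) andbF.
  rewrite (law_sum p _ (fun z => hent K (fun x1 => (x1 == z.2)%:R))) /=.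
  by rewrite (law_sum p x (fun z => hent K (fun x1 => (x1 == z)%:R))).
move=> [a x1] x0 y0.
have [->|x10] := eqVneq x1 x0; last first.
  by rewrite /law !big_pred0 ?mul0r // => t; rewrite !xpair_eqE;
    have [->|] := eqVneq (x t) x1; rewrite ?(negbTE x10) ?andbF.
rewrite (@eq_law _ _ p _ _ _ (fun t => (f t, x t, y t)) _ (a, x0, y0)); last first.
  by move=> t; rewrite !xpair_eqE; case: (x t == x0); rewrite ?andbF ?andbT.
rewrite ch; congr (_ * _); apply: eq_law => t.
by rewrite !xpair_eqE; case: (x t == x0); rewrite ?andbF ?andbT.
Qed.

End Channel.

Definition marg1 (R : realType) (X Y1 Y2 : finType) (W : X -> Y1 * Y2 -> R) x y1 : R :=
  \sum_y2 W x (y1, y2).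
Definition marg2 (R : realType) (X Y1 Y2 : finType) (W : X -> Y1 * Y2 -> R) x y2 : R :=
  \sum_y1 W x (y1, y2).

Section Functionals.
Variables (R : realType) (X Y1 Y2 : finType) (W : X -> Y1 * Y2 -> R).
Hypothesis W_tr : transition W.

Lemma marg1_transition : transition (marg1 W).
Proof.
move=> x; have [W0 W1] := W_tr x; split=> [y1|]; first exact: sumr_ge0.
by rewrite -W1 sum_pair.
Qed.

Lemma marg2_transition : transition (marg2 W).
Proof.
move=> x; have [W0 W1] := W_tr x; split=> [y1|]; first exact: sumr_ge0.
by rewrite exchange_big -W1 sum_pair.
Qed.

Variables (U V : finType).
Implicit Type q : U * V * X -> R.

Definition qU q u x := \sum_v q (u, v, x).
Definition qX q x := \sum_u \sum_v q (u, v, x).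

(* [rate1] is [I(X; Y1 | U, V)], [rate2] is [I(U; Y2)], [rate3] is [I(V; Y2 | U)] and
   [rate4] is [I(V; Y1 | U)] when [q] is the law of [(U, V, X)]. *)
Definition rate1 q : R :=
  \sum_u \sum_v hent (marg1 W) (fun x => q (u, v, x))
  - \sum_x qX q x * hent (marg1 W) (fun x' => (x' == x)%:R).
Definition rate2 q : R :=
  hent (marg2 W) (qX q) - \sum_u hent (marg2 W) (qU q u).
Definition rate3 q : R :=
  \sum_u hent (marg2 W) (qU q u)
  - \sum_u \sum_v hent (marg2 W) (fun x => q (u, v, x)).
Definition rate4 q : R :=
  \sum_u hent (marg1 W) (qU q u)
  - \sum_u \sum_v hent (marg1 W) (fun x => q (u, v, x)).

Variables (T : finType) (p : T -> R).
Hypothesis p_pmf : pmf p.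
Variables (u : T -> U) (v : T -> V) (x : T -> X) (y : T -> Y1 * Y2).

Lemma channel_law_marg1 (A : finType) (f : T -> A) :
  channel_law p W f x y -> channel_law p (marg1 W) f x (fun t => (y t).1).
Proof.
move=> ch a x0 y1; rewrite /marg1 big_distrr /=.
rewrite (law_fst p _ (fun t => (y t).2)); apply: eq_bigr => y2 _.
rewrite -ch; apply: eq_law => t; rewrite !xpair_eqE -andbA.
by case: (y t).
Qed.

Lemma channel_law_marg2 (A : finType) (f : T -> A) :
  channel_law p W f x y -> channel_law p (marg2 W) f x (fun t => (y t).2).
Proof.
move=> ch a x0 y2; rewrite /marg2 big_distrr /=.
rewrite (law_fst p _ (fun t => (y t).1)); apply: eq_bigr => y1 _.
rewrite -ch; apply: eq_law => t; rewrite !xpair_eqE -andbA.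
by case: (y t) => a1 a2; rewrite xpair_eqE [(a2 == _) && _]andbC.
Qed.

Hypothesis ch : channel_law p W (fun t => (u t, v t)) x y.
Let q := law p (fun t => (u t, v t, x t)).

Let qUE a x0 : law p (fun t => (u t, x t)) (a, x0) = qU q a x0.
Proof.
rewrite (law_fst p _ v); apply: eq_bigr => b _; apply: eq_law => t.
by rewrite !xpair_eqE andbAC.
Qed.

Let qXE x0 : law p x x0 = qX q x0.
Proof.
rewrite (law_snd p u); apply: eq_bigr => a _; exact: qUE.
Qed.

Let chu : channel_law p W u x y.
Proof. exact: (channel_law_comp fst ch). Qed.

Let ch0 : channel_law p W (fun=> tt) x y.
Proof. exact: (channel_law_comp (fun=> tt) ch). Qed.

Let ent_uv (Y : finType) (K : X -> Y -> R) (z : T -> Y) :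
  channel_law p K (fun t => (u t, v t)) x z ->
  ent p (fun t => (u t, v t, z t)) - ent p (fun t => (u t, v t)) =
  \sum_a \sum_b hent K (fun x0 => q (a, b, x0)).
Proof.
move=> c; rewrite (hent_law c).
by rewrite sum_pair.
Qed.

Let ent_u (Y : finType) (K : X -> Y -> R) (z : T -> Y) :
  channel_law p K u x z ->
  ent p (fun t => (u t, z t)) - ent p u = \sum_a hent K (qU q a).
Proof.
move=> c; rewrite (hent_law c); apply: eq_bigr => a _.
by apply: eq_hent => x0; exact: qUE.
Qed.

Lemma rate1E :
  cond_mutual_info p x (fun t => (y t).1) (fun t => (u t, v t)) = rate1 q.
Proof.
have c := channel_law_marg1 ch.
rewrite /rate1 -(ent_uv c).
under [X in _ - X]eq_bigr => x0 _ do rewrite -qXE.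
rewrite -(hent_law_input marg1_transition p_pmf c) cond_mutual_info_ent //.
rewrite (@eq_ent _ _ p _ _ (fun t => (x t, _)) (fun t => (u t, v t, x t))); last first.
  by move=> t t'; rewrite !xpair_eqE andbC.
rewrite (@eq_ent _ _ p _ _ (fun t => ((y t).1, (u t, v t)))
  (fun t => (u t, v t, (y t).1))); last first.
  by move=> t t'; rewrite !xpair_eqE andbC.
rewrite (@eq_ent _ _ p _ _ (fun t => (x t, _, _))
  (fun t => (u t, v t, x t, (y t).1))); last first.
  by move=> t t'; rewrite !xpair_eqE -!andbA; do !bool_congr.
lra.
Qed.

Lemma rate2E : mutual_info p u (fun t => (y t).2) = rate2 q.
Proof.
rewrite /rate2 -(ent_u (channel_law_marg2 chu)) mutual_info_ent //.
have := hent_law (channel_law_marg2 ch0).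
rewrite ent_unit // (big_pred1 tt); last by case.
rewrite (eq_hent _ (nu := qX q)); last first.
  by move=> x0; rewrite -qXE; apply: eq_law => t; rewrite xpair_eqE eqxx.
move=> <-.
rewrite (@eq_ent _ _ p _ _ (fun t => (tt, _)) (fun t => (y t).2)); last first.
  by move=> t t'; rewrite xpair_eqE eqxx.
lra.
Qed.

Let rate34E (Y : finType) (K : X -> Y -> R) (z : T -> Y) :
  channel_law p K (fun t => (u t, v t)) x z -> channel_law p K u x z ->
  cond_mutual_info p v z u = \sum_a hent K (qU q a)
     - \sum_a \sum_b hent K (fun x0 => q (a, b, x0)).
Proof.
move=> cuv cu.
rewrite -(ent_u cu) -(ent_uv cuv) cond_mutual_info_ent //.
rewrite (@eq_ent _ _ p _ _ (fun t => (v t, _)) (fun t => (u t, v t))); last first.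
  by move=> t t'; rewrite !xpair_eqE andbC.
rewrite (@eq_ent _ _ p _ _ (fun t => (z t, u t)) (fun t => (u t, z t))); last first.
  by move=> t t'; rewrite !xpair_eqE andbC.
rewrite (@eq_ent _ _ p _ _ (fun t => (v t, _, _)) (fun t => (u t, v t, z t))); last first.
  by move=> t t'; rewrite !xpair_eqE -!andbA; do !bool_congr.
lra.
Qed.

Lemma rate3E : cond_mutual_info p v (fun t => (y t).2) u = rate3 q.
Proof. exact: rate34E (channel_law_marg2 ch) (channel_law_marg2 chu). Qed.

Lemma rate4E : cond_mutual_info p v (fun t => (y t).1) u = rate4 q.
Proof. exact: rate34E (channel_law_marg1 ch) (channel_law_marg1 chu). Qed.

End Functionals.

(** * Cardinality reduction *)

Section Caratheodory.
Variables (R : realType) (U D : finType) (a : U -> D -> R) (c : U -> R).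
Variables (l : D -> R).
Implicit Types w z : U -> R.

Let m u := \sum_k l k * a u k.

Lemma kernel_vector (S : {set U}) : (#|D| < #|S|)%N ->
  exists z, [/\ exists u, z u != 0, forall u, u \notin S -> z u = 0 &
    forall k, \sum_u z u * a u k = 0].
Proof.
move=> DS.
pose A := \matrix_(i < #|S|, j < #|D|) a (enum_val i) (enum_val j).
have : kermx A != 0.
  rewrite -mxrank_eq0 mxrank_ker subn_eq0 -ltnNge.
  exact: leq_ltn_trans (rank_leq_col A) DS.
case/rowV0Pn => y /sub_kermxP yA y0.
have /existsP[i0 yi0] : [exists i, y 0 i != 0].
  rewrite -negb_forall; apply: contraNN y0 => /forallP y0.
  by apply/eqP/rowP => i; rewrite mxE; apply/eqP.
have [u0 u0S] : exists u0, u0 \in S by exists (enum_val i0); exact: enum_valP.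
pose z u := if u \in S then y 0 (enum_rank_in u0S u) else 0.
have zE i : z (enum_val i) = y 0 i by rewrite /z enum_valP enum_valK_in.
exists z; split.
- by exists (enum_val i0); rewrite zE.
- by move=> u /negbTE uS; rewrite /z uS.
move=> k; rewrite (bigID (mem S)) /= [X in _ + X]big1 ?addr0; last first.
  by move=> u /negbTE uS; rewrite /z uS mul0r.
rewrite big_enum_val /=.
have /rowP/(_ (enum_rank k)) := yA; rewrite !mxE => e; rewrite -[RHS]e.
by apply: eq_bigr => i _; rewrite zE mxE enum_rankK.
Qed.

(** Caratheodory's reduction with an objective. While the support exceeds [#|D|], the features
    restricted to it have a linear dependence [z]; moving along [z] keeps all features, and with the
    right sign does not increase the objective, until some weight vanishes. The form [l] is a
    combination of preserved features, so keeping the mass [m] fixed costs no additional letter. *)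
Lemma sparse_weights w :
  (forall u, 0 <= w u) -> (forall u, w u != 0 -> 0 < m u) ->
  exists w', [/\ forall u, 0 <= w' u, forall u, w u = 0 -> w' u = 0,
    forall k, \sum_u w' u * a u k = \sum_u w u * a u k,
    \sum_u w' u * c u <= \sum_u w u * c u &
    (#|[set u | w' u != 0%R]%SET| <= #|D|)%N].
Proof.
have [n] := ubnP #|[set u | w u != 0%R]%SET|.
elim: n w => // n IH w; rewrite ltnS => wn w_ge0 w_m.
have [wD|Dw] := leqP #|[set u | w u != 0%R]%SET| #|D|; first by exists w; split.
have [z [[u1 zu1] zS za]] : exists z, [/\ exists u, z u < 0,
    forall u, w u = 0 -> z u = 0 &
    (forall k, \sum_u z u * a u k = 0) /\ \sum_u z u * c u <= 0].
  have [z [[u1 zu1] zS za]] := kernel_vector Dw.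
  have {}zS u : w u = 0 -> z u = 0 by move=> wu; apply: zS; rewrite inE wu eqxx.
  have zm : \sum_u z u * m u = 0.
    rewrite /m; under eq_bigr => u _ do rewrite big_distrr /=.
    rewrite exchange_big big1 //= => k _.
    under eq_bigr => u _ do rewrite mulrCA.
    by rewrite -big_distrr /= za mulr0.
  (* [m] is positive on the support and [z'] annihilates it, so a nonzero [z'] must take a negative
     value. This applies to [z] and to [- z], which leaves the sign free for the objective. *)
  have neg z' : (forall u, w u = 0 -> z' u = 0) -> z' u1 != 0 ->
      \sum_u z' u * m u = 0 -> exists u, z' u < 0.
    move=> z'S z'u1 z'm; apply: contrapT => z'0.
    have {}z'0 u : 0 <= z' u by rewrite leNgt; apply/negP => ?; apply: z'0; exists u.
    have zm0 u : 0 <= z' u * m u.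
      have [/z'S ->|/w_m/ltW mu] := eqVneq (w u) 0; first by rewrite mul0r.
      exact: mulr_ge0.
    move/eqP: z'm; rewrite psumr_eq0 => [|u _]; last exact: zm0.
    move=> /allP /(_ u1); rewrite mem_index_enum => /(_ isT) /=.
    rewrite mulf_eq0 (negbTE z'u1) /= => /eqP m0.
    have : w u1 != 0 by apply: contraNN z'u1 => /eqP /z'S ->.
    by move/w_m; rewrite m0 ltxx.
  have [zc|zc] := leP (\sum_u z u * c u) 0.
    by exists z; split => //; apply: neg => //; exists u1.
  exists (fun u => - z u); split.
  - apply: (neg (fun u => - z u)); rewrite /= ?oppr_eq0 //.
      by move=> u /zS ->; rewrite oppr0.
    by under eq_bigr => u _ do rewrite mulNr; rewrite sumrN zm oppr0.
  - by move=> u /zS ->; rewrite oppr0.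
  split; first by move=> k; under eq_bigr => u _ do rewrite mulNr; rewrite sumrN za oppr0.
  by under eq_bigr => u _ do rewrite mulNr; rewrite sumrN oppr_le0 ltW.
pose P u := z u < 0.
have Pu1 : P u1 by [].
(* The smallest ratio is the longest step that keeps all weights nonnegative; it annihilates the
   weight of [u0]. *)
have [u0 zu0 u0min] := @arg_minP _ R _ u1 P (fun u => w u / - z u) Pu1.
set t := w u0 / - z u0 in u0min.
have t_ge0 : 0 <= t by rewrite divr_ge0 // oppr_ge0 ltW.
pose w1 u := w u + t * z u.
have w1_ge0 u : 0 <= w1 u.
  rewrite /w1; have [zu|zu] := leP 0 (z u);
    first by apply: addr_ge0; [exact: w_ge0 | exact: mulr_ge0].
  have := u0min u zu; rewrite ler_pdivlMr ?oppr_gt0 //; lra.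
have w1S u : w u = 0 -> w1 u = 0.
  by move=> wu; rewrite /w1 wu (zS _ wu) mulr0 addr0.
have w1u0 : w1 u0 = 0.
  by rewrite /w1 /t; field; rewrite lt_eqF.
have wu0 : w u0 != 0 by apply: contraTneq zu0 => /zS; rewrite /P => ->; rewrite ltxx.
have [||| w' [w'0 w'S w'a w'c w'D]] := IH w1.
- apply: leq_trans wn; apply: proper_card; apply/properP; split.
    by apply/fintype.subsetP => u; rewrite !inE; apply: contraNneq => /w1S ->.
  by exists u0; rewrite !inE // w1u0 eqxx.
- exact: w1_ge0.
- by move=> u w1u; apply: w_m; apply: contraNneq w1u => /w1S ->.
have w1sum f : \sum_u w1 u * f u = \sum_u w u * f u + t * \sum_u z u * f u.
  by rewrite big_distrr -big_split /=; apply: eq_bigr => u _; rewrite /w1 mulrDl mulrA.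
exists w'; split=> //.
- by move=> u /w1S /w'S.
- by move=> k; rewrite w'a w1sum (proj1 za) mulr0 addr0.
- apply: le_trans w'c _; rewrite w1sum gerDl.
  by rewrite mulr_ge0_le0 // (proj2 za).
Qed.

End Caratheodory.

(** Indices beyond the size of [S] are sent to [None] and contribute 0, so the index set has size
    exactly [N] even when [U] is smaller. *)
Lemma index_support (R : realType) (U : finType) (S : {set U}) (N : nat) :
  (#|S| <= N)%N -> exists s : 'I_N -> option U,
  forall G : U -> R, (forall u, u \notin S -> G u = 0) ->
  \sum_i oapp G 0 (s i) = \sum_u G u.
Proof.
move=> SN; pose L := [seq Some u | u <- enum S].
have szL : size L = #|S| by rewrite size_map -cardE.
exists (fun i => nth None L i) => G G0.
transitivity (\sum_(0 <= i < N) oapp G 0 (nth None L i)); first by rewrite big_mkord.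
rewrite (@big_cat_nat _ _ _ #|S|) //= [X in _ + X]big_nat_cond
  [X in _ + X]big1 ?addr0; last first.
  by move=> i /andP[/andP[Si _] _]; rewrite nth_default // szL.
rewrite -szL -(big_nth None xpredT (oapp G 0)) big_map /= big_enum /=.
rewrite [RHS](bigID (mem S)) /= [X in _ = _ + X]big1 ?addr0 //.
Qed.

Section Reduction.
Variables (R : realType) (X Y1 Y2 : finType) (W : X -> Y1 * Y2 -> R).
Hypothesis W_tr : transition W.

Definition dominates (U V U' V' : finType) (q' : U' * V' * X -> R)
    (q : U * V * X -> R) : Prop :=
  [/\ qX q' = qX q, rate1 W q <= rate1 W q', rate2 W q <= rate2 W q',
    rate3 W q <= rate3 W q' & rate4 W q <= rate4 W q'].

Lemma dominates_trans (U V U' V' U'' V'' : finType) (q : U * V * X -> R)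
    (q' : U' * V' * X -> R) (q'' : U'' * V'' * X -> R) :
  dominates q'' q' -> dominates q' q -> dominates q'' q.
Proof.
move=> [e a1 a2 a3 a4] [e' b1 b2 b3 b4]; split; first by rewrite e e'.
- exact: le_trans b1 a1.
- exact: le_trans b2 a2.
- exact: le_trans b3 a3.
- exact: le_trans b4 a4.
Qed.

Lemma sum_qX (U V : finType) (q : U * V * X -> R) : \sum_x qX q x = \sum_z q z.
Proof.
rewrite /qX exchange_big /=; under eq_bigr => u _ do rewrite exchange_big /=.
by rewrite !sum_pair.
Qed.

Variables (U V : finType).
Implicit Types q : U * V * X -> R.

Let m1 := marg1_transition W_tr.
Let m2 := marg2_transition W_tr.

(* Only [rate3] decreases with the objective [c], and every other rate is a function of
   the preserved quantities [a]; preserving [c] as well would cost one more letter. *)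
Lemma reduceU q : (forall z, 0 <= q z) ->
  exists q', [/\ forall z, 0 <= q' z, dominates q' q &
    exists2 S : {set U}, (#|S| <= #|X| + 3)%N &
      forall u v x, u \notin S -> q' (u, v, x) = 0].
Proof.
move=> q0.
have qU0 u x : 0 <= qU q u x by exact: sumr_ge0.
pose a u (k : X + 'I_3) := match k with
  | inl x => qU q u x
  | inr (@Ordinal _ 0 _) => hent (marg2 W) (qU q u)
  | inr (@Ordinal _ 1 _) => hent (marg1 W) (qU q u)
  | inr _ => \sum_v hent (marg1 W) (fun x => q (u, v, x))
  end.
pose c u := \sum_v hent (marg2 W) (fun x => q (u, v, x)).
pose l (k : X + 'I_3) : R := if k is inl _ then 1 else 0.
have mE u : \sum_k l k * a u k = \sum_x qU q u x.
  rewrite big_sumType /= [X in _ + X]big1 ?addr0 => [|k _]; last exact: mul0r.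
  by apply: eq_bigr => x _; rewrite mul1r.
(* The initial weights select the letters of positive mass, as [sparse_weights] requires; on the
   other letters [q] vanishes, so these weights reproduce [q]. *)
pose w u : R := if 0 < \sum_x qU q u x then 1 else 0.
have [||w' [w'0 w'S w'a w'c w'D]] := @sparse_weights R U (X + 'I_3)%type a c l w.
- by move=> u; rewrite /w; case: ifP.
- by move=> u; rewrite mE /w; case: ifP => //; rewrite eqxx.
have w_nil u : w u = 0 -> forall v x, q (u, v, x) = 0.
  rewrite /w; case: ifP => [_ /eqP|/negbT]; first by rewrite oner_eq0.
  rewrite -leNgt => s0 _ v x.
  have {s0} : \sum_x qU q u x == 0 by rewrite eq_le s0 sumr_ge0.
  rewrite psumr_eq0 // => /allP /(_ x); rewrite mem_index_enum => /(_ isT) /=.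
  rewrite psumr_eq0 // => /allP /(_ v); rewrite mem_index_enum => /(_ isT) /=.
  by move/eqP.
have wq u v x : w u * q (u, v, x) = q (u, v, x).
  have [/w_nil ->|] := eqVneq (w u) 0; first by rewrite mulr0.
  by rewrite /w; case: ifP; rewrite ?mul1r ?eqxx.
have wU u x : w u * qU q u x = qU q u x.
  by rewrite /qU big_distrr /=; apply: eq_bigr => v _.
have wh (Y : finType) (K : X -> Y -> R) mu u : 
    (forall x, w u * mu x = mu x) -> transition K -> (forall x, 0 <= mu x) ->
    w u * hent K mu = hent K mu.
  by move=> e Ktr mu0; rewrite -hent_scale //; [exact: eq_hent | rewrite /w; case: ifP].
pose q' (z : U * V * X) := w' z.1.1 * q z.
have q'0 z : 0 <= q' z by rewrite mulr_ge0.
have q'U u x : qU q' u x = w' u * qU q u x by rewrite /qU big_distrr.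
have hU (Y : finType) (K : X -> Y -> R) u : transition K ->
    hent K (qU q' u) = w' u * hent K (qU q u).
  by move=> Ktr; rewrite -hent_scale //; apply: eq_hent => x; exact: q'U.
have hUV (Y : finType) (K : X -> Y -> R) u : transition K ->
    \sum_v hent K (fun x => q' (u, v, x)) = w' u * \sum_v hent K (fun x => q (u, v, x)).
  by move=> Ktr; rewrite big_distrr /=; apply: eq_bigr => v _; rewrite -hent_scale.
have eX : qX q' = qX q.
  apply: funext => x; have := w'a (inl x); rewrite /= => e.
  transitivity (\sum_u w' u * qU q u x); first by apply: eq_bigr => u _; exact: q'U.
  by rewrite e; apply: eq_bigr => u _; exact: wU.
have e0 : \sum_u hent (marg2 W) (qU q' u) = \sum_u hent (marg2 W) (qU q u).
  under eq_bigr => u _ do rewrite hU //.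
  rewrite (w'a (inr (@Ordinal 3 0 isT))) /=.
  by apply: eq_bigr => u _; apply: wh.
have e1 : \sum_u hent (marg1 W) (qU q' u) = \sum_u hent (marg1 W) (qU q u).
  under eq_bigr => u _ do rewrite hU //.
  rewrite (w'a (inr (@Ordinal 3 1 isT))) /=.
  by apply: eq_bigr => u _; apply: wh.
have wUV (Y : finType) (K : X -> Y -> R) u : transition K ->
  w u * (\sum_v hent K (fun x => q (u, v, x))) = \sum_v hent K (fun x => q (u, v, x)).
  by move=> Ktr; rewrite big_distrr; apply: eq_bigr => v _; apply: wh.
have e2 : \sum_u \sum_v hent (marg1 W) (fun x => q' (u, v, x)) =
          \sum_u \sum_v hent (marg1 W) (fun x => q (u, v, x)).
  under eq_bigr => u _ do rewrite hUV //.
  rewrite (w'a (inr (@Ordinal 3 2 isT))) /=.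
  by apply: eq_bigr => u _; exact: wUV.
have e3 : \sum_u \sum_v hent (marg2 W) (fun x => q' (u, v, x)) <=
          \sum_u \sum_v hent (marg2 W) (fun x => q (u, v, x)).
  under eq_bigr => u _ do rewrite hUV //.
  apply: le_trans w'c _; rewrite le_eqVlt; apply/orP; left; apply/eqP.
  by apply: eq_bigr => u _; exact: wUV.
exists q'; split => //.
  split => //; rewrite /rate1 /rate2 /rate3 /rate4 ?eX ?e0 ?e1 ?e2 //.
  by rewrite lerB.
exists [set u | w' u != 0%R]%SET.
  by apply: leq_trans w'D _; rewrite card_sum card_ord.
by move=> u v x; rewrite inE negbK => /eqP w'u; rewrite /q' /= w'u mul0r.
Qed.

(** The reduction is carried out separately for each u. Preserving [qU q u] together with the
    contributions of u to H(Y1 | U, V) and H(Y2 | U, V) leaves every rate unchanged, so the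
    objective can be 0. Letters u of mass zero stay so, which keeps an earlier reduction of U
    intact. *)
Lemma reduceV q : (forall z, 0 <= q z) ->
  exists q', [/\ forall z, 0 <= q' z, dominates q' q,
    forall u, (forall v x, q (u, v, x) = 0) -> forall v x, q' (u, v, x) = 0 &
    exists2 S : U -> {set V}, (forall u, #|S u| <= #|X| + 2)%N &
      forall u v x, v \notin S u -> q' (u, v, x) = 0].
Proof.
move=> q0.
pose a u v (k : X + 'I_2) := match k with
  | inl x => q (u, v, x)
  | inr (@Ordinal _ 0 _) => hent (marg2 W) (fun x => q (u, v, x))
  | inr _ => hent (marg1 W) (fun x => q (u, v, x))
  end.
pose l (k : X + 'I_2) : R := if k is inl _ then 1 else 0.
have mE u v : \sum_k l k * a u v k = \sum_x q (u, v, x).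
  rewrite big_sumType /= [X in _ + X]big1 ?addr0 => [|k _]; last exact: mul0r.
  by apply: eq_bigr => x _; rewrite mul1r.
pose w u v : R := if 0 < \sum_x q (u, v, x) then 1 else 0.
have w0 u v : 0 <= w u v by rewrite /w; case: ifP.
have /choice[w' w'P] : forall u, exists w' : V -> R, [/\ forall v, 0 <= w' v,
    forall k, \sum_v w' v * a u v k = \sum_v w u v * a u v k &
    (#|[set v | w' v != 0%R]%SET| <= #|{: X + 'I_2}|)%N].
  move=> u.
  have [||w' [w'0 _ w'a _ w'D]] := @sparse_weights R V (X + 'I_2)%type (a u)
    (fun=> 0) l (w u).
  - exact: w0.
  - by move=> v; rewrite mE /w; case: ifP => //; rewrite eqxx.
  by exists w'; split.
have w'0 u v : 0 <= w' u v by case: (w'P u).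
have wq u v x : w u v * q (u, v, x) = q (u, v, x).
  rewrite /w; case: ifP => [_|/negbT]; first by rewrite mul1r.
  rewrite -leNgt mul0r => s0.
  have {s0} : \sum_x q (u, v, x) == 0 by rewrite eq_le s0 sumr_ge0.
  rewrite psumr_eq0 // => /allP /(_ x); rewrite mem_index_enum => /(_ isT) /=.
  by move/eqP.
pose q' (z : U * V * X) := w' z.1.1 z.1.2 * q z.
have q'0 z : 0 <= q' z by rewrite mulr_ge0.
have hE (Y : finType) (K : X -> Y -> R) u v : transition K ->
    hent K (fun x => q' (u, v, x)) = w' u v * hent K (fun x => q (u, v, x)).
  by move=> Ktr; rewrite -hent_scale.
have wh (Y : finType) (K : X -> Y -> R) u v : transition K ->
    w u v * hent K (fun x => q (u, v, x)) = hent K (fun x => q (u, v, x)).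
  by move=> Ktr; rewrite -hent_scale //; apply: eq_hent => x; exact: wq.
have eU u : qU q' u = qU q u.
  apply: funext => x; have [_ /(_ (inl x)) /= e _] := w'P u.
  by rewrite /qU e; apply: eq_bigr => v _; exact: wq.
have eX : qX q' = qX q.
  by apply: funext => x; apply: eq_bigr => u _; have /(congr1 (@^~ x)) := eU u.
have e0 u : \sum_v hent (marg2 W) (fun x => q' (u, v, x)) =
            \sum_v hent (marg2 W) (fun x => q (u, v, x)).
  under eq_bigr => v _ do rewrite hE //.
  have [_ /(_ (inr (@Ordinal 2 0 isT))) /= -> _] := w'P u.
  by apply: eq_bigr => v _; exact: wh.
have e1 u : \sum_v hent (marg1 W) (fun x => q' (u, v, x)) =
            \sum_v hent (marg1 W) (fun x => q (u, v, x)).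
  under eq_bigr => v _ do rewrite hE //.
  have [_ /(_ (inr (@Ordinal 2 1 isT))) /= -> _] := w'P u.
  by apply: eq_bigr => v _; exact: wh.
exists q'; split => //.
- have eh (Y : finType) (K : X -> Y -> R) :
      \sum_u hent K (qU q' u) = \sum_u hent K (qU q u).
    by apply: eq_bigr => u _; rewrite eU.
  by split=> //; rewrite /rate1 /rate2 /rate3 /rate4 ?eX ?eh
    ?(eq_bigr _ (fun u _ => e0 u)) ?(eq_bigr _ (fun u _ => e1 u)).
- by move=> u qu v x; rewrite /q' qu mulr0.
exists (fun u => [set v | w' u v != 0]%SET).
  by move=> u; have [_ _ /leq_trans] := w'P u; apply; rewrite card_sum card_ord.
by move=> u v x; rewrite inE negbK => /eqP w'u; rewrite /q' /= w'u mul0r.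
Qed.

End Reduction.

(** Where the marginal vanishes, the kernel is the point mass at [b0], which keeps it stochastic. *)
Lemma disintegration (R : realType) (A B : finType) (q : A * B -> R) (b0 : B) :
  pmf q -> exists K : A -> B -> R, transition K /\
    forall a b, q (a, b) = (\sum_b' q (a, b')) * K a b.
Proof.
move=> [q0 q1]; pose P a := \sum_b q (a, b).
have P0 a : 0 <= P a by exact: sumr_ge0.
exists (fun a b => if P a == 0 then (b == b0)%:R else q (a, b) / P a); split.
  move=> a; split=> [b|]; case: eqP => [_|/eqP Pa] //.
  - by rewrite divr_ge0.
  - by rewrite (bigD1 b0) //= eqxx big1 ?addr0 // => b /negbTE ->.
  - by rewrite -big_distrl /= divff.
move=> a b; case: eqP => [Pa|/eqP Pa]; last by rewrite mulrC divfK.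
rewrite -/(P a) Pa mul0r; apply/eqP.
move/eqP: Pa; rewrite psumr_eq0 // => /allP /(_ b).
by rewrite mem_index_enum => /(_ isT).
Qed.

(** * Kernels and channel outputs *)

Section Compose.
Variables (R : realType) (A B : finType) (P : A -> R) (K : A -> B -> R).
Hypotheses (P_pmf : pmf P) (K_tr : transition K).

Definition compose (t : A * B) : R := P t.1 * K t.1 t.2.

Lemma compose_pmf : pmf compose.
Proof.
have [P0 P1] := P_pmf; split; first by move=> t; rewrite mulr_ge0 // transition_ge0.
rewrite -P1 sum_pair; apply: eq_bigr => a _.
by rewrite /compose /= -big_distrr /= transition_sum // mulr1.
Qed.

Lemma law_compose (C : finType) (h : A -> C) c :
  law compose (fun t => h t.1) c = law P h c.
Proof.
rewrite /law big_mkcond sum_pair [RHS]big_mkcond; apply: eq_bigr => a _ /=.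
case: ifP => _; last exact: big1.
by rewrite /compose /= -big_distrr /= transition_sum // mulr1.
Qed.

End Compose.

Lemma law_id (R : realType) (A : finType) (P : A -> R) a : law P id a = P a.
Proof. by rewrite /law big_pred1_eq. Qed.

Section Output.
Variables (R : realType) (A X Y : finType) (K : X -> Y -> R) (q : A * X -> R).
Hypotheses (K_tr : transition K) (q_pmf : pmf q).

Definition with_output : A * X * Y -> R := compose q (fun z => K z.2).

Lemma with_output_pmf : pmf with_output.
Proof. by apply: compose_pmf. Qed.

Lemma law_with_output ax : law with_output fst ax = q ax.
Proof. by rewrite (law_compose q (K := fun z => K z.2) _ id) // law_id. Qed.

Lemma channel_law_with_output :
  channel_law with_output K (fun t => t.1.1) (fun t => t.1.2) snd.
Proof.
move=> a x y.
rewrite (eq_law _ (g := id) (b := (a, x, y))); last by case=> [[]].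
rewrite [X in _ = X * _](eq_law _ (g := fst) (b := (a, x))); last by case=> [[]].
by rewrite law_with_output law_id.
Qed.

End Output.

Section Concavity.
Variables (R : realType) (X Y : finType) (K : X -> Y -> R).
Hypothesis K_tr : transition K.

(** This is H(Y | A) <= H(Y) on the space of triples (A, X, Y), read through [hent_law]. *)
Lemma hent_superadd (A : finType) (q : A * X -> R) : pmf q ->
  \sum_a hent K (fun x => q (a, x)) <= hent K (fun x => \sum_a q (a, x)).
Proof.
move=> q_pmf.
pose p := with_output K q.
have p_pmf : pmf p by exact: with_output_pmf.
have ch : channel_law p K (fun t => t.1.1) (fun t => t.1.2) snd.
  exact: channel_law_with_output.
have qE a x : law p (fun t => (t.1.1, t.1.2)) (a, x) = q (a, x).
  by rewrite -(law_with_output q K_tr); apply: eq_law => -[[]].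
have e1 := hent_law ch.
have e2 := hent_law (channel_law_comp (fun=> tt) ch).
move: e2; rewrite ent_unit // subr0 (big_pred1 tt); last by case.
rewrite (eq_hent _ (nu := fun x => \sum_a q (a, x))) => [<-|x]; last first.
  rewrite (eq_law _ (g := fun t => t.1.2) (b := x)); last by case=> [[]].
  by rewrite (law_snd p (fun t => t.1.1)); apply: eq_bigr => a _; exact: qE.
rewrite (eq_bigr (fun a => hent K (fun x => law p (fun t => (t.1.1, t.1.2)) (a, x)))).
  rewrite -e1 (@eq_ent _ _ p _ _ (fun t => (tt, t.2)) snd); last first.
    by move=> t t'; rewrite xpair_eqE eqxx.
  have := ent_subadd p_pmf (fun t => t.1.1) snd; lra.
by move=> a _; apply: eq_hent => x; rewrite qE.
Qed.

End Concavity.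

(** * Time sharing and common finite alphabets *)

Section Mixture.
Variables (R : realType) (X Y1 Y2 : finType) (W : X -> Y1 * Y2 -> R).
Hypothesis W_tr : transition W.

Let m1 := marg1_transition W_tr.
Let m2 := marg2_transition W_tr.

(** The time-sharing index joins U. Conditional entropies given U average exactly and H(Y1 | X) is
    linear in the input law; only H(Y2) changes, and it can only grow by concavity. The lemma serves
    twice: with two weights for convexity and with uniform weights over the letters of a block in
    the converse. *)
Lemma mixture (I U V : finType) (w : I -> R) (q : I -> U * V * X -> R) :
  pmf w -> (forall i, pmf (q i)) ->
  exists q' : (I * U) * V * X -> R, [/\ pmf q',
    \sum_i w i * rate1 W (q i) <= rate1 W q',
    \sum_i w i * rate2 W (q i) <= rate2 W q',
    \sum_i w i * rate3 W (q i) <= rate3 W q' &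
    \sum_i w i * rate4 W (q i) <= rate4 W q'].
Proof.
move=> [w0 w1] q_pmf.
have q0 i z : 0 <= q i z by case: (q_pmf i).
pose q' (z : I * U * V * X) := let: (i, u, v, x) := z in w i * q i (u, v, x).
have qUE i u x : qU q' (i, u) x = w i * qU (q i) u x by rewrite /qU big_distrr.
have qXE x : qX q' x = \sum_i w i * qX (q i) x.
  rewrite /qX sum_pair.
  apply: eq_bigr => i _; rewrite big_distrr; apply: eq_bigr => u _.
  by rewrite big_distrr.
have hU (Y : finType) (K : X -> Y -> R) : transition K ->
    \sum_iu hent K (qU q' iu) = \sum_i w i * \sum_u hent K (qU (q i) u).
  move=> Ktr; rewrite sum_pair.
  apply: eq_bigr => i _; rewrite big_distrr; apply: eq_bigr => u _ /=.
  rewrite -hent_scale //; last by move=> x; exact: sumr_ge0.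
  by apply: eq_hent => x; exact: qUE.
have hUV (Y : finType) (K : X -> Y -> R) : transition K ->
    \sum_iu \sum_v hent K (fun x => q' (iu, v, x)) =
    \sum_i w i * \sum_u \sum_v hent K (fun x => q i (u, v, x)).
  move=> Ktr; rewrite sum_pair.
  apply: eq_bigr => i _; rewrite big_distrr; apply: eq_bigr => u _ /=.
  by rewrite big_distrr /=; apply: eq_bigr => v _; rewrite -hent_scale.
have hX (Y : finType) (K : X -> Y -> R) : transition K ->
    \sum_i w i * hent K (qX (q i)) <= hent K (qX q').
  move=> Ktr; pose r (z : I * X) := w z.1 * qX (q z.1) z.2.
  have r_pmf : pmf r.
    split; first by move=> z; rewrite mulr_ge0 //; do 2 (apply: sumr_ge0 => ? _).
    rewrite -w1 sum_pair.
    apply: eq_bigr => i _; rewrite /r /= -big_distrr /= sum_qX.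
    by case: (q_pmf i) => _ ->; rewrite mulr1.
  have := hent_superadd Ktr r_pmf.
  rewrite [hent K (qX q')](eq_hent _ (nu := fun x => \sum_i r (i, x))) //.
  apply: le_trans; rewrite le_eqVlt; apply/orP; left; apply/eqP.
  apply: eq_bigr => i _; rewrite -hent_scale //.
  by move=> x; do 2 (apply: sumr_ge0 => ? _).
have wsum (F G : I -> R) : \sum_i w i * (F i - G i) =
    \sum_i w i * F i - \sum_i w i * G i.
  by rewrite -sumrB; apply: eq_bigr => i _; rewrite mulrBr.
exists q'; split.
- split=> [[[[i u] v] x]|]; first exact: mulr_ge0.
  rewrite -sum_qX; under eq_bigr => x _ do rewrite qXE.
  rewrite exchange_big -w1; apply: eq_bigr => i _ /=.
  by rewrite -big_distrr /= sum_qX; case: (q_pmf i) => _ ->; rewrite mulr1.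
- rewrite /rate1 wsum (hUV _ _ m1) lerB //.
  under [X in X <= _]eq_bigr => x _ do rewrite qXE big_distrl.
  rewrite exchange_big /=; apply: ler_sum => i _.
  by rewrite big_distrr /=; apply: ler_sum => x _; rewrite mulrA.
- by rewrite /rate2 wsum hU // lerB // hX.
- by rewrite /rate3 wsum hU // hUV.
- by rewrite /rate4 wsum hU // hUV.
Qed.

Section Reindex.
Variables (U V : finType) (N M : nat).

(** The rates involve the letters v only through sums at fixed u, so each u may number its own set
    [S' u] from the start. Hence [M] bounds each set and not their union. *)
Lemma reindex_support q (S : {set U}) (S' : U -> {set V}) : (forall z : U * V * X, 0
  <= q z) ->
  (#|S| <= N)%N -> (forall u, #|S' u| <= M)%N ->
  (forall u v x, u \notin S -> q (u, v, x) = 0) ->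
  (forall u v x, v \notin S' u -> q (u, v, x) = 0) ->
  exists q' : 'I_N * 'I_M * X -> R, (forall z, 0 <= q' z) /\ dominates W q' q.
Proof.
move=> q0 SN S'M qS qS'.
have [s sE] := @index_support R U S N SN.
have /choice[s' s'E] := fun u => @index_support R V (S' u) M (S'M u).
pose q' (z : 'I_N * 'I_M * X) := let: (i, j, x) := z in
  oapp (fun u => oapp (fun v => q (u, v, x)) 0 (s' u j)) 0 (s i).
have qUE i x : qU q' i x = oapp (fun u => qU q u x) 0 (s i).
  rewrite /qU /=; case: (s i) => [u|] /=; last by rewrite big1.
  by apply: (s'E u (fun v => q (u, v, x))) => v /qS'.
have qXE : qX q' = qX q.
  apply: funext => x.
  transitivity (\sum_i oapp (fun u => qU q u x) 0 (s i)).
    by apply: eq_bigr => i _; exact: qUE.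
  apply: (sE (fun u => qU q u x)) => u uS.
  by rewrite /qU big1 // => v _; exact: qS.
have hU (Y : finType) (K : X -> Y -> R) :
    \sum_i hent K (qU q' i) = \sum_u hent K (qU q u).
  transitivity (\sum_i oapp (fun u => hent K (qU q u)) 0 (s i)).
    apply: eq_bigr => i _; rewrite (eq_hent _ (qUE i)).
    by case: (s i) => [u|] //=; apply: hent0.
  apply: (sE (fun u => hent K (qU q u))) => u uS; apply: hent0 => x.
  by rewrite /qU big1 // => v _; exact: qS.
have hUV (Y : finType) (K : X -> Y -> R) :
    \sum_i \sum_j hent K (fun x => q' (i, j, x)) =
    \sum_u \sum_v hent K (fun x => q (u, v, x)).
  pose G u := \sum_v hent K (fun x => q (u, v, x)).
  transitivity (\sum_i oapp G 0 (s i)).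
    apply: eq_bigr => i _; rewrite /q' /=.
    case: (s i) => [u|] /=; last by rewrite big1 // => j _; exact: hent0.
    rewrite /G -(s'E u (fun v => hent K (fun x => q (u, v, x)))); last first.
      by move=> v /qS' vS; exact: hent0.
    by apply: eq_bigr => j _; case: (s' u j) => //=; exact: hent0.
  apply: (sE G) => u uS; rewrite /G big1 // => v _; apply: hent0 => x; exact: qS.
exists q'; split.
  by move=> [[i j] x] /=; case: (s i) => //= u; case: (s' u j) => /=.
by split; rewrite // /rate1 /rate2 /rate3 /rate4 ?qXE ?hU ?hUV.
Qed.

End Reindex.

Lemma cardinality_reduction (U V : finType) (q : U * V * X -> R) : pmf q ->
  exists q' : 'I_(#|X| + 3) * 'I_(#|X| + 2) * X -> R, pmf q' /\ dominates W q' q.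
Proof.
move=> [q0 q1].
have [q1' [q1'0 d1 [S SX qS]]] := reduceU W_tr q0.
have [q2 [q20 d2 q2S [S' S'X qS']]] := reduceV W_tr q1'0.
have [|q3 [q30 d3]] := @reindex_support U V _ _ q2 S S' q20 SX S'X _ qS'.
  by move=> u v x uS; apply: q2S => v' x'; exact: qS.
have d : dominates W q3 q by apply: (dominates_trans d3); exact: dominates_trans d1.
exists q3; split=> //; split=> //.
by rewrite -sum_qX; case: d => -> _ _ _ _; rewrite sum_qX.
Qed.

End Mixture.

(** * The single-letter region is closed and convex *)

Section Continuity.
Variable R : realType.

(** With s the square root of t, |t ln t| = 2 s (s ln (1/s)), and ln (1/s) < 1/s. *)
Lemma normr_xlnx_le (t : R) : 0 < t -> t <= 1 -> `|xlnx t| <= 2 * Num.sqrt t.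
Proof.
move=> t0 t1; set s := Num.sqrt t.
have s0 : 0 < s by rewrite sqrtr_gt0.
have tE : t = s ^+ 2 by rewrite sqr_sqrtr // ltW.
rewrite /xlnx normrM gtr0_norm // ler0_norm ?ln_le0 // tE lnXn // mulr2n.
have := @ln_sublinear R s^-1; rewrite invr_gt0 lnV ?posrE // => /(_ s0) ls.
have : s * - ln s <= 1.
  by rewrite -[X in _ <= X](@divff _ s) ?gt_eqF // ler_wpM2l // ltW.
rewrite -(ler_pM2l s0) expr2; lra.
Qed.

Lemma continuous_xlnx : continuous (@xlnx R).
Proof.
move=> x; have [x0|x0|<-] := ltgtP 0 x.
- by apply: cvgM; [exact: cvg_id | exact: continuous_ln].
(* [ln] takes the value 0 at nonpositive arguments, so [xlnx] vanishes there. Continuity on the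
   whole line avoids any special treatment of the boundary of the simplex. *)
- rewrite /continuous_at; apply/cvgrPdist_le => e e0.
  near=> t; have t0 : t <= 0 by near: t; exact: lt_le_nbhsl.
  by rewrite /xlnx (ln0 (ltW x0)) (ln0 t0) !mulr0 subr0 normr0 ltW.
- rewrite /continuous_at xlnx0; apply/cvgrPdist_le => e e0.
  near=> t; rewrite sub0r normrN.
  have [t0|t0] := leP t 0; first by rewrite /xlnx ln0 // mulr0 normr0 ltW.
  apply: le_trans (normr_xlnx_le t0 _) _.
    by near: t; exact: lt_le_nbhsl.
  rewrite -ler_pdivlMl // mulrC -[X in _ <= X]gtr0_norm ?divr_gt0 //.
  rewrite -sqrtr_sqr ler_wsqrtr //.
  by near: t; apply: lt_le_nbhsl; rewrite exprn_gt0 // divr_gt0.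
Unshelve. all: by end_near. Qed.

Lemma continuous_sum (T : topologicalType) (I : finType) (F : I -> T -> R) :
  (forall i, continuous (F i)) -> continuous (fun t => \sum_i F i t).
Proof. by move=> cF; apply: continuous_big => //; exact: add_continuous. Qed.

Lemma continuousMl (T : topologicalType) (F : T -> R) (c : R) :
  continuous F -> continuous (fun t => F t * c).
Proof. by move=> cF t; apply: cvgM; [exact: cF | exact: cvg_cst]. Qed.

Lemma continuousDl (T : topologicalType) (F : T -> R) (c : R) :
  continuous F -> continuous (fun t => F t + c).
Proof. by move=> cF t; apply: cvgD; [exact: cF | exact: cvg_cst]. Qed.

Lemma continuous_minr (T : topologicalType) (F G : T -> R) :
  continuous F -> continuous G -> continuous (fun t => Num.min (F t) (G t)).
Proof. by move=> cF cG t; apply: (@continuous_min R T F G t (cF t) (cG t)). Qed.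

Lemma continuous_hent (T : topologicalType) (X Y : finType) (K : X -> Y -> R)
    (mu : T -> X -> R) :
  (forall x, continuous (mu^~ x)) -> continuous (fun t => hent K (mu t)).
Proof.
move=> cmu t; apply: cvgB.
  apply: continuous_comp; last exact: continuous_xlnx.
  exact: (continuous_sum cmu).
apply: (@continuous_sum _ _ (fun y t => xlnx (\sum_x mu t x * K x y))) => y {}t.
apply: continuous_comp; last exact: continuous_xlnx.
apply: (@continuous_sum _ _ (fun x t => mu t x * K x y)) => x.
exact: continuousMl.
Qed.

End Continuity.

Section RateContinuity.
Variables (R : realType) (X Y1 Y2 : finType) (W : X -> Y1 * Y2 -> R).
Variables (T : topologicalType) (U V : finType) (q : T -> U * V * X -> R).
Hypothesis q_cont : forall z, continuous (q^~ z).

Let cU u x : continuous (fun t => qU (q t) u x).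
Proof. by apply: (@continuous_sum _ _ _ (fun v t => q t (u, v, x))). Qed.

Let cX x : continuous (fun t => qX (q t) x).
Proof. by apply: (@continuous_sum _ _ _ (fun u t => qU (q t) u x)). Qed.

Let chU (Y : finType) (K : X -> Y -> R) :
  continuous (fun t => \sum_u hent K (qU (q t) u)).
Proof.
apply: (@continuous_sum _ _ _ (fun u t => hent K (qU (q t) u))) => u.
exact: continuous_hent.
Qed.

Let chUV (Y : finType) (K : X -> Y -> R) :
  continuous (fun t => \sum_u \sum_v hent K (fun x => q t (u, v, x))).
Proof.
apply: (@continuous_sum _ _ _ (fun u t => \sum_v hent K (fun x => q t (u, v, x)))) => u.
apply: (@continuous_sum _ _ _ (fun v t => hent K (fun x => q t (u, v, x)))) => v.
by apply: (@continuous_hent _ _ _ _ _ (fun t x => q t (u, v, x))) => x.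
Qed.

Lemma continuous_rate1 : continuous (fun t => rate1 W (q t)).
Proof.
move=> t; apply: cvgB; first exact: chUV.
apply: (@continuous_sum _ _ _ (fun x t => qX (q t) x * hent (marg1 W)
  (fun x' => (x' == x)%:R))) => x.
exact: continuousMl.
Qed.

Lemma continuous_rate2 : continuous (fun t => rate2 W (q t)).
Proof. by move=> t; apply: cvgB; [apply: continuous_hent | apply: chU]. Qed.

Lemma continuous_rate3 : continuous (fun t => rate3 W (q t)).
Proof. by move=> t; apply: cvgB; [apply: chU | apply: chUV]. Qed.

Lemma continuous_rate4 : continuous (fun t => rate4 W (q t)).
Proof. by move=> t; apply: cvgB; [apply: chU | apply: chUV]. Qed.

End RateContinuity.

Lemma compact_simplex (R : realType) n :
  compact [set v : 'rV[R]_n | (forall i, 0 <= v 0 i) /\ \sum_i v 0 i = 1].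
Proof.
apply: (@subclosed_compact _ _ [set v : 'rV[R]_n | forall i, `[0, 1]%classic (v 0 i)]).
- rewrite (_ : mkset _ = (\bigcap_i [set v : 'rV[R]_n | 0 <= v 0 i]) `&`
                         [set v : 'rV[R]_n | \sum_i v 0 i = 1]).
    apply: closedI.
      apply: closed_bigI => i _.
      apply: (@preimage_closed _ _ (fun v : 'rV[R]_n => v 0 i) [set x | 0 <= x]).
        by move=> v _; exact: coord_continuous.
      exact: closed_ge.
    apply: (@preimage_closed _ _ (fun v : 'rV[R]_n => \sum_i v 0 i) [set x | x = 1]).
      move=> v _.
      apply: (@continuous_sum _ _ _ (fun i (v : 'rV[R]_n) => v 0 i)) => i.
      exact: coord_continuous.
    exact: closed_eq.
  by apply/seteqP; split=> v /= [v0 v1]; split=> // i; [move=> _|]; exact: v0.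
- apply: (@rV_compact R n (fun=> `[0, 1]%classic)) => i.
  exact: segment_compact.
move=> v /= [v0 v1] i; rewrite in_itv /= v0 /= -v1 (bigD1 i) //= lerDl.
exact: sumr_ge0.
Qed.

Section SingleLetter.
Variables (R : realType) (X Y1 Y2 : finType) (W : X -> Y1 * Y2 -> R).
Hypothesis W_tr : transition W.

Definition rates_within (U V : finType) (q : U * V * X -> R) (r1 r2 r3 C : R) : Prop :=
  [/\ r1 <= rate1 W q, r2 <= rate2 W q, r3 <= rate3 W q + C & r3 <= rate4 W q].

Lemma rates_with_output (U V : finType) (q : U * V * X -> R) (p := with_output W q) :
  pmf q ->
  [/\ cond_mutual_info p (fun t => t.1.2) (fun t => t.2.1) (fun t => (t.1.1.1, t.1.1.2))
        = rate1 W q,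
      mutual_info p (fun t => t.1.1.1) (fun t => t.2.2) = rate2 W q,
      cond_mutual_info p (fun t => t.1.1.2) (fun t => t.2.2) (fun t => t.1.1.1)
        = rate3 W q &
      cond_mutual_info p (fun t => t.1.1.2) (fun t => t.2.1) (fun t => t.1.1.1)
        = rate4 W q].
Proof.
move=> q_pmf.
have p_pmf : pmf p by exact: with_output_pmf.
have ch : channel_law p W (fun t => (t.1.1.1, t.1.1.2)) (fun t => t.1.2) snd.
  have := channel_law_with_output q W_tr.
  by rewrite (_ : (fun t => t.1.1) = (fun t
    : U * V * X * (Y1 * Y2) => (t.1.1.1, t.1.1.2))) //;
    apply/funext => -[[[]]].
have qE : law p (fun t => (t.1.1.1, t.1.1.2, t.1.2)) = q.
  apply/funext => z; rewrite -(law_with_output q W_tr z).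
  by apply: eq_law => -[[[]]].
by rewrite -qE; split; [apply: rate1E | apply: rate2E | apply: rate3E | apply: rate4E].
Qed.

Lemma pmf_joint (U V : finType) (PUV : U * V -> R) (PX : U * V -> X -> R) :
  pmf PUV -> transition PX -> pmf (fun z : U * V * X => PUV z.1 * PX z.1 z.2).
Proof.
move=> [p0 p1] PX_tr; split; first by move=> z; rewrite mulr_ge0 // transition_ge0.
rewrite -p1 sum_pair; apply: eq_bigr => uv _ /=.
by rewrite -big_distrr /= transition_sum // mulr1.
Qed.

Lemma joint_with_output (U V : finType) (PUV : U * V -> R) (PX : U * V -> X -> R) :
  joint W PUV PX = with_output W (fun z : U * V * X => PUV z.1 * PX z.1 z.2).
Proof. by apply/funext => -[[uv x] y]. Qed.

Lemma single_letter_sub C r1 r2 r3 : single_letter_region W C (r1, r2, r3) ->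
  [/\ 0 <= r1, 0 <= r2 & 0 <= r3] /\ exists U V : finType, exists q : U * V * X -> R,
    pmf q /\ rates_within q r1 r2 r3 C.
Proof.
move=> [r0 [U [V [PUV [PX [[_ _ PUV_pmf PX_tr]]]]]]] /=.
rewrite joint_with_output.
have q_pmf := pmf_joint PUV_pmf PX_tr.
have [-> -> -> ->] := rates_with_output q_pmf.
rewrite le_min => -[? ? /andP[? ?]]; split=> //.
by exists U, V, (fun z => PUV z.1 * PX z.1 z.2).
Qed.

Lemma sub_single_letter C r1 r2 r3 (x0 : X) (U V : finType) (q : U * V * X -> R) :
  0 <= r1 -> 0 <= r2 -> 0 <= r3 ->
  (#|U| <= #|X| + 3)%N -> (#|V| <= #|X| + 2)%N ->
  pmf q -> rates_within q r1 r2 r3 C -> single_letter_region W C (r1, r2, r3).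
Proof.
move=> r10 r20 r30 UX VX q_pmf [h1 h2 h3 h4]; split=> //.
have [q0 q1] := q_pmf.
pose PUV uv := \sum_x q (uv, x).
have [PX [PX_tr PXE]] := disintegration x0 q_pmf.
have qE : (fun z : U * V * X => PUV z.1 * PX z.1 z.2) = q.
  by apply/funext => -[uv x]; rewrite PXE.
exists U, V, PUV, PX; split.
  split=> //; last by split=> [uv|]; [exact: sumr_ge0 | rewrite -sum_pair].
  apply: leq_trans VX _; rewrite -[X in (X <= _)%N]muln1 leq_mul2l.
  by rewrite addn3 orbT.
rewrite /= joint_with_output qE.
have [-> -> -> ->] := rates_with_output q_pmf.
by rewrite le_min; split=> //; rewrite h3.
Qed.

(** The alphabets [U] and [V] may depend on [e]; [cardinality_reduction] moves every approximating
    law to the same alphabets before compactness is invoked. *)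
Lemma single_letter_closed C r1 r2 r3 (x0 : X) : 0 <= r1 -> 0 <= r2 -> 0 <= r3 ->
  (forall e, 0 < e -> exists U V : finType, exists q : U * V * X -> R,
     pmf q /\ rates_within q (r1 - e) (r2 - e) (r3 - e) C) ->
  single_letter_region W C (r1, r2, r3).
Proof.
move=> r10 r20 r30 approx.
pose Z := ('I_(#|X| + 3) * 'I_(#|X| + 2) * X)%type.
pose qv (t : 'rV[R]_#|{: Z}|) (z : Z) : R := t 0 (enum_rank z).
have qv_cont z : continuous (qv^~ z) by exact: coord_continuous.
(* The worst margin among the four constraints. Its maximum on the simplex is attained and is at
   least [- e] for every [e > 0], hence nonnegative, and a maximizer meets all constraints
   exactly. *)
pose slack t := Num.min (Num.min (rate1 W (qv t) - r1) (rate2 W (qv t) - r2))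
  (Num.min (rate3 W (qv t) + C - r3) (rate4 W (qv t) - r3)).
have slackP t e : reflect (rates_within (qv t) (r1 - e) (r2 - e) (r3 - e) C)
    (- e <= slack t).
  rewrite /slack !le_min; apply: (iffP idP) => [/andP[/andP[? ?] /andP[? ?]]|[? ? ? ?]].
    by split; lra.
  by apply/andP; split; apply/andP; split; lra.
have slack_cont : continuous slack.
  apply: continuous_minr; apply: continuous_minr.
  - by apply: continuousDl; exact: continuous_rate1.
  - by apply: continuousDl; exact: continuous_rate2.
  - by do 2 apply: continuousDl; exact: continuous_rate3.
  - by apply: continuousDl; exact: continuous_rate4.
pose S := [set v : 'rV[R]_#|{: Z}| | (forall i, 0 <= v 0 i) /\ \sum_i v 0 i = 1].
have S_pmf v : S v -> pmf (qv v).
  move=> [v0 v1]; split=> [z|]; first exact: v0.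
  by rewrite -v1 (reindex _ (onW_bij _ (@enum_rank_bij Z))).
have approxS e : 0 < e -> exists2 v, S v & - e <= slack v.
  move=> e0; have [U [V [q [q_pmf [h1 h2 h3 h4]]]]] := approx e e0.
  have [q' [[q'0 q'1] [_ d1 d2 d3 d4]]] := cardinality_reduction W_tr q_pmf.
  pose v : 'rV[R]_#|{: Z}| := \row_i q' (enum_val i).
  have qvE : qv v = q' by apply/funext => z; rewrite /qv mxE enum_rankK.
  exists v.
    split; first by move=> i; rewrite mxE.
    rewrite -q'1 [RHS](reindex _ (onW_bij _ (@enum_val_bij Z))).
    by apply: eq_bigr => i _; rewrite mxE.
  apply/slackP; rewrite qvE; split; try exact: le_trans d1; try exact: le_trans d2.
  - by apply: le_trans h3 _; rewrite lerD2r.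
  - exact: le_trans d4.
have S0 : S !=set0 by have [v Sv _] := approxS 1 ltr01; exists v.
have [|v vS vmax] := EVT_max_rV S0 (@compact_simplex R _) (f := slack).
  exact: continuous_subspaceT.
have v0 : 0 <= slack v.
  apply/ler_addgt0Pr => e e0; have [v' v'S le_v'] := approxS e e0.
  have := vmax v'; rewrite inE => /(_ v'S); lra.
have := slackP v 0; rewrite oppr0 v0 !addr0 => /elimT/(_ isT) v_rates.
by apply: (@sub_single_letter C r1 r2 r3 x0 _ _ (qv v)); rewrite ?card_ord //;
  apply: S_pmf; rewrite inE in vS.
Qed.

Lemma single_letter_convex C :
  @convex_set R (R^o * R^o * R^o)%type (single_letter_region W C).
Proof.
move=> [[r1 r2] r3] [[s1 s2] s3] k; rewrite !inE => Hr Hs.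
have [[r10 r20 r30] [U [V [q [q_pmf hq]]]]] := single_letter_sub Hr.
have [[_ x0] _] := pmf_inhabited q_pmf.
have [[s10 s20 s30] [U' [V' [q' [q'_pmf hq']]]]] := single_letter_sub Hs.
(* [mixture] needs laws on common alphabets, so both laws are reduced beforehand; the mixture
   doubles U and is reduced once more. *)
have [a [a_pmf [_ a1 a2 a3 a4]]] := cardinality_reduction W_tr q_pmf.
have [b [b_pmf [_ b1 b2 b3 b4]]] := cardinality_reduction W_tr q'_pmf.
have l0 : 0 <= k%:inum :> R by [].
have l1 : 0 <= 1 - k%:inum :> R by rewrite subr_ge0.
set l := k%:inum : R in l0 l1 *.
pose w (i : bool) : R := if i then l else 1 - l.
have w_pmf : pmf w by split=> [[]|] //=; rewrite big_bool /=; lra.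
have ab_pmf (i : bool) : pmf (if i then a else b) by case: i.
have [c [c_pmf]] := mixture W_tr w_pmf ab_pmf.
rewrite !big_bool /= => c1 c2 c3 c4.
have [d [d_pmf [_ d1 d2 d3 d4]]] := cardinality_reduction W_tr c_pmf.
case: hq => h1 h2 h3 h4; case: hq' => h1' h2' h3' h4'.
have mono (x y x' y' : R) : x <= x' -> y <= y' -> l * x + (1 - l) * y
  <= l * x' + (1 - l) * y'.
  by move=> xx yy; rewrite lerD // ler_wpM2l.
have e1 := mono _ _ _ _ (le_trans h1 a1) (le_trans h1' b1).
have e2 := mono _ _ _ _ (le_trans h2 a2) (le_trans h2' b2).
have e4 := mono _ _ _ _ (le_trans h4 a4) (le_trans h4' b4).
have e3 : l * r3 + (1 - l) * s3 <=
    l * (rate3 W a + C) + (1 - l) * (rate3 W b + C).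
  by apply: mono; [apply: le_trans h3 _ | apply: le_trans h3' _]; rewrite lerD2r.
apply: (@sub_single_letter C _ _ _ x0 _ _ d); rewrite ?card_ord //.
- by rewrite addr_ge0 // mulr_ge0.
- by rewrite addr_ge0 // mulr_ge0.
- by rewrite addr_ge0 // mulr_ge0.
split.
- exact: le_trans (le_trans e1 c1) d1.
- exact: le_trans (le_trans e2 c2) d2.
- by apply: le_trans e3 _; clear - c3 d3; lra.
- exact: le_trans (le_trans e4 c4) d4.
Qed.

End SingleLetter.

(** * Converse *)

Section ProductMeasure.
Variables (R : realType) (I A : finType) (P : I -> A -> R).
Hypothesis P_pmf : forall i, pmf (P i).

Lemma prod_pmf : pmf (fun f : {ffun I -> A} => \prod_i P i (f i)).
Proof.
split=> [f|]; first by apply: prodr_ge0 => i _; case: (P_pmf i).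
rewrite -(bigA_distr_bigA P) big1 // => i _; by case: (P_pmf i).
Qed.

Lemma sum_prod_coordinatewise (c : I -> A -> bool) :
  \sum_(f : {ffun I -> A} | [forall i, c i (f i)]) \prod_i P i (f i) =
  \prod_i \sum_(z | c i z) P i z.
Proof.
rewrite (bigA_distr_big_dep c); apply: eq_bigl => f.
by apply/forallP/familyP.
Qed.

Definition upd (i : I) (z : A) (f : {ffun I -> A}) : {ffun I -> A} :=
  [ffun j => if j == i then z else f j].

(** Coordinate [i] is independent of any event that ignores it. With its factor removed, the sum
    [S z] does not depend on [z], because overwriting coordinate [i] is a bijection between the two
    index sets; summing over [z] identifies [S z] with the probability of [g]. *)
Lemma sum_prod_coordinate (i : I) (z : A) (g : {ffun I -> A} -> bool) :
  (forall z f, g (upd i z f) = g f) ->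
  \sum_(f : {ffun I -> A} | g f && (f i == z)) \prod_j P j (f j) =
  (\sum_(f : {ffun I -> A} | g f) \prod_j P j (f j)) * P i z.
Proof.
move=> gupd; have updii z' f : upd i z' f i = z' by rewrite ffunE eqxx.
pose S z := \sum_(f : {ffun I -> A} | g f && (f i == z)) \prod_(j | j != i) P j (f j).
have SE z' : \sum_(f : {ffun I -> A} | g f && (f i == z')) \prod_j P j (f j) = S z' * P i z'.
  rewrite big_distrl; apply: eq_bigr => f /andP[_ /eqP fz].
  by rewrite (bigD1 i) //= fz mulrC.
have S_cst z' : S z' = S z.
  rewrite /S [RHS](reindex_onto (upd i z) (upd i z')); last first.
    move=> f /andP[_ /eqP fz]; apply/ffunP => j; rewrite !ffunE.
    by case: eqP => // ->.
  apply: eq_big => [f|f _].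
    rewrite gupd updii eqxx andbT; congr (_ && _).
    apply/eqP/eqP => [fz|<-]; last by rewrite updii.
    by apply/ffunP => j; rewrite !ffunE; case: eqP => // ->.
  by apply: eq_bigr => j /negbTE ji; rewrite ffunE ji.
rewrite SE; congr (_ * _).
rewrite (partition_big (fun f : {ffun I -> A} => f i) xpredT) //=.
under eq_bigr => z' _ do rewrite SE S_cst.
by rewrite -big_distrr /=; case: (P_pmf i) => _ ->; rewrite mulr1.
Qed.

End ProductMeasure.

(** The uniform input law charges every input, so the conditional law of Y2 given Y1 computed from
    it serves all [x] at once. [D] vanishes at values y1 that no input can produce, hence it is not
    claimed to be stochastic. *)
Lemma degraded_kernel (R : realType) (X Y1 Y2 : finType) (W : X -> Y1 * Y2 -> R) :
  (0 < #|X|)%N -> physically_degraded W ->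
  exists D : Y1 -> Y2 -> R, forall x y, W x y = marg1 W x y.1 * D y.1 y.2.
Proof.
move=> X0 degr; pose PX (_ : X) : R := #|X|%:R^-1.
have X0' : #|X|%:R != 0 :> R by rewrite pnatr_eq0 -lt0n.
have PX_pmf : pmf PX.
  split=> [x|]; first by rewrite invr_ge0.
  by rewrite sumr_const -[_ *+ _]mulr_natl divff.
have := degr PX PX_pmf.
set p := fun t => _ => /= degrE.
exists (fun y1 y2 => cond_law p (fun t => t.2.2) (fun t => t.2.1) y2 y1).
move=> x [y1 y2] /=; have := degrE x y1 y2.
rewrite -mulrA => /mulfI; apply; by rewrite invr_eq0.
Qed.

(** * Entropies of output prefixes of a block code *)

Section Converse.
Variables (R : realType) (X Y1 Y2 : finType) (W : X -> Y1 * Y2 -> R).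
Hypothesis W_tr : transition W.
Variable D : Y1 -> Y2 -> R.
Hypothesis WD : forall x y, W x y = marg1 W x y.1 * D y.1 y.2.
Variables (M : finType) (n : nat) (x : M -> 'I_n -> X).
Hypothesis M0 : (0 < #|M|)%N.

Let T := (M * {ffun 'I_n -> Y1 * Y2})%type.

Definition code_law (t : T) : R := #|M|%:R^-1 * \prod_i W (x t.1 i) (t.2 i).

Local Notation p := code_law.

Let M0' : #|M|%:R != 0 :> R.
Proof. by rewrite pnatr_eq0 -lt0n. Qed.

Lemma code_law_pmf : pmf p.
Proof.
split=> [t|].
  rewrite mulr_ge0 ?invr_ge0 //; apply: prodr_ge0 => i _; exact: transition_ge0.
rewrite sum_pair /p.
under eq_bigr => m _.
  rewrite -big_distrr /= (proj2 (prod_pmf (fun i => W_tr (x m i)))) mulr1; over.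
by rewrite sumr_const -[_ *+ _]mulr_natl divff.
Qed.

(* The first [k] outputs, the other coordinates being masked, so that all prefixes
   have the same type. *)
Definition pre1 (k : nat) (t : T) : {ffun 'I_n -> option Y1} :=
  [ffun j : 'I_n => if (j < k)%N then Some (t.2 j).1 else None].
Definition pre2 (k : nat) (t : T) : {ffun 'I_n -> option Y2} :=
  [ffun j : 'I_n => if (j < k)%N then Some (t.2 j).2 else None].

Lemma pre1_eq k t t' :
  (pre1 k t == pre1 k t') = [forall j : 'I_n, (j < k)%N ==> ((t.2 j).1 == (t'.2 j).1)].
Proof.
apply/eqP/forallP => [/ffunP e j|e].
  by apply/implyP => jk; have := e j; rewrite !ffunE jk => -[->].
by apply/ffunP => j; rewrite !ffunE; case: ifP => // jk; have := e j; rewrite jk => /eqP ->.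
Qed.

Lemma pre2_eq k t t' :
  (pre2 k t == pre2 k t') = [forall j : 'I_n, (j < k)%N ==> ((t.2 j).2 == (t'.2 j).2)].
Proof.
apply/eqP/forallP => [/ffunP e j|e].
  by apply/implyP => jk; have := e j; rewrite !ffunE jk => -[->].
by apply/ffunP => j; rewrite !ffunE; case: ifP => // jk; have := e j; rewrite jk => /eqP ->.
Qed.

Lemma forall_ltnS (i : 'I_n) (c : 'I_n -> bool) :
  [forall j : 'I_n, (j < i.+1)%N ==> c j] = [forall j : 'I_n, (j < i)%N ==> c j] && c i.
Proof.
apply/forallP/andP => [e|[/forallP e ci] j].
  split; last by have := e i; rewrite ltnSn.
  by apply/forallP => j; apply/implyP => ji; have := e j; rewrite ltnS ltnW.
rewrite ltnS leq_eqVlt; apply/implyP => /orP[/eqP/val_inj -> //|ji].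
by have := e j; rewrite ji.
Qed.

Lemma pre1S (i : 'I_n) t t' :
  (pre1 i.+1 t == pre1 i.+1 t') = (pre1 i t == pre1 i t') && ((t.2 i).1 == (t'.2 i).1).
Proof. by rewrite !pre1_eq forall_ltnS. Qed.

Lemma pre2S (i : 'I_n) t t' :
  (pre2 i.+1 t == pre2 i.+1 t') = (pre2 i t == pre2 i t') && ((t.2 i).2 == (t'.2 i).2).
Proof. by rewrite !pre2_eq forall_ltnS. Qed.

Lemma pre1_0 t t' : (pre1 0 t == pre1 0 t') = true.
Proof. by rewrite pre1_eq; apply/forallP. Qed.

Lemma pre2_0 t t' : (pre2 0 t == pre2 0 t') = true.
Proof. by rewrite pre2_eq; apply/forallP. Qed.

Section Prefix.
Variables (E : finType) (G : M -> E).

(** The joint probability of the value of [G] and of the first [k] letters of Y1. *)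
Definition message_weight (k : nat) (t : T) : R := \sum_(m | G m == G t.1) #|M|%:R^-1 *
  \prod_(j < n) (if (j < k)%N then marg1 W (x m j) (t.2 j).1 else 1).

Definition kernel_weight (l : nat) (t : T) : R :=
  \prod_(j < n) (if (j < l)%N then D (t.2 j).1 (t.2 j).2 else 1).

(* The prefix of [Y2] contributes a factor that depends neither on the message nor
   on [k], hence the Markov relations below. *)
Lemma law_prefix k l t : (l <= k)%N ->
  law p (fun t => (G t.1, pre1 k t, pre2 l t)) (G t.1, pre1 k t, pre2 l t) =
  kernel_weight l t * message_weight k t.
Proof.
move=> lk; rewrite /law big_mkcond sum_pair /=.
rewrite /message_weight [X in _ = _ * X]big_mkcond big_distrr; apply: eq_bigr => m _ /=.
pose c (j : 'I_n) (z : Y1 * Y2) :=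
  ((j < k)%N ==> (z.1 == (t.2 j).1)) && ((j < l)%N ==> (z.2 == (t.2 j).2)).
rewrite (eq_bigr (fun y
  : {ffun 'I_n -> Y1 * Y2} => if (G m == G t.1) && [forall j, c j (y j)]
   then #|M|%:R^-1 * \prod_i W (x m i) (y i) else 0)); last first.
  move=> y _; rewrite !xpair_eqE pre1_eq pre2_eq -andbA; congr (if _ && _ then _ else _).
  apply/andP/forallP => [[/forallP h1 /forallP h2] j|h].
    by rewrite /c h1 h2.
  by split; apply/forallP => j; have /andP[] := h j.
case: eqP => [_|_] /=; last by rewrite mulr0 big1.
rewrite -big_mkcond /= -big_distrr /= mulrCA; congr (_ * _).
rewrite (sum_prod_coordinatewise (fun i => W (x m i))) /kernel_weight -big_split /=.
apply: eq_bigr => j _; rewrite /c.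
case: (ltnP j l) => [jl|_] /=.
  rewrite (leq_trans jl lk) /= (big_pred1 (t.2 j)); first by rewrite WD mulrC.
  by move=> [a b]; case: (t.2 j) => a' b'; rewrite /= xpair_eqE.
rewrite mul1r; case: (ltnP j k) => [jk|_] /=; last by
  rewrite -[RHS](transition_sum W_tr (x m j)).
rewrite /marg1 big_mkcond sum_pair /= (bigD1 (t.2 j).1) //= [X in _ + X]big1 ?addr0.
  by apply: eq_bigr => b _; rewrite eqxx.
by move=> a /negbTE aj; apply: big1 => b _; rewrite aj.
Qed.

(** H(G, Y1^k, Y2^l). The converse is phrased in this two-parameter family, so that conditional
    entropies of single letters are increments in [k] or [l] and telescope. Letters are numbered
    from 0: the prefix of length [i] is what precedes letter [i]. *)
Definition hpre k l := ent p (fun t => (G t.1, pre1 k t, pre2 l t)).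

(** Given [G] and the past of Y1, the letter [i] of Y1 is independent of the past of Y2: in the
    factorization of [law_prefix], the factor of Y2 is common to both sides. *)
Lemma hpre_markov (i : 'I_n) :
  hpre i.+1 i - hpre i i = hpre i.+1 0 - hpre i 0.
Proof.
have := @cond_ent_markov _ _ _ code_law_pmf _ _ _ (fun t => (t.2 i).1)
  (pre2 i) (fun t => (G t.1, pre1 i t)).
rewrite /hpre.
rewrite (@eq_ent _ _ p _ _ (fun t => ((t.2 i).1, (_, _)))
  (fun t => (G t.1, pre1 i.+1 t, pre2 i t)));
  last by move=> t t'; rewrite !xpair_eqE pre1S; do ![case: (_ == _)].
rewrite (@eq_ent _ _ p _ _ (fun t => (pre2 i t, _)) (fun t => (G t.1, pre1 i t, pre2 i t)));
  last by move=> t t'; rewrite !xpair_eqE; do ![case: (_ == _)].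
rewrite (@eq_ent _ _ p _ _ (fun t => ((t.2 i).1, (G t.1, _)))
  (fun t => (G t.1, pre1 i.+1 t, pre2 0 t)));
  last by move=> t t'; rewrite !xpair_eqE pre1S pre2_0; do ![case: (_ == _)].
rewrite (@eq_ent _ _ p _ _ (fun t => (G t.1, pre1 i t))
  (fun t => (G t.1, pre1 i t, pre2 0 t)));
  last by move=> t t'; rewrite !xpair_eqE pre2_0; do ![case: (_ == _)].
apply=> t.
rewrite (@eq_law _ _ p _ _ _
  (fun t => (G t.1, pre1 i.+1 t, pre2 i t)) _ (G t.1, pre1 i.+1 t, pre2 i t));
  last by move=> t'; rewrite !xpair_eqE pre1S; do ![case: (_ == _)].
rewrite [X in _ = _ * X](@eq_law _ _ p _ _ _
  (fun t => (G t.1, pre1 i t, pre2 i t)) _ (G t.1, pre1 i t, pre2 i t));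
  last by move=> t'; rewrite !xpair_eqE; do ![case: (_ == _)].
rewrite [X in _ = X * _](@eq_law _ _ p _ _ _
  (fun t => (G t.1, pre1 i.+1 t, pre2 0 t)) _ (G t.1, pre1 i.+1 t, pre2 0 t));
  last by move=> t'; rewrite !xpair_eqE pre1S pre2_0; do ![case: (_ == _)].
rewrite [X in _ * X = _](@eq_law _ _ p _ _ _
  (fun t => (G t.1, pre1 i t, pre2 0 t)) _ (G t.1, pre1 i t, pre2 0 t));
  last by move=> t'; rewrite !xpair_eqE pre2_0; do ![case: (_ == _)].
rewrite !law_prefix //.
have -> : kernel_weight 0 t = 1 by rewrite /kernel_weight big1.
ring.
Qed.

End Prefix.

(** Once Y1^k is known, Y2^k carries no further information on the messages. With [k = n] this
    removes Y2^n from the Fano bound of [converse_rate4]. *)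
Lemma hpre_markov_message (E F : finType) (G : M -> E) (H : M -> F) k :
  hpre (fun m => (H m, G m)) k k - hpre G k k = hpre (fun m => (H m, G m)) k 0 - hpre G k 0.
Proof.
have := @cond_ent_markov _ _ _ code_law_pmf _ _ _ (fun t => H t.1)
  (pre2 k) (fun t => (G t.1, pre1 k t)).
rewrite /hpre.
rewrite (@eq_ent _ _ p _ _ (fun t => (H t.1, (_, _)))
  (fun t => (H t.1, G t.1, pre1 k t, pre2 k t)));
  last by move=> t t'; rewrite !xpair_eqE; do ![case: (_ == _)].
rewrite (@eq_ent _ _ p _ _ (fun t => (pre2 k t, _)) (fun t => (G t.1, pre1 k t, pre2 k t)));
  last by move=> t t'; rewrite !xpair_eqE; do ![case: (_ == _)].
rewrite (@eq_ent _ _ p _ _ (fun t => (H t.1, (G t.1, _)))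
  (fun t => (H t.1, G t.1, pre1 k t, pre2 0 t)));
  last by move=> t t'; rewrite !xpair_eqE pre2_0; do ![case: (_ == _)].
rewrite (@eq_ent _ _ p _ _ (fun t => (G t.1, pre1 k t))
  (fun t => (G t.1, pre1 k t, pre2 0 t)));
  last by move=> t t'; rewrite !xpair_eqE pre2_0; do ![case: (_ == _)].
apply=> t.
pose HG m := (H m, G m).
rewrite (@eq_law _ _ p _ _ _
  (fun t => (HG t.1, pre1 k t, pre2 k t)) _ (HG t.1, pre1 k t, pre2 k t));
  last by move=> t'; rewrite !xpair_eqE; do ![case: (_ == _)].
rewrite [X in _ = _ * X](@eq_law _ _ p _ _ _
  (fun t => (G t.1, pre1 k t, pre2 k t)) _ (G t.1, pre1 k t, pre2 k t));
  last by move=> t'; rewrite !xpair_eqE; do ![case: (_ == _)].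
rewrite [X in _ = X * _](@eq_law _ _ p _ _ _
  (fun t => (HG t.1, pre1 k t, pre2 0 t)) _ (HG t.1, pre1 k t, pre2 0 t));
  last by move=> t'; rewrite !xpair_eqE pre2_0; do ![case: (_ == _)].
rewrite [X in _ * X = _](@eq_law _ _ p _ _ _
  (fun t => (G t.1, pre1 k t, pre2 0 t)) _ (G t.1, pre1 k t, pre2 0 t));
  last by move=> t'; rewrite !xpair_eqE pre2_0; do ![case: (_ == _)].
rewrite !law_prefix //.
have -> : kernel_weight 0 t = 1 by rewrite /kernel_weight big1.
ring.
Qed.

Lemma memoryless (E : finType) (f : T -> E) (i : 'I_n) :
  (forall m z y, f (m, upd i z y) = f (m, y)) ->
  channel_law p W f (fun t => x t.1 i) (fun t => t.2 i).
Proof.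
move=> fi a x0 y0; rewrite /law [LHS]big_mkcond
  [X in _ = X * _]big_mkcond !sum_pair big_distrl /=.
apply: eq_bigr => m _; rewrite -!big_mkcond /= -!big_distrr /= -mulrA.
congr (_ * _).
have [xm|xm] := eqVneq (x m i) x0; last first.
  by rewrite !big_pred0 ?mul0r // => y; rewrite !xpair_eqE (negbTE xm) ?andbF.
rewrite -xm -(sum_prod_coordinate (fun i => W_tr (x m i))) //.
  by move=> z y; rewrite fi.
Qed.

End Converse.

(** * Single-letter bounds and Fano's inequality *)

Section NLetter.
Variables (R : realType) (X Y1 Y2 : finType) (W : X -> Y1 * Y2 -> R).
Hypothesis W_tr : transition W.
Variable D : Y1 -> Y2 -> R.
Hypothesis WD : forall x y, W x y = marg1 W x y.1 * D y.1 y.2.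
Variables (N1 N2 N3 N12 : finType) (n : nat).
Let M := (N1 * N2 * N3)%type.
Variable x : M -> 'I_n -> X.
Hypothesis M0 : (0 < #|{: M}|)%N.
Variables (d1 : {ffun 'I_n -> Y1} -> N1) (d2 : {ffun 'I_n -> Y2} -> N2)
  (d3 : {ffun 'I_n -> Y2} * N12 -> N3) (conf : {ffun 'I_n -> Y1} -> N12).
Let T := (M * {ffun 'I_n -> Y1 * Y2})%type.
Let p : T -> R := code_law W x.

Definition out1 (t : T) : {ffun 'I_n -> Y1} := [ffun j => (t.2 j).1].
Definition out2 (t : T) : {ffun 'I_n -> Y2} := [ffun j => (t.2 j).2].

Definition decoding_error (t : T) : bool :=
  [|| d1 (out1 t) != t.1.1.1, d2 (out2 t) != t.1.1.2
    | d3 (out2 t, conf (out1 t)) != t.1.2].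

Variable eps : R.
Hypothesis p_error : \sum_(t | decoding_error t) p t <= eps.

Let p_pmf : pmf p. Proof. exact: code_law_pmf. Qed.
Let p_ge0 t : 0 <= p t. Proof. by case: p_pmf. Qed.

Lemma out1_eq t t' : (out1 t == out1 t') = (pre1 n t == pre1 n t').
Proof.
rewrite pre1_eq; apply/eqP/forallP => [/ffunP e j|e].
  by have := e j; rewrite !ffunE => ->; rewrite eqxx implybT.
by apply/ffunP => j; rewrite !ffunE; have := e j; rewrite ltn_ord => /eqP.
Qed.

Lemma out2_eq t t' : (out2 t == out2 t') = (pre2 n t == pre2 n t').
Proof.
rewrite pre2_eq; apply/eqP/forallP => [/ffunP e j|e].
  by have := e j; rewrite !ffunE => ->; rewrite eqxx implybT.
by apply/ffunP => j; rewrite !ffunE; have := e j; rewrite ltn_ord => /eqP.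
Qed.

(* The law of [(U_i, V_i, X_i)] with [U_i = (M2, Y2^(i-1))], [V_i = (M2', Y1^(i-1))]. *)
Definition letter_law (i : 'I_n) :=
  law p (fun t : T => ((t.1.1.2, pre2 i t), (t.1.2, pre1 i t), x t.1 i)).

Lemma letter_law_pmf i : pmf (letter_law i).
Proof. exact: law_pmf. Qed.

Local Notation h := (hpre W x).
Let g0 (m : M) := tt.
Let g2 (m : M) := m.1.2.
Let g23 (m : M) := (m.2, m.1.2).
Let gm (m : M) := m.

Let pre_upd1 (i : 'I_n) (m : M) z (y : {ffun 'I_n -> Y1 * Y2}) :
  pre1 i (m, upd i z y) = pre1 i (m, y).
Proof.
by apply/ffunP => j; rewrite !ffunE /=; case: ltnP => // ji; case: eqP ji => // ->;
  rewrite ltnn.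
Qed.

Let pre_upd2 (i : 'I_n) (m : M) z (y : {ffun 'I_n -> Y1 * Y2}) :
  pre2 i (m, upd i z y) = pre2 i (m, y).
Proof.
by apply/ffunP => j; rewrite !ffunE /=; case: ltnP => // ji; case: eqP ji => // ->;
  rewrite ltnn.
Qed.

Let ch (i : 'I_n) : channel_law p W (fun t : T => ((t.1.1.2, pre2 i t), (t.1.2, pre1 i t)))
  (fun t => x t.1 i) (fun t => t.2 i).
Proof. by apply: memoryless => // m z y; rewrite pre_upd1 pre_upd2. Qed.

Ltac entc := move=> t t'; rewrite ?xpair_eqE ?pre1S ?pre2S ?pre1_0 ?pre2_0;
  do ![case: (_ == _)] => //.

Let h0 (E : finType) (G : M -> E) : h G 0 0 = ent p (fun t => G t.1).
Proof. by apply: eq_ent; entc. Qed.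

(** Equality holds: [hpre_markov] deletes Y2^(i-1) from the conditioning. By memorylessness H(Y1_i |
    X_i) equals both H(Y1_i | U_i, V_i, X_i) and H(Y1_i | M, Y1^(i-1), Y2^(i-1)); these are [e1] and
    [e2]. *)
Lemma rate1_letter (i : 'I_n) : rate1 W (letter_law i) =
  (h g23 i.+1 0 - h g23 i 0) - (h gm i.+1 0 - h gm i 0).
Proof.
rewrite /letter_law -(rate1E W_tr p_pmf (ch i)) cond_mutual_info_ent //.
have c2 : channel_law p W (fun t : T => (t.1, pre1 i t, pre2 i t)) (fun t => x t.1 i)
  (fun t => t.2 i).
  by apply: memoryless => // m z y; rewrite pre_upd1 pre_upd2.
have e1 := hent_law_input (marg1_transition W_tr) p_pmf (channel_law_marg1 (ch i)).
have e2 := hent_law_input (marg1_transition W_tr) p_pmf (channel_law_marg1 c2).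
rewrite -(hpre_markov W_tr WD x M0 g23) -(hpre_markov W_tr WD x M0 gm).
move: e1; rewrite -e2 => {e2}.
rewrite (@eq_ent _ _ p _ _ (fun t : T => (_, x t.1 i, (t.2 i).1)) (fun t
  : T => (x t.1 i, (t.2 i).1, (t.1.1.2, pre2 i t, (t.1.2, pre1 i t))))); last by entc.
rewrite (@eq_ent _ _ p _ _ (fun t : T => (_, x t.1 i)) (fun t
  : T => (x t.1 i, (t.1.1.2, pre2 i t, (t.1.2, pre1 i t))))); last by entc.
rewrite (@eq_ent _ _ p _ _ (fun t : T => (t.1, pre1 i t, pre2 i t, x t.1 i, (t.2 i).1))
  (fun t => (gm t.1, pre1 i.+1 t, pre2 i t))); last first.
  by move=> t t'; rewrite !xpair_eqE pre1S /gm; case: eqP => [->|]; rewrite ?eqxx;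
    do ![case: (_ == _)].
rewrite (@eq_ent _ _ p _ _ (fun t : T => (t.1, pre1 i t, pre2 i t, x t.1 i))
  (fun t => (gm t.1, pre1 i t, pre2 i t))); last first.
  by move=> t t'; rewrite !xpair_eqE /gm; case: eqP => [->|]; rewrite ?eqxx;
    do ![case: (_ == _)].
rewrite (@eq_ent _ _ p _ _ (fun t : T => ((t.2 i).1, _)) (fun t
  : T => (g23 t.1, pre1 i.+1 t, pre2 i t))); last by entc.
rewrite (@eq_ent _ _ p _ _ (fun t : T => (t.1.1.2, pre2 i t, (t.1.2, pre1 i t))) (fun t
  : T => (g23 t.1, pre1 i t, pre2 i t))); last by entc.
rewrite /hpre -/p; lra.
Qed.

(** The only loss is H(Y2_i) >= H(Y2_i | Y2^(i-1)). *)
Lemma rate2_letter (i : 'I_n) :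
  (h g0 0 i.+1 - h g0 0 i) - (h g2 0 i.+1 - h g2 0 i) <= rate2 W (letter_law i).
Proof.
rewrite /letter_law -(rate2E p_pmf (ch i)) mutual_info_ent //.
have := ent_subadd p_pmf (fun t : T => (t.2 i).2) (fun t => (g0 t.1, pre1 0 t, pre2 i t)).
rewrite (@eq_ent _ _ p _ _ (fun t : T => (_, (_, _, _)))
  (fun t => (g0 t.1, pre1 0 t, pre2 i.+1 t))); last by entc.
rewrite (@eq_ent _ _ p _ _ (fun t : T => (_, (t.2 i).2))
  (fun t => (g2 t.1, pre1 0 t, pre2 i.+1 t))); last by entc.
rewrite (@eq_ent _ _ p _ _ (fun t : T => (t.1.1.2, pre2 i t))
  (fun t => (g2 t.1, pre1 0 t, pre2 i t))); last by entc.
rewrite /hpre -/p; lra.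
Qed.

(** The prefix Y1^(i-1) inside V_i only adds conditioning to the subtracted entropy, hence only
    increases the information. *)
Lemma rate3_letter (i : 'I_n) :
  (h g2 0 i.+1 - h g2 0 i) - (h g23 0 i.+1 - h g23 0 i) <= rate3 W (letter_law i).
Proof.
rewrite /letter_law -(rate3E p_pmf (ch i)) cond_mutual_info_ent //.
have := cond_ent_reduce p_pmf (fun t : T => (t.2 i).2) (pre1 i)
  (fun t => (g23 t.1, pre1 0 t, pre2 i t)).
rewrite (@eq_ent _ _ p _ _ (fun t : T => (_, (_, (_, _, _))))
  (fun t => (g23 t.1, pre1 i t, pre2 i.+1 t))); last by entc.
rewrite (@eq_ent _ _ p _ _ (fun t : T => (_, (g23 t.1, _, _)))
  (fun t => (g23 t.1, pre1 i t, pre2 i t))); last by entc.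
rewrite (@eq_ent _ _ p _ _ (fun t : T => ((t.2 i).2, (g23 t.1, _, _)))
  (fun t => (g23 t.1, pre1 0 t, pre2 i.+1 t))); last by entc.
rewrite (@eq_ent _ _ p _ _ (fun t : T => (t.1.2, pre1 i t, (t.1.1.2, pre2 i t)))
  (fun t => (g23 t.1, pre1 i t, pre2 i t))); last by entc.
rewrite (@eq_ent _ _ p _ _ (fun t : T => ((t.2 i).2, (t.1.1.2, pre2 i t)))
  (fun t => (g2 t.1, pre1 0 t, pre2 i.+1 t))); last by entc.
rewrite (@eq_ent _ _ p _ _ (fun t : T => (t.1.2, pre1 i t, _, _))
  (fun t => (g23 t.1, pre1 i t, pre2 i.+1 t))); last by entc.
rewrite (@eq_ent _ _ p _ _ (fun t : T => (t.1.1.2, pre2 i t))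
  (fun t => (g2 t.1, pre1 0 t, pre2 i t))); last by entc.
rewrite /hpre -/p; lra.
Qed.

(** H(Y1_i | U_i) is bounded below by conditioning on Y1^(i-1) as well; then [hpre_markov] removes
    Y2^(i-1) from both entropies. *)
Lemma rate4_letter (i : 'I_n) :
  (h g2 i.+1 0 - h g2 i 0) - (h g23 i.+1 0 - h g23 i 0) <= rate4 W (letter_law i).
Proof.
rewrite /letter_law -(rate4E p_pmf (ch i)) cond_mutual_info_ent //.
rewrite -(hpre_markov W_tr WD x M0 g23) -(hpre_markov W_tr WD x M0 g2).
have := cond_ent_reduce p_pmf (fun t : T => (t.2 i).1) (pre1 i)
  (fun t => (g2 t.1, pre2 i t)).
rewrite (@eq_ent _ _ p _ _ (fun t : T => (_, (_, (_, _))))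
  (fun t => (g2 t.1, pre1 i.+1 t, pre2 i t))); last by entc.
rewrite (@eq_ent _ _ p _ _ (fun t : T => (_, (g2 t.1, _)))
  (fun t => (g2 t.1, pre1 i t, pre2 i t))); last by entc.
rewrite (@eq_ent _ _ p _ _ (fun t : T => (t.1.2, pre1 i t, (t.1.1.2, pre2 i t)))
  (fun t => (g23 t.1, pre1 i t, pre2 i t))); last by entc.
rewrite (@eq_ent _ _ p _ _ (fun t : T => (t.1.2, pre1 i t, _, _))
  (fun t => (g23 t.1, pre1 i.+1 t, pre2 i t))); last by entc.
rewrite /hpre -/p /g2; lra.
Qed.

Let fano_error (A B : finType) (f : T -> A) (k : T -> B) (g : B -> A) :
  (forall t, g (k t) != f t -> decoding_error t) ->
  ent p (fun t => (f t, k t)) - ent p k <= ln 2 + eps * ln #|A|%:R.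
Proof.
move=> gP; apply: le_trans (fano p_pmf f k g) _; rewrite lerD2l.
have [t0 _] := pmf_inhabited p_pmf.
have A0 : (0 < #|A|)%N by apply/card_gt0P; exists (f t0).
rewrite ler_wpM2r ?ln_ge0 ?ler1n //; apply: le_trans p_error.
rewrite [X in _ <= X](bigID (fun t => g (k t) != f t)) /=.
rewrite [X in _ <= X + _](eq_bigl (fun t => g (k t) != f t)).
  by rewrite lerDl sumr_ge0.
by move=> t; case: (boolP (g (k t) != f t)) => [/gP ->|]; rewrite ?andbF.
Qed.

Let lnN1 : 0 < #|N1|%:R :> R. Proof. by have := M0;
  rewrite !card_prod !muln_gt0 ltr0n => /andP[/andP[]]. Qed.
Let lnN2 : 0 < #|N2|%:R :> R. Proof. by have := M0;
  rewrite !card_prod !muln_gt0 ltr0n => /andP[/andP[]]. Qed.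
Let lnN3 : 0 < #|N3|%:R :> R. Proof. by have := M0;
  rewrite !card_prod !muln_gt0 ltr0n => /andP[]. Qed.

Let ent_message : ent p (fun t => t.1) = ln #|N1|%:R + ln #|N2|%:R + ln #|N3|%:R.
Proof.
have lawE m : law p (fun t => t.1) m = #|{: M}|%:R^-1.
  rewrite /law big_mkcond sum_pair /= (bigD1 m) //= eqxx [X in _ + X]big1 ?addr0.
    rewrite -big_distrr /= (proj2 (prod_pmf (fun i => W_tr (x m i)))) mulr1 //.
  by move=> m' /negbTE mm'; apply: big1 => y _; rewrite mm'.
rewrite /ent; under eq_bigr => t _ do rewrite lawE.
rewrite -big_distrl /=; case: p_pmf => _ ->; rewrite mul1r lnV ?opprK ?posrE ?ltr0n //.
by rewrite !card_prod !natrM !lnM ?posrE ?mulr_gt0.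
Qed.

(** Subadditivity and H(M1) <= ln |N1| extract this from the entropy of the full message, without
    computing any marginal law. *)
Let ent_g23 : ln #|N2|%:R + ln #|N3|%:R <= h g23 0 0.
Proof.
rewrite h0; have := ent_subadd p_pmf (fun t => t.1.1.1) (fun t => g23 t.1).
have := ent_le_ln_card p_pmf (fun t => t.1.1.1).
rewrite (@eq_ent _ _ p _ _ (fun t : T => (_, g23 t.1)) (fun t => t.1)); last first.
  by move=> [[[a b] c] y] [[[a' b'] c'] y']; rewrite !xpair_eqE; do ![case: (_ == _)].
rewrite ent_message; lra.
Qed.

Let ent_g2_le : h g2 0 0 <= ln #|N2|%:R.
Proof. by rewrite h0; exact: ent_le_ln_card. Qed.

Let ent_g2_ge : ln #|N2|%:R <= h g2 0 0.
Proof.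
have := ent_subadd p_pmf (fun t => t.1.2) (fun t => g2 t.1).
have := ent_le_ln_card p_pmf (fun t => t.1.2).
have := ent_g23; rewrite !h0; lra.
Qed.

Let ent_g23_le : h g23 0 0 <= ln #|N2|%:R + ln #|N3|%:R.
Proof.
rewrite h0; have := ent_subadd p_pmf (fun t => t.1.2) (fun t => t.1.1.2).
have := ent_le_ln_card p_pmf (fun t => t.1.2).
have := ent_le_ln_card p_pmf (fun t => t.1.1.2).
rewrite /g23; lra.
Qed.

Let tele (F : nat -> R) : \sum_(i < n) (F i.+1 - F i) = F n - F 0%N.
Proof. by rewrite -(big_mkord xpredT (fun i => F i.+1 - F i)) telescope_sumr. Qed.

(** The increments telescope to I(M1; Y1^n | M2, M2'). Fano's inequality is applied with the other
    messages given to Decoder 1 for free. *)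
Lemma converse_rate1 :
  (1 - eps) * ln #|N1|%:R <= \sum_i rate1 W (letter_law i) + ln 2.
Proof.
under eq_bigr => i _ do rewrite rate1_letter.
rewrite sumrB (tele (h g23 ^~ 0%N)) (tele (h gm ^~ 0%N)) /=.
have := @fano_error _ _ (fun t => t.1.1.1) (fun t => (g23 t.1, out1 t)) (fun z => d1 z.2).
have err t : d1 (out1 t) != t.1.1.1 -> decoding_error t.
  by rewrite /decoding_error => ->.
move=> /(_ err).
rewrite (@eq_ent _ _ p _ _ (fun t : T => (_, (g23 t.1, _)))
  (fun t => (gm t.1, pre1 n t, pre2 0 t))); last first.
  move=> t t'; rewrite /gm !xpair_eqE out1_eq pre2_0.
  by case: t t' => [[[a b] c] y] [[[a' b'] c'] y'] /=;
    rewrite !xpair_eqE; do ![case: (_ == _)].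
rewrite (@eq_ent _ _ p _ _ (fun t : T => (g23 t.1, _))
  (fun t => (g23 t.1, pre1 n t, pre2 0 t))); last first.
  by move=> t t'; rewrite !xpair_eqE out1_eq pre2_0 andbT.
have := ent_g23_le; have : h gm 0 0 = _ := etrans (h0 gm) ent_message.
rewrite /hpre -/p; lra.
Qed.

Lemma converse_rate2 :
  (1 - eps) * ln #|N2|%:R <= \sum_i rate2 W (letter_law i) + ln 2.
Proof.
have : \sum_(i < n) ((h g0 0 i.+1 - h g0 0 i) - (h g2 0 i.+1 - h g2 0 i)) <=
    \sum_i rate2 W (letter_law i) by apply: ler_sum => i _; exact: rate2_letter.
rewrite sumrB (tele (h g0 0%N)) (tele (h g2 0%N)) /=.
have := @fano_error _ _ (fun t => t.1.1.2) out2 d2.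
have err t : d2 (out2 t) != t.1.1.2 -> decoding_error t.
  by rewrite /decoding_error => ->; rewrite orbT.
move=> /(_ err).
rewrite (@eq_ent _ _ p _ _ (fun t : T => (_, out2 t))
  (fun t => (g2 t.1, pre1 0 t, pre2 n t))); last first.
  by move=> t t'; rewrite !xpair_eqE out2_eq pre1_0 andbT.
rewrite (@eq_ent _ _ p _ _ out2 (fun t => (g0 t.1, pre1 0 t, pre2 n t))); last first.
  by move=> t t'; rewrite !xpair_eqE out2_eq pre1_0 andbT.
have := ent_g2_ge; have : h g0 0 0 = 0 by rewrite h0; exact: ent_unit.
rewrite /hpre -/p; lra.
Qed.

(** The increments telescope to I(M2'; Y2^n | M2). Decoder 2 also sees the conference index, whose
    entropy is at most [ln #|N12|]; giving it away changes the conditional entropy of M2' by at most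
    that amount. *)
Lemma converse_rate3 : (1 - eps) * ln #|N3|%:R <=
  \sum_i rate3 W (letter_law i) + ln #|N12|%:R + ln 2.
Proof.
have : \sum_(i < n) ((h g2 0 i.+1 - h g2 0 i) - (h g23 0 i.+1 - h g23 0 i)) <=
    \sum_i rate3 W (letter_law i) by apply: ler_sum => i _; exact: rate3_letter.
rewrite sumrB (tele (h g2 0%N)) (tele (h g23 0%N)) /=.
have := @fano_error _ _ (fun t => t.1.2) (fun t => (conf (out1 t), (g2 t.1, out2 t)))
  (fun z => d3 (z.2.2, z.1)).
have err t : d3 (out2 t, conf (out1 t)) != t.1.2 -> decoding_error t.
  by rewrite /decoding_error => ->; rewrite !orbT.
move=> /(_ err).
have := ent_subadd p_pmf (fun t => conf (out1 t)) (fun t => (g2 t.1, out2 t)).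
have := ent_le_ln_card p_pmf (fun t => conf (out1 t)).
have := @le_ent _ _ p p_pmf _ _ (fun t => (t.1.2, (conf (out1 t), (g2 t.1, out2 t))))
  (fun t => (g23 t.1, pre1 0 t, pre2 n t)).
have det t t' : (t.1.2, (conf (out1 t), (g2 t.1, out2 t))) =
    (t'.1.2, (conf (out1 t'), (g2 t'.1, out2 t'))) ->
    (g23 t.1, pre1 0 t, pre2 n t) = (g23 t'.1, pre1 0 t', pre2 n t').
  move=> [e1 _ e2 e3]; apply/eqP; rewrite !xpair_eqE pre1_0 -out2_eq e3 e1 !eqxx !andbT /=.
  exact/eqP.
move=> /(_ det).
rewrite (@eq_ent _ _ p _ _ (fun t : T => (g2 t.1, out2 t))
  (fun t => (g2 t.1, pre1 0 t, pre2 n t))); last first.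
  by move=> t t'; rewrite !xpair_eqE out2_eq pre1_0 andbT.
have := ent_g2_le; have := ent_g23.
rewrite /hpre -/p; lra.
Qed.

(** The conference index is a function of Y1^n, so M2' can be estimated from both outputs; then Y2^n
    is dropped by [hpre_markov_message]. *)
Lemma converse_rate4 :
  (1 - eps) * ln #|N3|%:R <= \sum_i rate4 W (letter_law i) + ln 2.
Proof.
have : \sum_(i < n) ((h g2 i.+1 0 - h g2 i 0) - (h g23 i.+1 0 - h g23 i 0)) <=
    \sum_i rate4 W (letter_law i) by apply: ler_sum => i _; exact: rate4_letter.
rewrite sumrB (tele (h g2 ^~ 0%N)) (tele (h g23 ^~ 0%N)) /=.
have := hpre_markov_message W_tr WD x M0 g2 (fun m : M => m.2) n; rewrite -/g23.
have := @fano_error _ _ (fun t => t.1.2) (fun t => (g2 t.1, out1 t, out2 t))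
  (fun z => d3 (z.2, conf z.1.2)).
have err t : d3 (out2 t, conf (out1 t)) != t.1.2 -> decoding_error t.
  by rewrite /decoding_error => ->; rewrite !orbT.
move=> /(_ err).
rewrite (@eq_ent _ _ p _ _ (fun t : T => (t.1.2, (g2 t.1, out1 t, out2 t)))
  (fun t => (g23 t.1, pre1 n t, pre2 n t))); last first.
  by move=> t t'; rewrite !xpair_eqE out2_eq out1_eq; do ![case: (_ == _)].
rewrite (@eq_ent _ _ p _ _ (fun t : T => (g2 t.1, out1 t, out2 t))
  (fun t => (g2 t.1, pre1 n t, pre2 n t))); last first.
  by move=> t t'; rewrite !xpair_eqE out2_eq out1_eq.
have := ent_g2_le; have := ent_g23.
rewrite /hpre -/p; lra.
Qed.

End NLetter.

(** * From block codes to the single-letter region *)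

Section TupleFfun.
Variables (Y1 Y2 : finType) (n : nat).

Definition tuples_of (y : {ffun 'I_n -> Y1 * Y2}) : n.-tuple Y1 * n.-tuple Y2 :=
  ([tuple (y i).1 | i < n], [tuple (y i).2 | i < n]).

Lemma tuples_of_bij : bijective tuples_of.
Proof.
exists (fun z : n.-tuple Y1 * n.-tuple Y2 => [ffun i => (tnth z.1 i, tnth z.2 i)]).
  by move=> y; apply/ffunP => i; rewrite ffunE !tnth_mktuple; case: (y i).
by move=> [a b]; congr (_, _); apply: eq_from_tnth => i; rewrite tnth_mktuple ffunE.
Qed.

End TupleFfun.

Section ConverseCode.
Variables (R : realType) (X Y1 Y2 : finType) (W : X -> Y1 * Y2 -> R).
Hypotheses (W_tr : transition W) (W_degr : physically_degraded W).

Lemma error_code_law (n nu1 nu2 nu2' nu12 : nat) (c : code X Y1 Y2 n nu1 nu2 nu2' nu12) :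
  \sum_(t | decoding_error
      (fun f => dec1 c [tuple f i | i < n]) (fun f => dec2 c [tuple f i | i < n])
      (fun z => dec2' c ([tuple z.1 i | i < n], z.2))
        (fun f => conf c [tuple f i | i < n]) t)
    code_law W (fun m i => tnth (enc c m) i) t = avg_error' c W.
Proof.
rewrite /avg_error' big_mkcond !sum_pair big_distrr; apply: eq_bigr => m1 _ /=.
rewrite !big_distrr; apply: eq_bigr => m2 _ /=.
rewrite !big_distrr; apply: eq_bigr => m3 _ /=.
rewrite -big_mkcond /= /code_law -big_distrr /=; congr (_ * _).
  by rewrite !card_prod !card_ord.
rewrite (reindex _ (onW_bij _ (@tuples_of_bij Y1 Y2 n))) /=.
have tupE (A : finType) (f : 'I_n -> A)
  : [tuple [ffun i => f i] i | i < n] = [tuple f i | i < n].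
  by apply: eq_from_tnth => i; rewrite !tnth_mktuple ffunE.
apply: eq_big => [y|y _].
  by rewrite !inE /decoding_error /= !tupE orbA.
by apply: eq_bigr => i _ /=; rewrite !tnth_mktuple; case: (y i).
Qed.

(** Uniform time sharing over the [n] letters puts the time index into U. [mixture] requires the
    same alphabets for all letters, which the masked prefixes provide. *)
Lemma converse_code (n nu1 nu2 nu2' nu12 : nat) (eps : R) :
  (0 < n)%N -> code_exists W n nu1 nu2 nu2' nu12 eps ->
  exists U V : finType, exists q : U * V * X -> R, pmf q /\
    [/\ (1 - eps) * ln nu1%:R <= n%:R * rate1 W q + ln 2,
        (1 - eps) * ln nu2%:R <= n%:R * rate2 W q + ln 2,
        (1 - eps) * ln nu2'%:R <= n%:R * rate3 W q + ln nu12%:R + ln 2 &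
        (1 - eps) * ln nu2'%:R <= n%:R * rate4 W q + ln 2].
Proof.
move=> n0 [[nu1_gt0 nu2_gt0 nu2'_gt0 nu12_gt0] [c [_ c_err]]].
have M0 : (0 < #|{: 'I_nu1 * 'I_nu2 * 'I_nu2'}|)%N.
  by rewrite !card_prod !card_ord !muln_gt0 nu1_gt0 nu2_gt0.
have X0 : (0 < #|X|)%N.
  have /card_gt0P[m _] := M0.
  by apply/card_gt0P; exists (tnth (enc c m) (Ordinal n0)).
have [D WD] := degraded_kernel X0 W_degr.
rewrite -error_code_law in c_err.
pose q := letter_law W (n := n) (fun m i => tnth (enc c m) i).
pose w (i : 'I_n) : R := n%:R^-1.
have n0' : n%:R != 0 :> R by rewrite pnatr_eq0 -lt0n.
have w_pmf : pmf w.
  split=> [i|]; first by rewrite invr_ge0.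
  by rewrite sumr_const card_ord -[_ *+ _]mulr_natl divff.
have q_pmf i : pmf (q i) by apply: letter_law_pmf.
have [q' [q'_pmf r1 r2 r3 r4]] := mixture W_tr w_pmf q_pmf.
have sumE (F : 'I_n -> R) r : \sum_i w i * F i <= r -> \sum_i F i <= n%:R * r.
  rewrite -big_distrr /= -(@ler_pM2l _ n%:R) ?ltr0n // mulrA divff // mul1r.
  exact.
exists _, _, q'; split => //.
have := converse_rate1 W_tr WD M0 c_err.
have := converse_rate2 W_tr M0 c_err.
have := converse_rate3 W_tr M0 c_err.
have := converse_rate4 W_tr WD M0 c_err.
rewrite !card_ord -/q.
move: (sumE _ _ r1) (sumE _ _ r2) (sumE _ _ r3) (sumE _ _ r4) => s1 s2 s3 s4.
by move=> h4 h3 h2 h1; clear - s1 s2 s3 s4 h1 h2 h3 h4; split; lra.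
Qed.

Lemma capacity_region_ge0 r1 r2 r3 C : capacity_region W (r1, r2, r3, C) ->
  [/\ 0 <= r1, 0 <= r2 & 0 <= r3].
Proof.
move=> cl.
have ge e : 0 < e -> [/\ - e <= r1, - e <= r2 & - e <= r3].
  move=> e0; have [[[[a1 a2] a3] c] [/= [[h1 h2 h3 _] _] [[[/= b1 b2] b3] _]]] :=
    cl _ (nbhsx_ballx (r1, r2, r3, C) e e0).
  move: b1 b2 b3; rewrite /ball /= !ltr_norml => /andP[? ?] /andP[? ?] /andP[? ?].
  by split; lra.
by split; rewrite -oppr_le0; apply/ler_addgt0Pr => e /ge[? ? ?]; lra.
Qed.

(** The four losses of [d] are the distance from [r] to the achievable rate [a], the tolerance
    gamma, the term [eps * a], and [ln 2 / N]. *)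
Let rate_lower_bound (N a r d eps L F : R) :
  0 < N -> 0 < d -> 0 <= eps -> eps <= 1 -> eps * a <= d -> r - d <= a ->
  N * (a - d) <= L -> ln 2 <= N * d -> (1 - eps) * L <= N * F + ln 2 ->
  r - 4 * d <= F.
Proof.
move=> N0 d0 e0 e1 ead ra NL ln2N LF.
have h : (1 - eps) * (N * (a - d)) <= N * F + N * d.
  apply: le_trans (le_trans LF _); last by rewrite lerD2l.
  by rewrite ler_wpM2l // subr_ge0.
have {h} : (1 - eps) * (a - d) <= F + d.
  by rewrite -(ler_pM2l N0) mulrCA [X in _ <= X]mulrDr.
have : 0 <= eps * d by rewrite mulr_ge0 // ltW.
lra.
Qed.

Lemma capacity_sub_rates r1 r2 r3 C e : 0 <= r1 -> 0 <= r2 -> 0 <= r3 -> 0 < e ->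
  capacity_region W (r1, r2, r3, C) ->
  exists U V : finType, exists q : U * V * X -> R,
    pmf q /\ rates_within W q (r1 - e) (r2 - e) (r3 - e) C.
Proof.
(* Every bound loses [4 * d]; the one with the link loses [2 * d] more, since the link rate [c] is
   within [d] of [C] and the code may exceed it by [d]. So [8 * d] leaves room. *)
move=> r10 r20 r30 e0 cl; pose d := e / 8.
have d0 : 0 < d by rewrite divr_gt0.
have dE : d * 8 = e by rewrite divfK.
have [[[[a1 a2] a3] c] [/= [[h1 h2 h3 hc] ach] [[[/= b1 b2] b3] b4]]] :=
  cl _ (nbhsx_ballx (r1, r2, r3, C) d d0).
move: b1 b2 b3 b4; rewrite /ball /= !ltr_norml.
move=> /andP[b1 b1'] /andP[b2 b2'] /andP[b3 b3'] /andP[b4 b4'].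
(* [B] dominates all the nearby achievable rates, so [eps = d / B] makes every product [eps * a] at
   most [d]. *)
pose B := r1 + r2 + r3 + e + 1.
have B0 : 0 < B by rewrite /B; lra.
pose eps := d / B.
have eps0 : 0 < eps by rewrite divr_gt0.
have eps1 : eps <= 1 by rewrite /eps ler_pdivrMr // mul1r /B /d; lra.
have eps_le a : a <= B -> eps * a <= d.
  by move=> aB; rewrite /eps mulrAC ler_pdivrMr // ler_pM2l.
have [a1B a2B a3B] : [/\ eps * a1 <= d, eps * a2 <= d & eps * a3 <= d].
  by split; apply: eps_le; rewrite /B; lra.
have [ra1 ra2 ra3] : [/\ r1 - d <= a1, r2 - d <= a2 & r3 - d <= a3] by split; lra.
have cC : c <= C + d by lra.
clear b1 b1' b2 b2' b3 b3' b4 b4' eps_le.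
have := ach eps d eps0 d0.
have : \forall n \near \oo, ln 2 <= n%:R * d.
  near=> n; rewrite -ler_pdivrMr //; near: n; exact: nbhs_infty_ger.
have : \forall n \near \oo, (0 < n)%N by near=> n; near: n; exact: nbhs_infty_gt.
move=> near1 near2 near3.
have [n [n0 [ln2 [nu1 [nu2 [nu2' [nu12 [code [g1 g2 g3 g4]]]]]]]]] :=
  filter_ex (filterI near1 (filterI near2 near3)).
have [U [V [q [q_pmf [k1 k2 k3 k4]]]]] := converse_code n0 code.
exists U, V, q; split=> //.
have n0' : 0 < n%:R :> R by rewrite ltr0n.
have [[nu1_gt0 nu2_gt0 nu2'_gt0 nu12_gt0] _] := code.
have lb a nu : (0 < nu)%N -> expR (n%:R * (a - d)) <= nu%:R ->
    n%:R * (a - d) <= ln nu%:R.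
  by move=> nu0; rewrite -ler_ln ?posrE ?expR_gt0 ?ltr0n // expRK.
have ub : ln nu12%:R <= n%:R * (c + d).
  by rewrite -[X in _ <= X]expRK ler_ln ?posrE ?expR_gt0 ?ltr0n.
have {}k3 : (1 - eps) * ln nu2'%:R <= n%:R * (rate3 W q + (c + d)) + ln 2.
  by rewrite mulrDr; apply: le_trans k3 _; rewrite lerD2r lerD2l.
have bound := rate_lower_bound n0' d0 (ltW eps0) eps1.
have {}k1 := bound _ _ _ _ a1B ra1 (lb _ _ nu1_gt0 g1) ln2 k1.
have {}k2 := bound _ _ _ _ a2B ra2 (lb _ _ nu2_gt0 g2) ln2 k2.
have {}k3 := bound _ _ _ _ a3B ra3 (lb _ _ nu2'_gt0 g3) ln2 k3.
have {}k4 := bound _ _ _ _ a3B ra3 (lb _ _ nu2'_gt0 g3) ln2 k4.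
clear - d0 dE k1 k2 k3 k4 cC; split; lra.
Unshelve. all: by end_near. Qed.

Lemma capacity_sub_single_letter C : capacity_region_at W C `<=` single_letter_region W C.
Proof.
move=> [[r1 r2] r3] cl.
have [r10 r20 r30] := capacity_region_ge0 cl.
have [U [V [q [q_pmf _]]]] := capacity_sub_rates r10 r20 r30 ltr01 cl.
have [[_ x0] _] := pmf_inhabited q_pmf.
apply: single_letter_closed => // e e0; exact: capacity_sub_rates.
Qed.

End ConverseCode.

(** * Random coding *)

Definition mean (R : realType) (I A : finType) (P : I -> A -> R)
    (G : {ffun I -> A} -> R) : R :=
  \sum_(f : {ffun I -> A}) (\prod_i P i (f i)) * G f.

Section Mean.
Variables (R : realType) (I A : finType) (P : I -> A -> R).
Hypothesis P_pmf : forall i, pmf (P i).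
Implicit Types G H : {ffun I -> A} -> R.

Lemma eq_mean G H : G =1 H -> mean P G = mean P H.
Proof. by move=> GH; apply: eq_bigr => f _; rewrite GH. Qed.

Lemma mean_weight_ge0 (f : {ffun I -> A}) : 0 <= \prod_i P i (f i).
Proof. by case: (prod_pmf P_pmf). Qed.

Lemma le_mean_supp G H :
  (forall f : {ffun I -> A}, (forall i, 0 < P i (f i)) -> G f <= H f) -> mean P G
    <= mean P H.
Proof.
move=> GH; apply: ler_sum => f _.
have [/existsP[i Pi]|/existsPn Pi] := boolP [exists i, P i (f i) == 0].
  by rewrite (bigD1 i) //= (eqP Pi) !mul0r.
apply: ler_wpM2l; first exact: mean_weight_ge0.
by apply: GH => i; rewrite lt_neqAle eq_sym Pi (proj1 (P_pmf i)).
Qed.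

Lemma le_mean G H : (forall f, G f <= H f) -> mean P G <= mean P H.
Proof. by move=> GH; apply: le_mean_supp. Qed.

Lemma mean_cst c : mean P (fun=> c) = c.
Proof. by rewrite /mean -big_distrl /= (proj2 (prod_pmf P_pmf)) mul1r. Qed.

Lemma meanD G H : mean P (fun f => G f + H f) = mean P G + mean P H.
Proof. by rewrite -big_split /=; apply: eq_bigr => f _; rewrite mulrDr. Qed.

Lemma meanZ c G : mean P (fun f => c * G f) = c * mean P G.
Proof. by rewrite /mean big_distrr; apply: eq_bigr => f _; rewrite mulrCA. Qed.

Lemma mean_sum (J : finType) (Q : pred J) (G : J -> {ffun I -> A} -> R) :
  mean P (fun f => \sum_(j | Q j) G j f) = \sum_(j | Q j) mean P (G j).
Proof.
rewrite /mean exchange_big; apply: eq_bigr => f _ /=; exact: big_distrr.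
Qed.

Lemma mean_exists_le G c : mean P G <= c -> exists f, G f <= c.
Proof.
move=> Gc; apply: contrapT => /forallNP nG.
have [f0 _] := pmf_inhabited (prod_pmf P_pmf).
have {}nG f : c < G f by rewrite ltNge; apply/negP.
(* Only finitely many [f] exist, so if all values exceeded [c] they would do so by a common positive
   margin. *)
pose d := \big[Num.min/(G f0 - c)]_f (G f - c).
have d0 : 0 < d.
  rewrite /d; elim/big_ind: _ => [|a b a0 b0|f _]; rewrite ?subr_gt0 //.
  by rewrite lt_min a0.
have : c + d <= mean P G.
  rewrite -(mean_cst (c + d)); apply: le_mean => f.
  by rewrite addrC -lerBrDr /d (bigD1 f) //= ge_min lexx.
by rewrite leNgt (le_lt_trans Gc) // ltrDl.
Qed.

Lemma mean_one (i : I) (g : A -> R) :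
  mean P (fun f => g (f i)) = \sum_a P i a * g a.
Proof.
rewrite /mean (partition_big (fun f : {ffun I -> A} => f i) xpredT) //=.
apply: eq_bigr => a _.
rewrite (eq_bigr (fun f : {ffun I -> A} => (\prod_j P j (f j)) * g a)); last first.
  by move=> f /eqP ->.
rewrite -big_distrl /=; congr (_ * _).
have := sum_prod_coordinate P_pmf (i := i) a (g := xpredT) (fun _ _ => erefl).
by rewrite (proj2 (prod_pmf P_pmf)) mul1r.
Qed.

Lemma mean_two (i j : I) (g : A -> A -> R) : i != j ->
  mean P (fun f => g (f i) (f j)) = \sum_a P i a * \sum_b P j b * g a b.
Proof.
move=> ij.
rewrite /mean (partition_big (fun f : {ffun I -> A} => f i) xpredT) //=.
apply: eq_bigr => a _.
rewrite (partition_big (fun f : {ffun I -> A} => f j) xpredT) //= big_distrr /=.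
apply: eq_bigr => b _.
rewrite (eq_bigr (fun f : {ffun I -> A} => (\prod_j P j (f j)) * g a b)); last first.
  by move=> f /andP[/eqP -> /eqP ->].
rewrite -big_distrl /= mulrA; congr (_ * _).
rewrite (sum_prod_coordinate P_pmf (i := j) b (g := fun f => f i == a)).
  congr (_ * _).
  have := sum_prod_coordinate P_pmf (i := i) a (g := xpredT) (fun _ _ => erefl).
  by rewrite (proj2 (prod_pmf P_pmf)) mul1r.
by move=> z f; rewrite /upd ffunE (negbTE ij).
Qed.

Lemma mean_exchange (J B : finType) (Q : J -> B -> R)
    (G : {ffun I -> A} -> {ffun J -> B} -> R) :
  mean P (fun f => mean Q (G f)) = mean Q (fun g => mean P (G^~ g)).
Proof.
rewrite /mean; under eq_bigr => f _ do rewrite big_distrr.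
rewrite exchange_big; apply: eq_bigr => g _ /=; rewrite big_distrr.
by apply: eq_bigr => f _; rewrite mulrCA.
Qed.

End Mean.

Definition ffcomp (I A B : finType) (h : A -> B) (f : {ffun I -> A}) : {ffun I -> B} :=
  [ffun i => h (f i)].

Lemma sum_ffun_pair (R : nmodType) (I A B : finType)
    (G : {ffun I -> A} -> {ffun I -> B} -> R) :
  \sum_f \sum_g G f g = \sum_(h : {ffun I -> A * B}) G (ffcomp fst h) (ffcomp snd h).
Proof.
rewrite pair_big /=.
pose F (h : {ffun I -> A * B}) := (ffcomp fst h, ffcomp snd h).
rewrite (reindex F) //.
exists (fun z : {ffun I -> A} * {ffun I -> B} => [ffun i => (z.1 i, z.2 i)]).
  by move=> h _; apply/ffunP => i; rewrite !ffunE; case: (h i).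
by move=> [f g] _; congr (_, _); apply/ffunP => i; rewrite !ffunE.
Qed.

Section Chain.
Variables (R : realType) (I A B : finType).

(** Drawing a word and then, letter by letter, a second word from it amounts to drawing independent
    pairs. *)
Lemma mean_chain (P : A -> R) (K : A -> B -> R)
    (G : {ffun I -> A} -> {ffun I -> B} -> R) :
  mean (fun=> P) (fun f => mean (fun i => K (f i)) (G f)) =
  mean (fun=> fun z : A * B => P z.1 * K z.1 z.2)
    (fun h => G (ffcomp fst h) (ffcomp snd h)).
Proof.
rewrite /mean; under eq_bigr => f _ do rewrite big_distrr.
rewrite sum_ffun_pair; apply: eq_bigr => h _ /=.
rewrite mulrA -big_split /=; congr (_ * _).
by apply: eq_bigr => i _; rewrite !ffunE.
Qed.

Lemma mean_ffcomp (p : A -> R) (h : A -> B) (G : {ffun I -> B} -> R) :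
  mean (fun=> p) (fun f => G (ffcomp h f)) = mean (fun=> law p h) G.
Proof.
rewrite /mean (partition_big (ffcomp h) xpredT) //=; apply: eq_bigr => g _.
rewrite (eq_bigr (fun f : {ffun I -> A} => (\prod_i p (f i)) * G g)); last first.
  by move=> f /eqP ->.
rewrite -big_distrl /=; congr (_ * _).
rewrite -(sum_prod_coordinatewise (fun=> p) (fun i z => h z == g i)).
apply: eq_bigl => f; apply/eqP/forallP => [<- i|e]; first by rewrite ffunE.
by apply/ffunP => i; rewrite ffunE; apply/eqP.
Qed.

End Chain.

Section Chebyshev.
Variables (R : realType) (T : finType) (p : T -> R) (n : nat).
Hypothesis p_pmf : pmf p.

(** Cross terms vanish by independence and centering. *)
Lemma mean_sqr_sum (g : T -> R) : \sum_t p t * g t = 0 ->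
  mean (fun _ : 'I_n => p) (fun f => (\sum_i g (f i)) ^+ 2) =
  n%:R * \sum_t p t * g t ^+ 2.
Proof.
move=> g0.
have P_pmf (i : 'I_n) : pmf p by [].
transitivity (\sum_i \sum_j mean (fun _ : 'I_n => p) (fun f => g (f i) * g (f j))).
  rewrite (eq_mean _ (H := fun f => \sum_i \sum_j g (f i) * g (f j))).
    rewrite (mean_sum _ xpredT (fun i f => \sum_j g (f i) * g (f j))).
    by apply: eq_bigr => i _; exact: (mean_sum _ xpredT (fun j f => g (f i) * g (f j))).
  by move=> f; rewrite expr2 big_distrl; apply: eq_bigr => i _; rewrite big_distrr.
rewrite (eq_bigr (fun=> \sum_t p t * g t ^+ 2)).
  by rewrite sumr_const card_ord mulr_natl.
move=> i _; rewrite (bigD1 i) //= big1 ?addr0.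
  exact: (mean_one P_pmf i (fun a => g a * g a)).
move=> j ji; rewrite (mean_two P_pmf (fun a b => g a * g b)) 1?eq_sym //.
rewrite big1 // => a _.
under eq_bigr => b _ do rewrite mulrCA.
by rewrite -big_distrr /= g0 !mulr0.
Qed.

Lemma chebyshev (g : T -> R) (d : R) : (0 < n)%N -> 0 < d ->
  mean (fun _ : 'I_n => p)
    (fun f => (\sum_i g (f i) < n%:R * (\sum_t p t * g t - d))%R%:R) <=
  (\sum_t p t * (g t - \sum_t p t * g t) ^+ 2) / d ^+ 2 / n%:R.
Proof.
move=> n0 d0; set mu := \sum_t p t * g t.
have n0' : 0 < n%:R :> R by rewrite ltr0n.
pose h t := g t - mu.
have h0 : \sum_t p t * h t = 0.
  under eq_bigr => t _ do rewrite mulrBr.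
  by rewrite sumrB -big_distrl /=; case: p_pmf => _ ->; rewrite mul1r subrr.
apply: (@le_trans _ _ (mean (fun _ : 'I_n => p)
    (fun f => ((n%:R * d) ^+ 2)^-1 * (\sum_i h (f i)) ^+ 2))); last first.
  rewrite meanZ mean_sqr_sum // le_eqVlt; apply/orP; left; apply/eqP.
  by field; rewrite !gt_eqF.
apply: le_mean => // f.
case: ltP => [lt|_]; last by rewrite mulr_ge0 ?invr_ge0 ?sqr_ge0.
rewrite mulrC ler_pdivlMr ?exprn_gt0 ?mulr_gt0 // mul1r.
have e : \sum_i h (f i) = \sum_i g (f i) - n%:R * mu.
  by rewrite sumrB sumr_const card_ord mulr_natl.
rewrite -[X in _ <= X]sqrrN ler_sqr ?nnegrE; last 2 first.
- by rewrite mulr_ge0 // ltW.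
- have : 0 < n%:R * d by rewrite mulr_gt0.
  rewrite e; lra.
rewrite e; lra.
Qed.

End Chebyshev.

(** * Threshold test on the information density *)

Section Threshold.
Variables (R : realType) (T A B Y : finType) (p : T -> R) (n : nat).
Hypothesis p_pmf : pmf p.
Variables (a : T -> A) (b : T -> B) (y : T -> Y).

(* The conditional information density of [b] and [y] given [a] exceeds [thr],
   with all denominators cleared. *)
Definition threshold_test (thr : R) (fa : {ffun 'I_n -> A}) (fb : {ffun 'I_n -> B})
    (fy : {ffun 'I_n -> Y}) : bool :=
  expR thr * \prod_i (law p (fun t => (a t, b t)) (fa i, fb i)
                      * law p (fun t => (a t, y t)) (fa i, fy i))
  <= \prod_i (law p (fun t => (a t, b t, y t)) (fa i, fb i, fy i) * law p a (fa i)).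

Definition info_density (t : T) : R :=
  ln (law p (fun t => (a t, b t, y t)) (a t, b t, y t) * law p a (a t)
      / (law p (fun t => (a t, b t)) (a t, b t) * law p (fun t => (a t, y t)) (a t, y t))).

Lemma mean_info_density :
  \sum_t p t * info_density t = cond_mutual_info p b y a.
Proof.
rewrite cond_mutual_info_ent //.
rewrite (@eq_ent _ _ p _ _ (fun t => (b t, a t)) (fun t => (a t, b t))); last first.
  by move=> t t'; rewrite !xpair_eqE andbC.
rewrite (@eq_ent _ _ p _ _ (fun t => (y t, a t)) (fun t => (a t, y t))); last first.
  by move=> t t'; rewrite !xpair_eqE andbC.
rewrite (@eq_ent _ _ p _ _ (fun t => (b t, y t, a t))
  (fun t => (a t, b t, y t))); last first.
  by move=> t t'; rewrite !xpair_eqE; do ![case: (_ == _)].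
transitivity (\sum_t p t * (ln (law p (fun t => (a t, b t, y t)) (a t, b t, y t))
    + ln (law p a (a t)) - ln (law p (fun t => (a t, b t)) (a t, b t))
    - ln (law p (fun t => (a t, y t)) (a t, y t)))).
  apply: eq_expect => // t pt.
  have l1 := law_gt0 p_pmf (fun t => (a t, b t, y t)) pt.
  have l2 := law_gt0 p_pmf a pt.
  have l3 := law_gt0 p_pmf (fun t => (a t, b t)) pt.
  have l4 := law_gt0 p_pmf (fun t => (a t, y t)) pt.
  by rewrite /info_density ln_div ?lnM ?posrE ?mulr_gt0 //; ring.
under eq_bigr => t _ do rewrite !mulrBr mulrDr.
rewrite !sumrB big_split /ent /=; lra.
Qed.

Lemma threshold_correct (d : R) : (0 < n)%N -> 0 < d ->
  mean (fun _ : 'I_n => p) (fun f =>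
    (~~ threshold_test (n%:R * (cond_mutual_info p b y a - d))
       (ffcomp a f) (ffcomp b f) (ffcomp y f))%:R) <=
  (\sum_t p t * (info_density t - cond_mutual_info p b y a) ^+ 2) / d ^+ 2 / n%:R.
Proof.
move=> n0 d0; rewrite -mean_info_density.
apply: le_trans (chebyshev p_pmf info_density n0 d0); apply: le_mean_supp => // f f_gt0.
case: (boolP (threshold_test _ _ _ _)) => //= nt.
rewrite (_ : (_ < _) = true) //; move: nt.
rewrite /threshold_test -ltNge.
under eq_bigr => i _ do rewrite !ffunE.
under [X in _ < _ * X -> _]eq_bigr => i _ do rewrite !ffunE.
set thr := n%:R * _.
have l1 i := law_gt0 p_pmf (fun t => (a t, b t, y t)) (f_gt0 i).
have l2 i := law_gt0 p_pmf a (f_gt0 i).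
have l3 i := law_gt0 p_pmf (fun t => (a t, b t)) (f_gt0 i).
have l4 i := law_gt0 p_pmf (fun t => (a t, y t)) (f_gt0 i).
set N := \prod_i _; set Dn := \prod_i _ => lt.
have N0 : 0 < N by apply: prodr_gt0 => i _; rewrite mulr_gt0.
have D0 : 0 < Dn by apply: prodr_gt0 => i _; rewrite mulr_gt0.
rewrite -ltr_expR; apply/idP.
suff -> : expR (\sum_i info_density (f i)) = N / Dn by rewrite ltr_pdivrMr.
rewrite expR_sum /N /Dn -prodfV -big_split /=; apply: eq_bigr => i _.
by rewrite /info_density lnK // posrE divr_gt0 ?mulr_gt0.
Qed.

(** Change of measure: the word [fb] is drawn from [K] without regard to [y]. On the words that pass
    the test, this weight is at most [expR (- thr)] times the true joint law of [(a, y, b)], which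
    sums to 1. *)
Lemma threshold_wrong (thr : R) (K : A -> B -> R) : transition K ->
  (forall u v, law p (fun t => (a t, b t)) (u, v) = law p a u * K u v) ->
  mean (fun _ : 'I_n => p) (fun f => mean (fun i => K (a (f i)))
    (fun fb => (threshold_test thr (ffcomp a f) fb (ffcomp y f))%:R)) <=
  expR (- thr).
Proof.
move=> K_tr KE.
pose ay t := (a t, y t).
pose F (g : {ffun 'I_n -> A * Y}) fb : R :=
  (threshold_test thr (ffcomp fst g) fb (ffcomp snd g))%:R.
rewrite (eq_mean _ (H := fun f => mean
  (fun i => K (ffcomp ay f i).1) (F (ffcomp ay f)))); last first.
  move=> f; rewrite /F (_ : ffcomp fst (ffcomp ay f) = ffcomp a f); last first.
    by apply/ffunP => i; rewrite !ffunE.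
  rewrite (_ : ffcomp snd (ffcomp ay f) = ffcomp y f); last first.
    by apply/ffunP => i; rewrite !ffunE.
  by apply: eq_bigr => fb _; congr (_ * _); apply: eq_bigr => i _; rewrite ffunE.
rewrite (mean_ffcomp p ay (fun g => mean (fun i => K (g i).1) (F g))).
rewrite (mean_chain _ (fun z => K z.1) F).
pose aby t := (a t, y t, b t).
apply: (@le_trans _ _ (\sum_(h : {ffun 'I_n -> A * Y * B}) expR (- thr) *
    \prod_i law p aby (h i))); last first.
  by rewrite -big_distrr /= (proj2 (prod_pmf (fun=> law_pmf p_pmf aby))) mulr1.
apply: ler_sum => h _.
have law0 i : 0 <= law p aby (h i) by exact: law_ge0.
rewrite /F; have [test|_] := boolP (threshold_test _ _ _ _); last first.
  by rewrite mulr0 mulr_ge0 ?expR_ge0 // prodr_ge0.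
rewrite mulr1 expRN mulrC ler_pdivlMr ?expR_gt0 // mulrC.
(* If the law of [a] vanishes at some coordinate, so does the weight on the left. Otherwise
   multiplying by the positive product of these laws turns the goal into the test itself. *)
have [/existsP[i ai]|/existsPn ai] := boolP [exists i, law p a (h i).1.1 == 0].
  rewrite [X in X <= _](_ : _ = 0); first exact: prodr_ge0.
  rewrite (bigD1 i) //= (_ : law p ay (h i).1 = 0) ?mul0r ?mulr0 //.
  apply/eqP; rewrite eq_le law_ge0 // andbT -(eqP ai).
  by rewrite (law_fst p a y (h i).1.1) (bigD1 (h i).1.2) //= -surjective_pairing
    lerDl sumr_ge0 // => ? _; exact: law_ge0.
have a0 i : 0 < law p a (h i).1.1 by rewrite lt_neqAle eq_sym ai law_ge0.
have Pa0 : 0 < \prod_i law p a (h i).1.1 by apply: prodr_gt0.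
rewrite -(ler_pM2r Pa0) -mulrA -!big_split /=.
move: test; rewrite /threshold_test; congr (_ * _ <= _).
  by apply: eq_bigr => i _; rewrite !ffunE KE -surjective_pairing /ay; ring.
apply: eq_bigr => i _; rewrite !ffunE; congr (_ * _); apply: eq_law => t.
by case: (h i) => [[u z] v]; rewrite !xpair_eqE /=; do ![case: (_ == _)].
Qed.

End Threshold.

Lemma eq_mean_kernel (R : realType) (I A : finType) (P Q : I -> A -> R)
    (G : {ffun I -> A} -> R) : (forall i, P i = Q i) -> mean P G = mean Q G.
Proof.
by move=> PQ; apply: eq_bigr => f _; congr (_ * _); apply: eq_bigr => i _; rewrite PQ.
Qed.

(** * Superposition codebook *)

Section RandomCode.
Variables (R : realType) (U V X Y1 Y2 : finType) (W : X -> Y1 * Y2 -> R).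
Hypothesis W_tr : transition W.
Variables (PU : U -> R) (KV : U -> V -> R) (KX : U * V -> X -> R).
Hypotheses (PU_pmf : pmf PU) (KV_tr : transition KV) (KX_tr : transition KX).
Variables (N1 N2 N3 : finType) (n : nat).
Let M := (N1 * N2 * N3)%type.
Let Un := {ffun 'I_n -> U}.
Let Vn := {ffun 'I_n -> V}.
Let Xn := {ffun 'I_n -> X}.
Let Yn := {ffun 'I_n -> Y1 * Y2}.

(** The law of a single chain of codewords and its channel output, to which all averages over
    codebooks are reduced. *)
Definition nested (psi : Un -> Vn -> Xn -> Yn -> R) : R :=
  mean (fun=> PU) (fun fu => mean (fun i => KV (fu i)) (fun fv =>
  mean (fun i => KX (fu i, fv i)) (fun fx => mean (fun i => W (fx i)) (psi fu fv fx)))).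

Definition letters (t : U * V * X * (Y1 * Y2)) : R :=
  PU t.1.1.1 * KV t.1.1.1 t.1.1.2 * KX t.1.1 t.1.2 * W t.1.2 t.2.

Let ru (t : U * V * X * (Y1 * Y2)) := t.1.1.1.
Let rv (t : U * V * X * (Y1 * Y2)) := t.1.1.2.
Let rx (t : U * V * X * (Y1 * Y2)) := t.1.2.

Lemma nestedE psi : nested psi = mean (fun=> letters) (fun f =>
  psi (ffcomp ru f) (ffcomp rv f) (ffcomp rx f) (ffcomp snd f)).
Proof.
rewrite /nested (mean_chain PU KV (fun fu fv => mean (fun i => KX (fu i, fv i))
  (fun fx => mean (fun i => W (fx i)) (psi fu fv fx)))).
transitivity (mean (fun=> fun z : U * V => PU z.1 * KV z.1 z.2) (fun h
  : {ffun 'I_n -> U * V} =>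
   mean (fun i => KX (h i)) (fun fx => mean (fun i => W (fx i))
     (psi (ffcomp fst h) (ffcomp snd h) fx)))).
  by apply: eq_mean => h; apply: eq_mean_kernel => i; rewrite !ffunE -surjective_pairing.
rewrite mean_chain.
transitivity (mean (fun=> fun z : U * V * X => PU z.1.1 * KV z.1.1 z.1.2 * KX z.1 z.2)
   (fun h : {ffun 'I_n -> U * V * X} => mean (fun i => W (h i).2)
     (psi (ffcomp fst (ffcomp fst h)) (ffcomp snd (ffcomp fst h)) (ffcomp snd h)))).
  by apply: eq_mean => h; apply: eq_mean_kernel => i; rewrite ffunE.
rewrite (mean_chain _ (fun z : U * V * X => W z.2)).
apply: eq_mean => h.
by congr psi; apply/ffunP => i; rewrite !ffunE.
Qed.

Let PUs (_ : N2) (fu : Un) : R := \prod_i PU (fu i).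
Let KVs (cu : {ffun N2 -> Un}) (j : N2 * N3) (fv : Vn) : R := \prod_i KV (cu j.1 i) (fv i).
Let KXs (cu : {ffun N2 -> Un}) (cv : {ffun N2 * N3 -> Vn}) (m : M) (fx : Xn) : R :=
  \prod_i KX (cu m.1.2 i, cv (m.1.2, m.2) i) (fx i).

Let PUs_pmf m2 : pmf (PUs m2). Proof. exact: (prod_pmf (fun i : 'I_n => PU_pmf)). Qed.
Let KVs_pmf cu j : pmf (KVs cu j). Proof. exact: (prod_pmf
  (fun i => KV_tr (cu j.1 i))). Qed.
Let KXs_pmf cu cv m : pmf (KXs cu cv m).
Proof. exact: (prod_pmf (fun i => KX_tr (cu m.1.2 i, cv (m.1.2, m.2) i))). Qed.

(** The three layers are drawn in turn because the words of each layer have a law that depends on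
    the words above them. *)
Definition codebook_mean
    (G : {ffun N2 -> Un} -> {ffun N2 * N3 -> Vn} -> {ffun M -> Xn} -> R) : R :=
  mean PUs (fun cu => mean (KVs cu) (fun cv => mean (KXs cu cv) (G cu cv))).

Lemma codebook_exists_le G c : codebook_mean G <= c ->
  exists cu cv cx, G cu cv cx <= c.
Proof.
move=> /(mean_exists_le PUs_pmf)[cu] /(mean_exists_le (KVs_pmf cu))[cv].
by move=> /(mean_exists_le (KXs_pmf cu cv))[cx]; exists cu, cv, cx.
Qed.

Lemma codebook_sum (J : finType) (Q : pred J) G :
  codebook_mean (fun cu cv cx => \sum_(j | Q j) G j cu cv cx) =
  \sum_(j | Q j) codebook_mean (G j).
Proof.
rewrite /codebook_mean -mean_sum; apply: eq_mean => cu.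
by rewrite -mean_sum; apply: eq_mean => cv; rewrite -mean_sum.
Qed.

Lemma codebookZ c G :
  codebook_mean (fun cu cv cx => c * G cu cv cx) = c * codebook_mean G.
Proof.
rewrite /codebook_mean -meanZ; apply: eq_mean => cu.
by rewrite -meanZ; apply: eq_mean => cv; rewrite -meanZ.
Qed.

Section Message.
Variable m : M.

Definition sent_mean
    (phi : {ffun N2 -> Un} -> {ffun N2 * N3 -> Vn} -> {ffun M -> Xn} -> Yn -> R) : R :=
  codebook_mean (fun cu cv cx => mean (fun i => W (cx m i)) (phi cu cv cx)).

Lemma le_sent_mean phi phi' :
  (forall cu cv cx y, phi cu cv cx y <= phi' cu cv cx y) ->
  sent_mean phi <= sent_mean phi'.
Proof. by move=> le; do 4 (apply: le_mean => // ?). Qed.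

Lemma sent_meanD phi phi' :
  sent_mean (fun cu cv cx y => phi cu cv cx y + phi' cu cv cx y) =
  sent_mean phi + sent_mean phi'.
Proof.
rewrite /sent_mean /codebook_mean -meanD; apply: eq_mean => cu.
rewrite -meanD; apply: eq_mean => cv; rewrite -meanD; apply: eq_mean => cx.
exact: meanD.
Qed.

Lemma sent_mean_sum (J : finType) (Q : pred J) phi :
  sent_mean (fun cu cv cx y => \sum_(j | Q j) phi j cu cv cx y) =
  \sum_(j | Q j) sent_mean (phi j).
Proof.
rewrite /sent_mean -codebook_sum; do 3 (apply: eq_mean => ?).
exact: mean_sum.
Qed.

Lemma sent_correct psi :
  sent_mean (fun cu cv cx => psi (cu m.1.2) (cv (m.1.2, m.2)) (cx m)) = nested psi.
Proof.
transitivity (mean PUs (fun cu => mean (KVs cu) (fun cv =>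
    mean (fun i => KX (cu m.1.2 i, cv (m.1.2, m.2) i)) (fun fx =>
      mean (fun i => W (fx i)) (psi (cu m.1.2) (cv (m.1.2, m.2)) fx))))).
  apply: eq_mean => cu; apply: eq_mean => cv.
  exact: (mean_one (KXs_pmf cu cv) m (fun fx => mean (fun i => W (fx i)) _)).
transitivity (mean PUs (fun cu => mean (fun i => KV (cu m.1.2 i)) (fun fv =>
    mean (fun i => KX (cu m.1.2 i, fv i)) (fun fx =>
      mean (fun i => W (fx i)) (psi (cu m.1.2) fv fx))))).
  apply: eq_mean => cu.
  exact: (mean_one (KVs_pmf cu) (m.1.2, m.2) (fun fv =>
    mean (fun i => KX (cu m.1.2 i, fv i)) (fun fx =>
      mean (fun i => W (fx i)) (psi (cu m.1.2) fv fx)))).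
exact: (mean_one PUs_pmf m.1.2 (fun fu => mean (fun i => KV (fu i)) (fun fv =>
    mean (fun i => KX (fu i, fv i)) (fun fx =>
      mean (fun i => W (fx i)) (psi fu fv fx))))).
Qed.

(** The word u of another m2 is independent of everything that produced the output. *)
Lemma sent_wrong2 (m2 : N2) (psi : Un -> Yn -> R) : m2 != m.1.2 ->
  sent_mean (fun cu cv cx y => psi (cu m2) y) =
  nested (fun fu fv fx y => mean (fun=> PU) (psi^~ y)).
Proof.
move=> m2m.
transitivity (mean PUs (fun cu => mean (KVs cu) (fun cv =>
    mean (fun i => KX (cu m.1.2 i, cv (m.1.2, m.2) i)) (fun fx =>
      mean (fun i => W (fx i)) (psi (cu m2)))))).
  apply: eq_mean => cu; apply: eq_mean => cv.
  exact: (mean_one (KXs_pmf cu cv) m (fun fx => mean (fun i => W (fx i)) _)).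
transitivity (mean PUs (fun cu => mean (fun i => KV (cu m.1.2 i)) (fun fv =>
    mean (fun i => KX (cu m.1.2 i, fv i)) (fun fx =>
      mean (fun i => W (fx i)) (psi (cu m2)))))).
  apply: eq_mean => cu.
  exact: (mean_one (KVs_pmf cu) (m.1.2, m.2) (fun fv =>
    mean (fun i => KX (cu m.1.2 i, fv i)) (fun fx =>
      mean (fun i => W (fx i)) (psi (cu m2))))).
transitivity (mean (fun=> PU) (fun fu' => nested (fun _ _ _ => psi fu'))).
  exact: (mean_two PUs_pmf (fun fu' fu => mean (fun i => KV (fu i)) (fun fv =>
    mean (fun i => KX (fu i, fv i)) (fun fx =>
      mean (fun i => W (fx i)) (psi fu'))))).
rewrite /nested mean_exchange; apply: eq_mean => fu.
rewrite mean_exchange; apply: eq_mean => fv.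
rewrite mean_exchange; apply: eq_mean => fx.
by rewrite mean_exchange.
Qed.

(** Under the correct m2, a wrong v shares u with the sent word; it is independent of the output
    only conditionally on u, whence the kernel [KV (fu i)]. *)
Lemma sent_wrong3 (m3 : N3) (psi : Un -> Vn -> Yn -> R) : m3 != m.2 ->
  sent_mean (fun cu cv cx y => psi (cu m.1.2) (cv (m.1.2, m3)) y) =
  nested (fun fu fv fx y => mean (fun i => KV (fu i)) (fun fv' => psi fu fv' y)).
Proof.
move=> m3m.
transitivity (mean PUs (fun cu => mean (KVs cu) (fun cv =>
    mean (fun i => KX (cu m.1.2 i, cv (m.1.2, m.2) i)) (fun fx =>
      mean (fun i => W (fx i)) (psi (cu m.1.2) (cv (m.1.2, m3))))))).
  apply: eq_mean => cu; apply: eq_mean => cv.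
  exact: (mean_one (KXs_pmf cu cv) m (fun fx => mean (fun i => W (fx i)) _)).
pose F (fu : Un) := mean (fun i => KV (fu i)) (fun fv' =>
   mean (fun i => KV (fu i)) (fun fv => mean (fun i => KX (fu i, fv i)) (fun fx =>
      mean (fun i => W (fx i)) (psi fu fv')))).
transitivity (mean PUs (fun cu => F (cu m.1.2))).
  apply: eq_mean => cu.
  apply: (mean_two (KVs_pmf cu) (i := (m.1.2, m3)) (j := (m.1.2, m.2)) (fun fv' fv =>
    mean (fun i => KX (cu m.1.2 i, fv i)) (fun fx =>
      mean (fun i => W (fx i)) (psi (cu m.1.2) fv')))).
  by rewrite xpair_eqE eqxx.
transitivity (mean (fun=> PU) F); first exact: (mean_one PUs_pmf m.1.2 F).
apply: eq_mean => fu; rewrite /F mean_exchange; apply: eq_mean => fv.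
rewrite mean_exchange; apply: eq_mean => fx.
by rewrite mean_exchange.
Qed.

(** Here the wrong x shares both u and v with the sent word. *)
Lemma sent_wrong1 (m1 : N1) (psi : Un -> Vn -> Xn -> Yn -> R) : m1 != m.1.1 ->
  sent_mean (fun cu cv cx y => psi (cu m.1.2) (cv (m.1.2, m.2)) (cx (m1, m.1.2, m.2)) y) =
  nested (fun fu fv fx y => mean (fun i => KX (fu i, fv i)) (fun fx' => psi fu fv fx' y)).
Proof.
move=> m1m.
pose F (fu : Un) (fv : Vn) := mean (fun i => KX (fu i, fv i)) (fun fx' =>
   mean (fun i => KX (fu i, fv i)) (fun fx => mean (fun i => W (fx i)) (psi fu fv fx'))).
transitivity (mean PUs (fun cu => mean (KVs cu)
  (fun cv => F (cu m.1.2) (cv (m.1.2, m.2))))).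
  apply: eq_mean => cu; apply: eq_mean => cv.
  apply: (mean_two (KXs_pmf cu cv) (i := (m1, m.1.2, m.2)) (j := m) (fun fx' fx =>
      mean (fun i => W (fx i)) (psi (cu m.1.2) (cv (m.1.2, m.2)) fx'))).
  by apply: contraNneq m1m => <-.
transitivity (mean PUs (fun cu => mean (fun i => KV (cu m.1.2 i)) (F (cu m.1.2)))).
  apply: eq_mean => cu.
  exact: (mean_one (KVs_pmf cu) (m.1.2, m.2) (F (cu m.1.2))).
transitivity (mean (fun=> PU) (fun fu => mean (fun i => KV (fu i)) (F fu))).
  exact: (mean_one PUs_pmf m.1.2 (fun fu => mean (fun i => KV (fu i)) (F fu))).
apply: eq_mean => fu; apply: eq_mean => fv; rewrite /F mean_exchange; apply: eq_mean => fx.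
by rewrite mean_exchange.
Qed.

End Message.

End RandomCode.

Lemma ffcomp_comp (I A B C : finType) (g : B -> C) (h : A -> B) (f : {ffun I -> A}) :
  ffcomp g (ffcomp h f) = ffcomp (fun a => g (h a)) f.
Proof. by apply/ffunP => i; rewrite !ffunE. Qed.

Lemma natrb_exists_le (R : realType) (J : finType) (Q : pred J) (b : J -> bool) :
  [exists j, Q j && b j]%:R <= \sum_(j | Q j) (b j)%:R :> R.
Proof.
case: existsP => [[j /andP[Qj bj]]|_]; last exact: sumr_ge0.
by rewrite (bigD1 j) //= bj lerDl sumr_ge0.
Qed.

Lemma natrb_or_le (R : realType) (b c : bool) : (b || c)%:R <= b%:R + c%:R :> R.
Proof. by case: b; case: c => /=; rewrite ?lerDl ?addr0 ?add0r. Qed.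

(** * Error events and the union bound *)

Section RandomDecoding.
Variables (R : realType) (U V X Y1 Y2 : finType) (W : X -> Y1 * Y2 -> R).
Hypothesis W_tr : transition W.
Variables (PU : U -> R) (KV : U -> V -> R) (KX : U * V -> X -> R).
Hypotheses (PU_pmf : pmf PU) (KV_tr : transition KV) (KX_tr : transition KX).

Let p := letters W PU KV KX.
Let T := (U * V * X * (Y1 * Y2))%type.
Let ru (t : T) := t.1.1.1.
Let rv (t : T) := t.1.1.2.
Let rx (t : T) := t.1.2.
Let ry1 (t : T) := t.2.1.
Let ry2 (t : T) := t.2.2.
Let r0 (t : T) := tt.
Let ruv (t : T) := (ru t, rv t).

Let UV := compose PU KV.
Let UVX := compose UV KX.
Let UVX_pmf : pmf UVX. Proof. exact: (compose_pmf (compose_pmf PU_pmf KV_tr) KX_tr). Qed.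
Let KW (z : U * V * X) := W z.2.
Let KW_tr : transition KW. Proof. by move=> z; exact: W_tr. Qed.
Let pE : p = compose UVX KW. Proof. by []. Qed.

Lemma letters_pmf : pmf p.
Proof. exact: (compose_pmf UVX_pmf KW_tr). Qed.

Let law_ru u : law p ru u = PU u.
Proof.
rewrite pE (law_compose UVX KW_tr (fun z => z.1.1)) (law_compose UV KX_tr fst).
by rewrite (law_compose PU KV_tr id) law_id.
Qed.

Let law_ruv z : law p ruv z = PU z.1 * KV z.1 z.2.
Proof.
rewrite (_ : ruv = fun t => id t.1.1); last by apply/funext => -[[[]]].
by rewrite pE (law_compose UVX KW_tr (fun z => id z.1)) (law_compose UV KX_tr id) law_id.
Qed.

Let law_ruvx z : law p (fun t => (ruv t, rx t)) z = law p ruv z.1 * KX z.1 z.2.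
Proof.
rewrite law_ruv (_ : (fun t => _) = fun t => id t.1); last by apply/funext => -[[[]]].
by rewrite pE (law_compose UVX KW_tr id) law_id.
Qed.

Variables (N1 N2 N3 N12 : finType) (bin : N3 -> N12) (k n : nat).
Let M := (N1 * N2 * N3)%type.
Hypotheses (M0 : (0 < #|{: M}|)%N) (n0 : (0 < n)%N).
Hypothesis bin_card : forall b, (#|[set m | bin m == b]%SET| <= k)%N.
Variable d : R.
Hypothesis d0 : 0 < d.

Let Un := {ffun 'I_n -> U}.
Let Vn := {ffun 'I_n -> V}.
Let Xn := {ffun 'I_n -> X}.

Definition rate_threshold (A B Y : finType) (a : T -> A) (b : T -> B) (y : T -> Y) : R :=
  n%:R * (cond_mutual_info p b y a - d).

Let test (A B Y : finType) (a : T -> A) (b : T -> B) (y : T -> Y) :=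
  @threshold_test R T A B Y p n a b y (rate_threshold a b y).

Let tt_n : {ffun 'I_n -> unit} := [ffun=> tt].
Let zip_n (fu : Un) (fv : Vn) : {ffun 'I_n -> U * V} := [ffun i => (fu i, fv i)].

(** Five tests, one per layer and decoder: u against Y1 and Y2, v given u against Y1 and Y2, x given
    (u, v) against Y1. The constant variable [r0] makes the conditional test unconditional for u. *)
Let tA (fu : Un) fy := test r0 ru ry1 tt_n fu fy.
Let tB (fu : Un) fy := test r0 ru ry2 tt_n fu fy.
Let tC (fu : Un) (fv : Vn) fy := test ru rv ry1 fu fv fy.
Let tD (fu : Un) (fv : Vn) fy := test ru rv ry2 fu fv fy.
Let tE (fu : Un) (fv : Vn) (fx : Xn) fy := test ruv rx ry1 (zip_n fu fv) fx fy.

Section Decoders.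
Variables (cu : {ffun N2 -> Un}) (cv : {ffun N2 * N3 -> Vn}) (cx : {ffun M -> Xn}).
Variable m0 : M.

Let pass1 (m : M) fy := [&& tA (cu m.1.2) fy, tC (cu m.1.2) (cv (m.1.2, m.2)) fy
  & tE (cu m.1.2) (cv (m.1.2, m.2)) (cx m) fy].

Definition decode (fy : {ffun 'I_n -> Y1}) : M := odflt m0 [pick m | pass1 m fy].
Definition decode2 (fy : {ffun 'I_n -> Y2}) : N2 := odflt m0.1.2 [pick m2 | tB (cu m2) fy].
Definition decode3 (z : {ffun 'I_n -> Y2} * N12) : N3 :=
  odflt m0.2 [pick m3 | (bin m3 == z.2) && tD (cu (decode2 z.1)) (cv (decode2 z.1, m3)) z.1].

(** Wrong codewords are excluded one layer at a time: a wrong m2 by the test on u alone, then a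
    wrong m2' under the correct u, then a wrong m1 under the correct u and v. So no event mixes
    several wrong layers. Decoder 2 only competes with messages in the bin of the sent m2'. *)
Definition bad_event (m : M) (y : {ffun 'I_n -> Y1 * Y2}) : bool :=
  [|| ~~ tA (cu m.1.2) (ffcomp fst y), ~~ tB (cu m.1.2) (ffcomp snd y),
      ~~ tC (cu m.1.2) (cv (m.1.2, m.2)) (ffcomp fst y),
      ~~ tD (cu m.1.2) (cv (m.1.2, m.2)) (ffcomp snd y),
      ~~ tE (cu m.1.2) (cv (m.1.2, m.2)) (cx m) (ffcomp fst y),
      [exists m2, (m2 != m.1.2) && tA (cu m2) (ffcomp fst y)],
      [exists m2, (m2 != m.1.2) && tB (cu m2) (ffcomp snd y)],
      [exists m3, (m3 != m.2) && tC (cu m.1.2) (cv (m.1.2, m3)) (ffcomp fst y)],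
      [exists m3, ((m3 != m.2) && (bin m3 == bin m.2))
         && tD (cu m.1.2) (cv (m.1.2, m3)) (ffcomp snd y)] |
      [exists m1, (m1 != m.1.1)
         && tE (cu m.1.2) (cv (m.1.2, m.2)) (cx (m1, m.1.2, m.2)) (ffcomp fst y)]].

Lemma decoding_error_bad t :
  decoding_error (fun fy => (decode fy).1.1) decode2 decode3
    (fun fy => bin (decode fy).2) t ->
  bad_event t.1 t.2.
Proof.
case: t => m y; apply: contraTT; rewrite /bad_event !negb_or.
case/and5P => /negPn hA /negPn hB /negPn hC /negPn hD.
case/and5P => /negPn hE /existsPn wA /existsPn wB /existsPn wC.
case/andP => /existsPn wD /existsPn wE.
rewrite /decoding_error -[out1 _]/(ffcomp fst y) -[out2 _]/(ffcomp snd y) /=.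
have dec2E : decode2 (ffcomp snd y) = m.1.2.
  rewrite /decode2; case: pickP => [m2 /= h2|/(_ m.1.2)]; last by rewrite hB.
  by apply/eqP; have := wB m2; rewrite h2 andbT negbK.
have decE : decode (ffcomp fst y) = m.
  rewrite /decode; case: pickP => [m' /= /and3P[h1 h2 h3]|/(_ m)]; last first.
    by rewrite /pass1 hA hC hE.
  have e2 : m'.1.2 = m.1.2.
    by apply/eqP; have := wA m'.1.2; rewrite h1 andbT negbK.
  have e3 : m'.2 = m.2.
    by apply/eqP; have := wC m'.2; rewrite -e2 h2 andbT negbK.
  have e1 : m'.1.1 = m.1.1.
    by apply/eqP; have := wE m'.1.1; rewrite -e2 -e3 -!surjective_pairing h3 andbT negbK.
  by rewrite [m']surjective_pairing [m'.1]surjective_pairing e1 e2 e3 -!surjective_pairing.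
rewrite decE dec2E !eqxx /= negbK.
rewrite /decode3 /= dec2E; case: pickP => [m3 /= /andP[b3 h3]|/(_ m.2)]; last first.
  by rewrite hD eqxx.
by have := wD m3; rewrite h3 b3 !andbT negbK.
Qed.

End Decoders.

Let var (A B Y : finType) (a : T -> A) (b : T -> B) (y : T -> Y) : R :=
  \sum_t p t * (info_density p a b y t - cond_mutual_info p b y a) ^+ 2.

Definition total_variance : R :=
  var r0 ru ry1 + var r0 ru ry2 + var ru rv ry1 + var ru rv ry2 + var ruv rx ry1.

Definition error_bound : R :=
  total_variance / d ^+ 2 / n%:R
  + (#|N2|.-1)%:R * (expR (- rate_threshold r0 ru ry1) + expR (- rate_threshold r0 ru ry2))
  + (#|N3|.-1)%:R * expR (- rate_threshold ru rv ry1)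
  + (k.-1)%:R * expR (- rate_threshold ru rv ry2)
  + (#|N1|.-1)%:R * expR (- rate_threshold ruv rx ry1).

Let nest := @nested R U V X Y1 Y2 W PU KV KX n.

Let letterE psi : nest psi = mean (fun=> p) (fun f =>
  psi (ffcomp ru f) (ffcomp rv f) (ffcomp rx f) (ffcomp snd f)).
Proof. exact: nestedE. Qed.

Let compfst (f : {ffun 'I_n -> T}) : ffcomp fst (ffcomp snd f) = ffcomp ry1 f.
Proof. exact: ffcomp_comp. Qed.
Let compsnd (f : {ffun 'I_n -> T}) : ffcomp snd (ffcomp snd f) = ffcomp ry2 f.
Proof. exact: ffcomp_comp. Qed.
Let comptt (f : {ffun 'I_n -> T}) : tt_n = ffcomp r0 f.
Proof. by apply/ffunP => i; rewrite !ffunE. Qed.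
Let compzip (f : {ffun 'I_n -> T}) : zip_n (ffcomp ru f) (ffcomp rv f) = ffcomp ruv f.
Proof. by apply/ffunP => i; rewrite !ffunE. Qed.

Let correct (A B Y : finType) (a : T -> A) (b : T -> B) (y : T -> Y) :
  mean (fun=> p) (fun f => (~~ test a b y (ffcomp a f) (ffcomp b f) (ffcomp y f))%:R)
  <= var a b y / d ^+ 2 / n%:R.
Proof. exact: (threshold_correct letters_pmf). Qed.

Let wrong (A B Y : finType) (a : T -> A) (b : T -> B) (y : T -> Y) (K : A -> B -> R) :
  transition K ->
  (forall u v, law p (fun t => (a t, b t)) (u, v) = law p a u * K u v) ->
  mean (fun=> p) (fun f => mean (fun i => K (a (f i)))
    (fun fb => (test a b y (ffcomp a f) fb (ffcomp y f))%:R)) <=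
  expR (- rate_threshold a b y).
Proof.
move=> K_tr KE.
exact: (@threshold_wrong R T A B Y p n letters_pmf a b y (rate_threshold a b y) K K_tr KE).
Qed.

Let correctA : nest (fun fu _ _ y => (~~ tA fu (ffcomp fst y))%:R)
  <= var r0 ru ry1 / d ^+ 2 / n%:R.
Proof.
rewrite letterE; apply: le_trans (correct r0 ru ry1); rewrite le_eqVlt; apply/orP; left.
by apply/eqP/eq_mean => f; rewrite /tA compfst (comptt f).
Qed.

Let correctB : nest (fun fu _ _ y => (~~ tB fu (ffcomp snd y))%:R)
  <= var r0 ru ry2 / d ^+ 2 / n%:R.
Proof.
rewrite letterE; apply: le_trans (correct r0 ru ry2); rewrite le_eqVlt; apply/orP; left.
by apply/eqP/eq_mean => f; rewrite /tB compsnd (comptt f).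
Qed.

Let correctC : nest (fun fu fv _ y => (~~ tC fu fv (ffcomp fst y))%:R)
  <= var ru rv ry1 / d ^+ 2 / n%:R.
Proof.
rewrite letterE; apply: le_trans (correct ru rv ry1); rewrite le_eqVlt; apply/orP; left.
by apply/eqP/eq_mean => f; rewrite /tC compfst.
Qed.

Let correctD : nest (fun fu fv _ y => (~~ tD fu fv (ffcomp snd y))%:R)
  <= var ru rv ry2 / d ^+ 2 / n%:R.
Proof.
rewrite letterE; apply: le_trans (correct ru rv ry2); rewrite le_eqVlt; apply/orP; left.
by apply/eqP/eq_mean => f; rewrite /tD compsnd.
Qed.

Let correctE : nest (fun fu fv fx y => (~~ tE fu fv fx (ffcomp fst y))%:R)
  <= var ruv rx ry1 / d ^+ 2 / n%:R.
Proof.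
rewrite letterE; apply: le_trans (correct ruv rx ry1); rewrite le_eqVlt; apply/orP; left.
by apply/eqP/eq_mean => f; rewrite /tE compfst compzip.
Qed.

Let law_r0u (z : unit) u : law p (fun t => (r0 t, ru t)) (z, u) = law p r0 z * PU u.
Proof.
case: z; rewrite -law_ru (_ : law p r0 tt = 1) ?mul1r.
  by apply: eq_law => t; rewrite xpair_eqE.
have [_ <-] := letters_pmf; exact: eq_bigl.
Qed.

Let wrongA : nest (fun _ _ _ y => mean (fun=> PU) (fun fu => (tA fu (ffcomp fst y))%:R)) <=
  expR (- rate_threshold r0 ru ry1).
Proof.
rewrite letterE.
apply: le_trans (wrong ry1 (K := fun=> PU) (fun=> PU_pmf) law_r0u).
rewrite le_eqVlt; apply/orP; left.
by apply/eqP/eq_mean => f; apply: eq_mean => fu; rewrite /tA compfst (comptt f).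
Qed.

Let wrongB : nest (fun _ _ _ y => mean (fun=> PU) (fun fu => (tB fu (ffcomp snd y))%:R)) <=
  expR (- rate_threshold r0 ru ry2).
Proof.
rewrite letterE.
apply: le_trans (wrong ry2 (K := fun=> PU) (fun=> PU_pmf) law_r0u).
rewrite le_eqVlt; apply/orP; left.
by apply/eqP/eq_mean => f; apply: eq_mean => fu; rewrite /tB compsnd (comptt f).
Qed.

Let law_uv u v : law p (fun t => (ru t, rv t)) (u, v) = law p ru u * KV u v.
Proof. by rewrite law_ru -(law_ruv (u, v)). Qed.

Let wrongC : nest (fun fu _ _ y => mean (fun i => KV (fu i))
  (fun fv => (tC fu fv (ffcomp fst y))%:R)) <=
  expR (- rate_threshold ru rv ry1).
Proof.
rewrite letterE.
apply: le_trans (wrong ry1 KV_tr law_uv).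
rewrite le_eqVlt; apply/orP; left.
apply/eqP/eq_mean => f; rewrite compfst.
by apply: eq_mean_kernel => i; rewrite ffunE.
Qed.

Let wrongD : nest (fun fu _ _ y => mean (fun i => KV (fu i))
  (fun fv => (tD fu fv (ffcomp snd y))%:R)) <=
  expR (- rate_threshold ru rv ry2).
Proof.
rewrite letterE.
apply: le_trans (wrong ry2 KV_tr law_uv).
rewrite le_eqVlt; apply/orP; left.
apply/eqP/eq_mean => f; rewrite compsnd.
by apply: eq_mean_kernel => i; rewrite ffunE.
Qed.

Let law_uvx z x : law p (fun t => (ruv t, rx t)) (z, x) = law p ruv z * KX z x.
Proof. exact: law_ruvx. Qed.

Let wrongE : nest (fun fu fv _ y => mean (fun i => KX (fu i, fv i))
  (fun fx => (tE fu fv fx (ffcomp fst y))%:R)) <=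
  expR (- rate_threshold ruv rx ry1).
Proof.
rewrite letterE.
apply: le_trans (wrong ry1 KX_tr law_uvx).
rewrite le_eqVlt; apply/orP; left.
apply/eqP/eq_mean => f; rewrite compfst.
rewrite (eq_mean _ (H := fun fx => (test ruv rx ry1 (ffcomp ruv f) fx (ffcomp ry1 f))%:R)).
  by apply: eq_mean_kernel => i; rewrite !ffunE.
by move=> fx; rewrite /tE compzip.
Qed.

Let sent := @sent_mean R U V X Y1 Y2 W PU KV KX N1 N2 N3 n.

Let sumC (J : finType) (j0 : J) (F : J -> R) c :
  (forall j, j != j0 -> F j <= c) -> \sum_(j | j != j0) F j <= (#|J|.-1)%:R * c.
Proof.
move=> Fc; apply: (@le_trans _ _ (\sum_(j | j != j0) c)); first exact: ler_sum.
by rewrite sumr_const cardC1 mulr_natl.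
Qed.

Lemma sent_bad (m : M) :
  sent m (fun cu cv cx y => (bad_event cu cv cx m y)%:R) <= error_bound.
Proof.
pose A1 (cu : {ffun N2 -> Un}) (cv : {ffun N2 * N3 -> Vn}) (cx : {ffun M -> Xn})
  (y : {ffun 'I_n -> Y1 * Y2}) : R := (~~ tA (cu m.1.2) (ffcomp fst y))%:R.
pose A2 (cu : {ffun N2 -> Un}) (cv : {ffun N2 * N3 -> Vn}) (cx : {ffun M -> Xn})
  (y : {ffun 'I_n -> Y1 * Y2}) : R := (~~ tB (cu m.1.2) (ffcomp snd y))%:R.
pose A3 (cu : {ffun N2 -> Un}) (cv : {ffun N2 * N3 -> Vn}) (cx : {ffun M -> Xn})
  (y : {ffun 'I_n -> Y1 * Y2}) : R :=
  (~~ tC (cu m.1.2) (cv (m.1.2, m.2)) (ffcomp fst y))%:R.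
pose A4 (cu : {ffun N2 -> Un}) (cv : {ffun N2 * N3 -> Vn}) (cx : {ffun M -> Xn})
  (y : {ffun 'I_n -> Y1 * Y2}) : R :=
  (~~ tD (cu m.1.2) (cv (m.1.2, m.2)) (ffcomp snd y))%:R.
pose A5 (cu : {ffun N2 -> Un}) (cv : {ffun N2 * N3 -> Vn}) (cx : {ffun M -> Xn})
  (y : {ffun 'I_n -> Y1 * Y2}) : R :=
  (~~ tE (cu m.1.2) (cv (m.1.2, m.2)) (cx m) (ffcomp fst y))%:R.
pose B1 m2 (cu : {ffun N2 -> Un}) (cv : {ffun N2 * N3 -> Vn}) (cx : {ffun M -> Xn})
  (y : {ffun 'I_n -> Y1 * Y2}) : R := (tA (cu m2) (ffcomp fst y))%:R.
pose B2 m2 (cu : {ffun N2 -> Un}) (cv : {ffun N2 * N3 -> Vn}) (cx : {ffun M -> Xn})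
  (y : {ffun 'I_n -> Y1 * Y2}) : R := (tB (cu m2) (ffcomp snd y))%:R.
pose B3 m3 (cu : {ffun N2 -> Un}) (cv : {ffun N2 * N3 -> Vn}) (cx : {ffun M -> Xn})
  (y : {ffun 'I_n -> Y1 * Y2}) : R :=
  (tC (cu m.1.2) (cv (m.1.2, m3)) (ffcomp fst y))%:R.
pose B4 m3 (cu : {ffun N2 -> Un}) (cv : {ffun N2 * N3 -> Vn}) (cx : {ffun M -> Xn})
  (y : {ffun 'I_n -> Y1 * Y2}) : R :=
  (tD (cu m.1.2) (cv (m.1.2, m3)) (ffcomp snd y))%:R.
pose B5 m1 (cu : {ffun N2 -> Un}) (cv : {ffun N2 * N3 -> Vn}) (cx : {ffun M -> Xn})
  (y : {ffun 'I_n -> Y1 * Y2}) : R :=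
  (tE (cu m.1.2) (cv (m.1.2, m.2)) (cx (m1, m.1.2, m.2)) (ffcomp fst y))%:R.
apply: (@le_trans _ _ (sent m (fun cu cv cx y =>
  A1 cu cv cx y + (A2 cu cv cx y + (A3 cu cv cx y + (A4 cu cv cx y + (A5 cu cv cx y
  + ((\sum_(m2 | m2 != m.1.2) B1 m2 cu cv cx y) + ((\sum_(m2 | m2 != m.1.2) B2 m2 cu cv cx y)
  + ((\sum_(m3 | m3 != m.2) B3 m3 cu cv cx y)
  + ((\sum_(m3 | (m3 != m.2) && (bin m3 == bin m.2)) B4 m3 cu cv cx y)
  + \sum_(m1 | m1 != m.1.1) B5 m1 cu cv cx y))))))))))).
  apply: le_sent_mean => // cu cv cx y; rewrite /bad_event.
  do 5 (apply: le_trans (natrb_or_le _ _ _) _; apply: lerD => //).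
  do 4 (apply: le_trans (natrb_or_le _ _ _) _; apply: lerD; first exact: natrb_exists_le).
  exact: natrb_exists_le.
rewrite /sent !sent_meanD !sent_mean_sum -/sent.
have e1 : sent m A1 <= var r0 ru ry1 / d ^+ 2 / n%:R.
  apply: le_trans correctA; rewrite /sent /nest -(sent_correct W PU_pmf KV_tr KX_tr m) //.
have e2 : sent m A2 <= var r0 ru ry2 / d ^+ 2 / n%:R.
  apply: le_trans correctB; rewrite /sent /nest -(sent_correct W PU_pmf KV_tr KX_tr m) //.
have e3 : sent m A3 <= var ru rv ry1 / d ^+ 2 / n%:R.
  apply: le_trans correctC; rewrite /sent /nest -(sent_correct W PU_pmf KV_tr KX_tr m) //.
have e4 : sent m A4 <= var ru rv ry2 / d ^+ 2 / n%:R.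
  apply: le_trans correctD; rewrite /sent /nest -(sent_correct W PU_pmf KV_tr KX_tr m) //.
have e5 : sent m A5 <= var ruv rx ry1 / d ^+ 2 / n%:R.
  apply: le_trans correctE; rewrite /sent /nest -(sent_correct W PU_pmf KV_tr KX_tr m) //.
have f1 : \sum_(m2 | m2 != m.1.2) sent m (B1 m2) <=
    (#|N2|.-1)%:R * expR (- rate_threshold r0 ru ry1).
  apply: sumC => m2 m2m; apply: le_trans wrongA.
  by rewrite /sent /nest -(sent_wrong2 W PU_pmf KV_tr KX_tr
    (fun fu y => (tA fu (ffcomp fst y))%:R) m2m).
have f2 : \sum_(m2 | m2 != m.1.2) sent m (B2 m2) <=
    (#|N2|.-1)%:R * expR (- rate_threshold r0 ru ry2).
  apply: sumC => m2 m2m; apply: le_trans wrongB.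
  by rewrite /sent /nest -(sent_wrong2 W PU_pmf KV_tr KX_tr
    (fun fu y => (tB fu (ffcomp snd y))%:R) m2m).
have f3 : \sum_(m3 | m3 != m.2) sent m (B3 m3) <=
    (#|N3|.-1)%:R * expR (- rate_threshold ru rv ry1).
  apply: sumC => m3 m3m; apply: le_trans wrongC.
  by rewrite /sent /nest -(sent_wrong3 W PU_pmf KV_tr KX_tr
    (fun fu fv y => (tC fu fv (ffcomp fst y))%:R) m3m).
have f4 : \sum_(m3 | (m3 != m.2) && (bin m3 == bin m.2)) sent m (B4 m3) <=
    (k.-1)%:R * expR (- rate_threshold ru rv ry2).
  apply: (@le_trans _ _ (\sum_(m3 | (m3 != m.2) && (bin m3 == bin m.2))
      expR (- rate_threshold ru rv ry2))).
    apply: ler_sum => m3 /andP[m3m _]; apply: le_trans wrongD.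
    by rewrite /sent /nest -(sent_wrong3 W PU_pmf KV_tr KX_tr
      (fun fu fv y => (tD fu fv (ffcomp snd y))%:R) m3m).
  rewrite sumr_const -[X in X <= _]mulr_natl ler_wpM2r ?expR_ge0 // ler_nat.
  (* The sent message belongs to its own bin, so at most [k.-1] competitors remain there. *)
  have := bin_card (bin m.2); rewrite (cardsD1 m.2) inE eqxx add1n => /(leq_trans _) h.
  rewrite -ltnS; apply: leq_trans (leqSpred _).
  apply: h; rewrite ltnS; apply: eq_leq.
  by apply: eq_card => j; rewrite [LHS]unfold_in !inE.
have f5 : \sum_(m1 | m1 != m.1.1) sent m (B5 m1) <=
    (#|N1|.-1)%:R * expR (- rate_threshold ruv rx ry1).
  apply: sumC => m1 m1m; apply: le_trans wrongE.
  by rewrite /sent /nest -(sent_wrong1 W PU_pmf KV_tr KX_tr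
    (fun fu fv fx y => (tE fu fv fx (ffcomp fst y))%:R) m1m).
rewrite /error_bound /total_variance !mulrDl mulrDr; lra.
Qed.

(** The average over messages is taken inside the codebook mean, so one codebook below the mean
    controls the average error. *)
Theorem random_code : exists (x : M -> 'I_n -> X)
    (d1 : {ffun 'I_n -> Y1} -> N1) (d2 : {ffun 'I_n -> Y2} -> N2)
    (d3 : {ffun 'I_n -> Y2} * N12 -> N3) (conf : {ffun 'I_n -> Y1} -> N12),
  \sum_(t | decoding_error d1 d2 d3 conf t) code_law W x t <= error_bound.
Proof.
have /card_gt0P[m0 _] := M0.
have : codebook_mean PU KV KX (fun cu cv cx => \sum_(m : M) #|{: M}|%:R^-1 *
    mean (fun i => W (cx m i)) (fun y => (bad_event cu cv cx m y)%:R)) <= error_bound.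
  rewrite codebook_sum.
  under eq_bigr => m _ do rewrite codebookZ.
  rewrite -big_distrr /= ler_pdivrMl ?ltr0n //.
  rewrite mulr_natl -sumr_const; apply: ler_sum => m _; exact: sent_bad.
move=> /(codebook_exists_le PU_pmf KV_tr KX_tr)[cu [cv [cx le]]].
exists (fun m i => cx m i), (fun fy => (decode cu cv cx m0 fy).1.1), (decode2 cu m0),
  (decode3 cu cv m0), (fun fy => bin (decode cu cv cx m0 fy).2).
apply: le_trans le; rewrite big_mkcond sum_pair; apply: ler_sum => m _.
rewrite /mean big_distrr; apply: ler_sum => y _ /=.
have w0 : 0 <= \prod_i W (cx m i) (y i) by apply: prodr_ge0 => i _; exact: transition_ge0.
case: ifP => [/decoding_error_bad -> |_]; first by rewrite mulr1.
by rewrite !mulr_ge0 ?invr_ge0.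
Qed.

End RandomDecoding.

(** * Achievability *)

Section Degraded.
Variables (R : realType) (X Y1 Y2 : finType) (W : X -> Y1 * Y2 -> R).
Variable D : Y1 -> Y2 -> R.
Hypothesis WD : forall x y, W x y = marg1 W x y.1 * D y.1 y.2.
Variables (T : finType) (p : T -> R).
Hypothesis p_pmf : pmf p.
Variables (A : finType) (f : T -> A) (x : T -> X) (y : T -> Y1 * Y2).
Hypothesis ch : channel_law p W f x y.

Lemma law_degraded a y1 y2 : law p (fun t => (f t, y t)) (a, (y1, y2)) =
  law p (fun t => (f t, (y t).1)) (a, y1) * D y1 y2.
Proof.
rewrite (law_snd p x) [X in _ = X * _](law_snd p x) big_distrl.
apply: eq_bigr => x0 _ /=.
rewrite (@eq_law _ _ p _ _ _ (fun t => (f t, x t, y t)) _ (a, x0, (y1, y2))); last first.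
  by move=> t; rewrite !xpair_eqE; do ![case: (_ == _)].
rewrite (@eq_law _ _ p _ _ (fun t => (x t, _))
  (fun t => (f t, x t, (y t).1)) _ (a, x0, y1)); last first.
  by move=> t; rewrite !xpair_eqE; do ![case: (_ == _)].
by rewrite ch (channel_law_marg1 ch) WD mulrA.
Qed.

End Degraded.

(** Data processing along f - Y1 - Y2: by [law_degraded] the kernel [D] is the same with and without
    [f], which gives the Markov relation. *)
Lemma mutual_info_degraded (R : realType) (X Y1 Y2 : finType) (W : X -> Y1 * Y2 -> R)
    (D : Y1 -> Y2 -> R) (T A : finType) (p : T -> R) (f : T -> A) (x : T -> X)
    (y : T -> Y1 * Y2) :
  (forall x y, W x y = marg1 W x y.1 * D y.1 y.2) -> pmf p -> channel_law p W f x y ->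
  mutual_info p f (fun t => (y t).2) <= mutual_info p f (fun t => (y t).1).
Proof.
move=> WD p_pmf ch; rewrite !mutual_info_ent //.
pose z1 t := (y t).1; pose z2 t := (y t).2.
have ch0 := channel_law_comp (fun=> tt) ch.
have := @cond_ent_markov _ _ _ p_pmf _ _ _ f z2 z1.
move=> mk; have {mk} : ent p (fun t => (f t, (z2 t, z1 t))) - ent p
  (fun t => (z2 t, z1 t)) =
    ent p (fun t => (f t, z1 t)) - ent p z1.
  apply: mk => t.
  rewrite (@eq_law _ _ p _ _ _
    (fun t => (f t, y t)) _ (f t, ((y t).1, (y t).2))); last first.
    by move=> t'; rewrite /z1 /z2 -surjective_pairing !xpair_eqE; case: (y t') (y t) => [? ?] [? ?];
      rewrite /= xpair_eqE; do ![case: (_ == _)].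
  rewrite (law_degraded WD ch).
  rewrite [X in _ = _ * X](@eq_law _ _ p _ _ _
    (fun t => (tt, y t)) _ (tt, ((y t).1, (y t).2))); last first.
    by move=> t'; rewrite /z1 /z2 -surjective_pairing !xpair_eqE; case: (y t') (y t) => [? ?] [? ?];
      rewrite /= xpair_eqE; do ![case: (_ == _)].
  rewrite (law_degraded WD ch0).
  rewrite [X in _ = _ * (X * _)](@eq_law _ _ p _ _ _ z1 _ (z1 t)); last first.
    by move=> t'; rewrite !xpair_eqE.
  by rewrite -/(z1 t); ring.
have := cond_ent_reduce p_pmf f z1 z2.
rewrite (@eq_ent _ _ p _ _ (fun t => (f t, (z1 t, z2 t)))
  (fun t => (f t, (z2 t, z1 t)))); last first.
  by move=> t t'; rewrite !xpair_eqE; do ![case: (_ == _)].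
rewrite (@eq_ent _ _ p _ _ (fun t => (z1 t, z2 t)) (fun t => (z2 t, z1 t))); last first.
  by move=> t t'; rewrite !xpair_eqE; do ![case: (_ == _)].
rewrite -/z1 -/z2; lra.
Qed.

Lemma cond_mutual_info_unit (R : realType) (T A B : finType) (p : T -> R)
    (f : T -> A) (g : T -> B) : pmf p ->
  cond_mutual_info p f g (fun=> tt) = mutual_info p f g.
Proof.
move=> p_pmf; rewrite cond_mutual_info_ent // mutual_info_ent // ent_unit // subr0.
by rewrite !ent_pair_unit.
Qed.

Lemma cond_mutual_info_ge0 (R : realType) (T A B C : finType) (p : T -> R)
    (f : T -> A) (g : T -> B) (h : T -> C) : pmf p -> 0 <= cond_mutual_info p f g h.
Proof.
move=> p_pmf; rewrite cond_mutual_info_ent //.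
have := cond_ent_reduce p_pmf f g h.
rewrite (@eq_ent _ _ p _ _ (fun t => (f t, (g t, h t)))
  (fun t => (f t, g t, h t))); last first.
  by move=> t t'; rewrite !xpair_eqE; do ![case: (_ == _)].
lra.
Qed.

Section CodeOfFfun.
Variables (R : realType) (X Y1 Y2 : finType) (W : X -> Y1 * Y2 -> R).
Hypothesis W_tr : transition W.

Lemma avg_error_le (n nu1 nu2 nu2' nu12 : nat) (c : code X Y1 Y2 n nu1 nu2 nu2' nu12) :
  avg_error c W <= avg_error' c W.
Proof.
rewrite ler_wpM2l ?invr_ge0 //; do 3 (apply: ler_sum => ? _).
rewrite big_mkcond [X in _ <= X]big_mkcond; apply: ler_sum => y _.
have W0 m : 0 <= block_channel W (enc c m) y by apply: prodr_ge0 => i _; exact: transition_ge0.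
by rewrite /error_set' finset.in_setU; case: (y \in error_set _ _ _) => //=; case: ifP.
Qed.

Lemma code_exists_ffun (n nu1 nu2 nu3 nu12 : nat) (eps : R)
    (x : 'I_nu1 * 'I_nu2 * 'I_nu3 -> 'I_n -> X)
    (d1 : {ffun 'I_n -> Y1} -> 'I_nu1) (d2 : {ffun 'I_n -> Y2} -> 'I_nu2)
    (d3 : {ffun 'I_n -> Y2} * 'I_nu12 -> 'I_nu3) (conf : {ffun 'I_n -> Y1} -> 'I_nu12) :
  (0 < nu1)%N -> (0 < nu2)%N -> (0 < nu3)%N -> (0 < nu12)%N ->
  \sum_(t | decoding_error d1 d2 d3 conf t) code_law W x t <= eps ->
  code_exists W n nu1 nu2 nu3 nu12 eps.
Proof.
move=> h1 h2 h3 h12 err; split=> //.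
pose unt (Y : finType) (y : n.-tuple Y) : {ffun 'I_n -> Y} := [ffun i => tnth y i].
have untK (Y : finType) (f : {ffun 'I_n -> Y}) : unt Y [tuple f i | i < n] = f.
  by apply/ffunP => i; rewrite ffunE tnth_mktuple.
pose c := @Code X Y1 Y2 n nu1 nu2 nu3 nu12 (fun m => [tuple x m i | i < n])
  (fun y => conf (unt _ y)) (fun y => d1 (unt _ y)) (fun y => d2 (unt _ y))
  (fun z => d3 (unt _ z.1, z.2)).
exists c; suff ce : avg_error' c W
  <= eps by split=> //; apply: le_trans ce; exact: avg_error_le.
rewrite -error_code_law; apply: le_trans err; rewrite le_eqVlt; apply/orP; left; apply/eqP.
apply: eq_big => [t|t _]; first by rewrite /decoding_error /= !untK.
by congr (_ * _); apply: eq_bigr => i _; rewrite tnth_mktuple.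
Qed.

End CodeOfFfun.

(** For negative [s] the choice is [nu = 1], so no competitor is left. *)
Lemma expR_ceil (R : realType) (s : R) :
  exists nu : nat, [/\ (0 < nu)%N, expR s <= nu%:R & (nu.-1)%:R <= expR s].
Proof.
exists (Num.truncn (expR s)).+1.
have := @truncn_itv R (expR s) (expR_ge0 s).
by move=> /andP[h1 h2]; split=> //; exact: ltW.
Qed.

Section Sizes.
Variables (R : realType) (N : R).
Hypothesis N0 : 0 < N.

(** The excess of 1 from rounding is absorbed by a factor 2, and [expR (N * g) >= 2] since
    [N * g >= 1]. *)
Lemma link_size (nu : nat) (c C g : R) : 0 <= C -> c <= C -> 0 < g -> g^-1 <= N ->
  (nu.-1)%:R <= expR (N * (c - g / 2)) -> (0 < nu)%N -> nu%:R <= expR (N * (C + g)).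
Proof.
move=> C0 cC g0 gN nu_le nu0.
have nuS : nu%:R = (nu.-1)%:R + 1 :> R by rewrite natr1 prednK.
have e1 : expR (N * (c - g / 2)) <= expR (N * C) by rewrite ler_expR ler_pM2l //; lra.
have e2 : 1 <= expR (N * C) by rewrite -expR0 ler_expR mulr_ge0 // ltW.
have e3 : 2 <= expR (N * g).
  have gNg : 1 <= N * g by rewrite -[X in X <= _](@mulVf _ g) ?gt_eqF // ler_wpM2r // ltW.
  by apply: le_trans (expR_ge1Dx _); clear - gNg; lra.
have e4 : expR (N * C) * 2 <= expR (N * C) * expR (N * g) by rewrite ler_wpM2l ?expR_ge0.
by rewrite mulrDr expRD nuS; clear - nu_le e1 e2 e4; lra.
Qed.

(** The factor 3 counts the terms of nu k - 1 = (nu - 1)(k - 1) + (nu - 1) + (k - 1), each at most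
    the exponential. *)
Lemma message_size (nu k : nat) (a b g : R) : 0 <= a -> 0 <= b -> 0 <= g ->
  (0 < nu)%N -> (0 < k)%N ->
  (nu.-1)%:R <= expR (N * (a - g)) -> (k.-1)%:R <= expR (N * (b - g)) ->
  ((nu * k).-1)%:R <= 3 * expR (N * (a + b - g)).
Proof.
move=> a0 b0 g0 nu0 k0 nu_le k_le.
have -> : ((nu * k).-1)%:R = (nu.-1)%:R * (k.-1)%:R + (nu.-1)%:R + (k.-1)%:R :> R.
  rewrite -natrM -!natrD; congr (_%:R).
  rewrite -{1}(prednK nu0) -{1}(prednK k0) mulSn mulnS /=.
  by rewrite addnC (addnC nu.-1).
pose E := expR (N * (a + b - g)).
have leE s : s <= a + b - g -> expR (N * s) <= E by move=> sr; rewrite ler_expR ler_pM2l.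
have b1 : (nu.-1)%:R <= E by apply: le_trans nu_le (leE _ _); lra.
have b2 : (k.-1)%:R <= E by apply: le_trans k_le (leE _ _); lra.
have b3 : (nu.-1)%:R * (k.-1)%:R <= E.
  apply: le_trans (ler_pM _ _ nu_le k_le) _ => //.
  by rewrite -expRD -mulrDr; apply: leE; lra.
by rewrite -/E; clear - b1 b2 b3; lra.
Qed.

Lemma union_bound_term (I s d a : R) : a <= expR (N * s) -> s + 2 * d <= I ->
  a * expR (- (N * (I - d))) <= expR (- (N * d)).
Proof.
move=> ae sI; apply: le_trans (ler_wpM2r (expR_ge0 _) ae) _.
have NsI : N * (s + 2 * d) <= N * I by rewrite ler_pM2l.
by rewrite -expRD ler_expR; clear - NsI; lra.
Qed.

Lemma expRN_le (d : R) : 0 < d -> expR (- (N * d)) <= d^-1 / N.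
Proof.
move=> d0; rewrite expRN -invfM lef_pV2 ?posrE ?expR_gt0 ?mulr_gt0 //.
by apply: le_trans (expR_ge1Dx _); rewrite mulrC lerDr.
Qed.

End Sizes.

Section Achievability.
Variables (R : realType) (X Y1 Y2 : finType) (W : X -> Y1 * Y2 -> R).
Hypotheses (W_tr : transition W) (W_degr : physically_degraded W).

Lemma single_letter_achievable C r1 r2 r3 : 0 <= C ->
  single_letter_region W C (r1, r2, r3) -> achievable W (r1, r2, r3, C).
Proof.
move=> C0 [[r10 r20 r30]] [U [V [PUV [PX [[_ _ PUV_pmf PX_tr]]]]]] /=.
set p := joint W PUV PX => -[h1 h2]; rewrite le_min => /andP[h3 h4].
split=> // eps gamma eps0 gamma0.
have [[u0 v0] _] := pmf_inhabited PUV_pmf.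
have [x0 _] := pmf_inhabited (PX_tr (u0, v0)).
have X0 : (0 < #|X|)%N by apply/card_gt0P; exists x0.
have [D WD] := degraded_kernel X0 W_degr.
have [KV [KV_tr KVE]] := disintegration v0 PUV_pmf.
pose PU u := \sum_v PUV (u, v).
have PU_pmf : pmf PU.
  case: PUV_pmf => P0 P1; split=> [u|]; first exact: sumr_ge0.
  by rewrite -sum_pair.
have pE : p = letters W PU KV PX.
  by apply/funext => -[[[u v] x] y]; rewrite /p /letters /= KVE.
have p_pmf : pmf p by rewrite pE; exact: letters_pmf.
have ch : channel_law p W (fun t => t.1.1.1) (fun t => t.1.2) snd.
  rewrite /p joint_with_output.
  exact: (channel_law_comp fst (channel_law_with_output _ W_tr)).
have IA : r2 <= cond_mutual_info p (fun t => t.1.1.1) (fun t => t.2.1) (fun=> tt).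
  rewrite cond_mutual_info_unit //; apply: le_trans h2 _.
  exact: (mutual_info_degraded WD p_pmf ch).
have IB : r2 <= cond_mutual_info p (fun t => t.1.1.1) (fun t => t.2.2) (fun=> tt).
  by rewrite cond_mutual_info_unit.
have ID0 := @cond_mutual_info_ge0 R _ _ _ _ p (fun t => t.1.1.2) (fun t => t.2.2)
  (fun t => t.1.1.1) p_pmf.
(* [union_bound_term] needs [2 * d] of slack between message rate and information; the smallest
   slack available is [gamma / 2], for the bins. *)
pose d := gamma / 4.
have d0 : 0 < d by rewrite divr_gt0.
(* The link rate actually used: more bins than messages m2' would be pointless, and [r3 - C'] stays
   nonnegative. If [r3 <= C], the rate inside a bin is 0 and is covered by the nonnegativity of I(V;
   Y2 | U). *)
pose C' := Num.min C r3.
have C'0 : 0 <= C' by rewrite le_min C0.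
have C'C : C' <= C by rewrite ge_min lexx.
have C'r : C' <= r3 by rewrite ge_min lexx orbT.
have Dr : r3 - C' <= cond_mutual_info p (fun t => t.1.1.2) (fun t => t.2.2)
  (fun t => t.1.1.1).
  rewrite /C'; case: (leP C r3) => _; last by rewrite subrr.
  by rewrite lerBlDr.
(* The 7 counts the exponential terms: two for m2 (one per decoder), three for m2' at Decoder 1
   because of [message_size], one inside the bin and one for m1. *)
pose K := total_variance W PU KV PX / d ^+ 2 + 7 / d.
have : \forall n \near \oo, K / eps <= n%:R by exact: nbhs_infty_ger.
have : \forall n \near \oo, gamma^-1 <= n%:R :> R by exact: nbhs_infty_ger.
have : \forall n \near \oo, (0 < n)%N by exact: nbhs_infty_gt.
move=> near1 near2 near3; apply: filterS (filterI near1 (filterI near2 near3)).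
move=> n [n0 [ng nK]].
have n0' : 0 < n%:R :> R by rewrite ltr0n.
have [nu1 [nu1_0 nu1_ge nu1_le]] := expR_ceil (n%:R * (r1 - gamma)).
have [nu2 [nu2_0 nu2_ge nu2_le]] := expR_ceil (n%:R * (r2 - gamma)).
have [nu12 [nu12_0 nu12_ge nu12_le]] := expR_ceil (n%:R * (C' - gamma / 2)).
have [k [k_0 k_ge k_le]] := expR_ceil (n%:R * (r3 - C' - gamma / 2)).
(* A message m2' encodes a pair (bin, position in the bin), so the bins have size [k] by
   construction. The tolerance [gamma] is split equally between the two factors. *)
pose nu3 := #|{: 'I_nu12 * 'I_k}|.
have nu3E : nu3 = (nu12 * k)%N by rewrite /nu3 card_prod !card_ord.
have nu3_0 : (0 < nu3)%N by rewrite nu3E muln_gt0 nu12_0.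
have dE2 : gamma / 2 = 2 * d by rewrite /d; field.
have dE4 : gamma = 4 * d by rewrite /d; field.
exists nu1, nu2, nu3, nu12; split; last first.
  split=> //; last exact: (link_size n0' C0 C'C gamma0 ng nu12_le nu12_0).
  rewrite nu3E natrM; apply: le_trans (ler_pM _ _ nu12_ge k_ge); rewrite ?expR_ge0 //.
  by rewrite -expRD -mulrDr ler_expR ler_pM2l //; lra.
pose bin (m : 'I_nu3) : 'I_nu12 := (enum_val m).1.
have bin_card b : (#|[set m | bin m == b]%SET| <= k)%N.
  rewrite -[k in (_ <= k)%N]card_ord.
  rewrite -(card_imset _ (f := fun j : 'I_k => enum_rank (b, j))); last first.
    by move=> j j' /enum_rank_inj [].
  apply/subset_leq_card/fintype.subsetP => m; rewrite inE => /eqP mb.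
  apply/imsetP; exists (enum_val m).2 => //.
  by rewrite -mb /bin -surjective_pairing enum_valK.
have M0 : (0 < #|{: 'I_nu1 * 'I_nu2 * 'I_nu3}|)%N.
  by rewrite !card_prod !card_ord !muln_gt0 nu1_0 nu2_0.
have [x [d1 [d2 [d3 [conf err]]]]] :=
  random_code W_tr PU_pmf KV_tr PX_tr M0 n0 bin_card d0.
apply: (@code_exists_ffun _ _ _ _ _ W_tr n nu1 nu2 nu3 nu12 eps x d1 d2 d3 conf) => //.
apply: le_trans err _.
have nu3_le : (nu3.-1)%:R <= 3 * expR (n%:R * (C' + (r3 - C') - gamma / 2)).
  rewrite nu3E; apply: message_size => //; last by rewrite divr_ge0 // ltW.
  by rewrite subr_ge0.
pose e := expR (- (n%:R * d)).
have tC : 3^-1 * (nu3.-1)%:R * expR (- (n%:R * (cond_mutual_info p (fun t => t.1.1.2)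
    (fun t => t.2.1) (fun t => t.1.1.1) - d))) <= e.
  apply: (union_bound_term n0' (s := C' + (r3 - C') - gamma / 2)).
    by rewrite ler_pdivrMl.
  by rewrite dE2; clear - h4; lra.
have term2 (I : R) : r2 <= I -> (nu2.-1)%:R * expR (- (n%:R * (I - d))) <= e.
  by move=> rI; apply: (union_bound_term n0' nu2_le); rewrite dE4; clear - rI d0; lra.
have tA := term2 _ IA; have tB := term2 _ IB.
have tD := union_bound_term n0' k_le
  (_ : _ <= cond_mutual_info p (fun t => t.1.1.2) (fun t => t.2.2) (fun t => t.1.1.1)).
have tE := union_bound_term n0' nu1_le
  (_ : _ <= cond_mutual_info p (fun t => t.1.2) (fun t => t.2.1)
    (fun t => (t.1.1.1, t.1.1.2))).
have {}tD := tD d ltac:(rewrite dE2; clear - Dr; lra).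
have {}tE := tE d ltac:(rewrite dE4; clear - h1 d0; lra).
have e_le : e <= d^-1 / n%:R by exact: expRN_le.
have Keps : K / n%:R <= eps by rewrite ler_pdivrMr // mulrC -ler_pdivrMr.
rewrite /error_bound !card_ord /rate_threshold -pE -/nu3.
apply: le_trans Keps; rewrite /K mulrDl mulrDr -/e in tD tE *.
by clear - tA tB tC tD tE e_le; lra.
Qed.

End Achievability.

Theorem theorem1 (R : realType) (X Y1 Y2 : finType) (W : X -> Y1 * Y2 -> R)
    (W_channel : transition W) (W_degraded : physically_degraded W)
    (C12 : R) (C12_ge0 : 0 <= C12) :
  capacity_region_at W C12 = rate_region W C12.
Proof.
have sl_cap : single_letter_region W C12 `<=` capacity_region_at W C12.
  move=> [[r1 r2] r3] sl; apply: subset_closure.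
  exact: single_letter_achievable.
apply/seteqP; split.
  move=> r /(capacity_sub_single_letter W_channel W_degraded) sl.
  exact: sub_gen_smallest.
apply: subset_trans sl_cap; apply: smallest_sub => //.
exact: single_letter_convex.
Qed.
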